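(* The following evaluations hold: (i) $\dfrac{\psi(-e^{-\pi/\sqrt5})}{e^{-\pi/(2\sqrt5)}\psi(-e^{-\sqrt5\pi})}=5^{1/4}$; (ii) $\dfrac{\psi(-e^{-3\pi/\sqrt5})}{e^{-3\pi/(2\sqrt5)}\psi(-e^{-3\sqrt5\pi})}=\dfrac{5^{1/4}(\sqrt3+1)(\sqrt5+\sqrt3)}{2}$; (iii) $\dfrac{\psi(-e^{-\pi/(3\sqrt5)})}{e^{-\pi/(3\sqrt5)}\psi(-e^{-3\pi/\sqrt5})}=\dfrac{\sqrt3(\sqrt3-1)(\sqrt5-\sqrt3)}{2}$; (iv) $\dfrac{\psi(-e^{-\pi/(3\sqrt3)})}{e^{-\pi/(12\sqrt3)}\psi(-e^{-\pi/\sqrt3})}=3^{-1/4}(\sqrt[3]4-1)$; (v) $\dfrac{\psi(-e^{-\pi})}{e^{-\pi/4}\psi(-e^{-3\pi})}=\sqrt[4]{3\sqrt3(2+\sqrt3)}$; (vi) $\dfrac{\psi(-e^{-\pi/(3\sqrt5)})}{e^{-\pi/(6\sqrt5)}\psi(-e^{-\sqrt5\pi/3})}=\dfrac{5^{1/4}(\sqrt3-1)(\sqrt5-\sqrt3)}{2}$; (vii) $\dfrac{\psi(-e^{-\sqrt5\pi/3})}{e^{-\sqrt5\pi/3}\psi(-e^{-3\sqrt5\pi})}=\dfrac{\sqrt3(\sqrt3+1)(\sqrt5+\sqrt3)}{2}$; (viii) $\dfrac{\psi(-e^{-\pi/\sqrt3})}{e^{-\pi/(4\sqrt3)}\psi(-e^{-\sqrt3\pi})}=3^{1/4}$;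 (ix) $\dfrac{\psi(-e^{-\sqrt3\pi})}{e^{-\sqrt3\pi/4}\psi(-e^{-3\sqrt3\pi})}=\dfrac{27^{1/4}}{\sqrt[3]4-1}$; (x) $\dfrac{\psi(-e^{-\pi/3})}{e^{-\pi/3}\psi(-e^{-3\pi})}=\sqrt3$; (xi) $\dfrac{\psi(-e^{-\pi/3})}{e^{-\pi/12}\psi(-e^{-\pi})}=\sqrt[4]{\sqrt3(2-\sqrt3)}$; (xii) $\dfrac{\psi(-e^{-\pi/\sqrt3})}{e^{-\pi/\sqrt3}\psi(-e^{-3\sqrt3\pi})}=\dfrac{3}{\sqrt[3]4-1}$; (xiii) $\dfrac{\psi(-e^{-\pi/(3\sqrt3)})}{e^{-\pi/(3\sqrt3)}\psi(-e^{-\sqrt3\pi})}=\sqrt[3]4-1$.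
   Context: For $|q|<1$, $\psi(q)=\sum_{n=0}^{\infty}q^{n(n+1)/2}$. All roots are positive real roots. *)

(* Defs.v *)
From Stdlib Require Import Reals.
From Coquelicot Require Import Coquelicot.
Open Scope R_scope.

(* Ramanujan's theta function psi(q) = sum_{n>=0} q^{n(n+1)/2}, for |q| < 1.
   The exponent n(n+1)/2 is an exact natural-number division. *)
Definition psi (q : R) : R :=
  Series (fun n : nat => q ^ ((n * (n + 1)) / 2)%nat).

(* Main.v *)
Require Import Defs.
From Stdlib Require Import Reals.
From Coquelicot Require Import Coquelicot.
From Stdlib Require Import Lra Lia Psatz ZArith List Permutation Classical ClassicalEpsilon.
Open Scope R_scope.

(** Write [chi = (2/.)] for the even character modulo 8 and
    [G t = sum_{n in Z} chi n e^{- pi t n^2 / 8}], so that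
    [psi (- e^{- pi t}) = e^{pi t / 8} G t / 2] and every quotient of the theorem is a quotient
    of values of [G].  Three facts give all of them.

    Inversion: [G (1/t) = sqrt t G t].  It reduces to Jacobi's inversion of [sum_n e^{- x n^2}],
    obtained as in Polya by averaging [(2 cos)^{2m}] over the angles [pi k / n] and letting
    [m, n] tend to infinity with [m / n^2] converging.

    Cubic relation: [G t ^ 4 + G (3t) ^ 4 = G (3t) (G (t/3) + G (3t)) ^ 3].  The vectors of [Z^4]
    reducing to the ternary tetracode modulo 3 form a copy of [Z^4] scaled by [sqrt 3], and the
    weight enumerator of the tetracode is [x^4 + 8 x y^3].  Together with inversion it settles
    the arguments in [Q] and in [Q sqrt 3].

    Degree 15: put [a = sqrt (th2 t th2 (15t))], [a' = sqrt (th2 (3t) th2 (5t))], and define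
    [b, b'] from [th3] and [c, c'] from [th4] in the same way.  Changes of variables between
    [3 m^2 + 5 n^2] and [i^2 + 15 j^2] give [a'^2 = a (b + c)], [b'^2 = b (a + c)],
    [c'^2 = c (a + b)] and [a' (b' - c') = a^2].  At [t = 1 / sqrt 5], inversion and the relation
    [th3 t th3 (3t) = th2 t th2 (3t) + th4 t th4 (3t)] turn these into algebraic equations, which
    determine [G (sqrt 5 / 3) / G (3 sqrt 5) = sqrt 3 a' c' / (a c)]. *)

(** * Unordered sums *)

(** The identities between theta series are reindexings of Z, Z^2 or Z^4, hence the unordered sums.
    The obstacle is the sign of [G]: duplication gives only G^2 = 2 th2 th4, so inversion and the
    product formulas of degree 15 have to be recovered from their squares, while the series of [G]
    has terms of both signs. Positivity comes out of the cubic relation itself: it passes from the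
    argument 9y down to y, and for large arguments the terms n = 1 and n = -1 dominate. In degree 15
    at t = 1 / sqrt 5, inversion leaves, besides the ratios a / b and c / b, the single unknown k =
    th2 (sqrt 5) / th4 (sqrt 5). Eliminating k shows that p = (a + c) / b satisfies (p^2 + 3p - 1)^2
    = 5 p^2, and a' c' / (a c) = (1 + p) / (1 - p) is then the positive root of m^2 - (3 + sqrt 5) m
    - 1 = 0, which is the origin of (sqrt 3 + 1)(sqrt 5 + sqrt 3) / 2. *)

Definition lsum {I : Type} (f : I -> R) (l : list I) : R :=
  fold_right (fun i s => f i + s) 0 l.

(** Convergence along the net of finite subsets, a finite subset being a list without repetition. *)
Definition has_sum {I : Type} (f : I -> R) (s : R) : Prop :=
  forall eps, 0 < eps ->
  exists l0, NoDup l0 /\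
    forall l, NoDup l -> incl l0 l -> Rabs (lsum f l - s) < eps.

Definition summable {I : Type} (f : I -> R) : Prop :=
  exists B, forall l, NoDup l -> lsum (fun i => Rabs (f i)) l <= B.

(** The value is meaningful only when [has_sum f] is inhabited; [summable] guarantees this. *)
Definition tsum {I : Type} (f : I -> R) : R := epsilon (inhabits 0) (has_sum f).

Definition dec_eq {I : Type} (x y : I) : {x = y} + {x <> y} :=
  excluded_middle_informative (x = y).

Definition decb (P : Prop) : bool := if excluded_middle_informative P then true else false.

Lemma decb_elim {P : Prop} : decb P = true -> P.
Proof. unfold decb; destruct excluded_middle_informative; congruence. Qed.

Lemma decb_intro {P : Prop} : P -> decb P = true.
Proof. unfold decb; destruct excluded_middle_informative; tauto. Qed.

Lemma lsum_ext {I} (f g : I -> R) l :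
  (forall i, In i l -> f i = g i) -> lsum f l = lsum g l.
Proof.
  induction l as [|x l IH]; simpl; intros H; auto.
  rewrite H, IH; auto.
Qed.

Lemma lsum_zero {I} (f : I -> R) l : (forall i, In i l -> f i = 0) -> lsum f l = 0.
Proof. induction l; simpl; intros H; [|rewrite H, IHl]; auto; ring. Qed.

Lemma lsum_app {I} (f : I -> R) l m : lsum f (l ++ m) = lsum f l + lsum f m.
Proof. induction l; simpl; [|rewrite IHl]; lra. Qed.

Lemma lsum_perm {I} (f : I -> R) l m : Permutation l m -> lsum f l = lsum f m.
Proof. induction 1; simpl; lra. Qed.

Lemma lsum_plus {I} (f g : I -> R) l : lsum (fun i => f i + g i) l = lsum f l + lsum g l.
Proof. induction l; simpl; [|rewrite IHl]; lra. Qed.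

Lemma lsum_scal {I} (c : R) (f : I -> R) l : lsum (fun i => c * f i) l = c * lsum f l.
Proof. induction l; simpl; [|rewrite IHl]; lra. Qed.

Lemma lsum_le {I} (f g : I -> R) l : (forall i, f i <= g i) -> lsum f l <= lsum g l.
Proof. intros H; induction l as [|x l IH]; simpl; [|specialize (H x)]; lra. Qed.

Lemma lsum_nonneg {I} (f : I -> R) l : (forall i, 0 <= f i) -> 0 <= lsum f l.
Proof. intros H; induction l as [|x l IH]; simpl; [|specialize (H x)]; lra. Qed.

Lemma lsum_abs {I} (f : I -> R) l : Rabs (lsum f l) <= lsum (fun i => Rabs (f i)) l.
Proof.
  induction l as [|x l IH]; simpl.
  - rewrite Rabs_R0; lra.
  - eapply Rle_trans; [apply Rabs_triang|lra].
Qed.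

Lemma lsum_map {I J} (f : I -> R) (p : J -> I) l : lsum f (map p l) = lsum (fun j => f (p j)) l.
Proof. induction l; simpl; [|rewrite IHl]; auto. Qed.

Lemma lsum_filter {I} (f : I -> R) (b : I -> bool) l :
  (forall i, b i = false -> f i = 0) -> lsum f (filter b l) = lsum f l.
Proof.
  intros H; induction l as [|x l IH]; simpl; auto.
  destruct (b x) eqn:E; simpl; rewrite IH; auto.
  rewrite (H x E); ring.
Qed.

Lemma lsum_incl {I} (f : I -> R) l m :
  (forall i, 0 <= f i) -> NoDup l -> incl l m -> lsum f l <= lsum f m.
Proof.
  intros Hf; revert m; induction l as [|x l IH]; intros m Hl Hm; simpl.
  - now apply lsum_nonneg.
  - inversion Hl as [|? ? Hx Hl']; subst.
    destruct (in_split x m) as [m1 [m2 ->]]; [apply Hm; now left|].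
    rewrite (lsum_perm f (m1 ++ x :: m2) (x :: m1 ++ m2)).
    2: symmetry; apply Permutation_middle.
    simpl; apply Rplus_le_compat_l, IH; auto.
    intros y Hy.
    assert (Hy' : In y (m1 ++ x :: m2)) by (apply Hm; now right).
    apply in_app_iff in Hy'; apply in_app_iff; simpl in Hy'.
    destruct Hy' as [?|[->|?]]; auto; contradiction.
Qed.

Lemma lsum_list_prod {I J} (f : I -> R) (g : J -> R) l m :
  lsum (fun v => f (fst v) * g (snd v)) (list_prod l m) = lsum f l * lsum g m.
Proof.
  induction l as [|x l IH]; simpl; [ring|].
  rewrite lsum_app, IH, lsum_map; simpl; rewrite lsum_scal; ring.
Qed.

Lemma NoDup_list_prod {I J} (l : list I) (m : list J) :
  NoDup l -> NoDup m -> NoDup (list_prod l m).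
Proof.
  intros Hl Hm; induction Hl as [|x l Hx Hl IH]; simpl; [constructor|].
  apply NoDup_app; auto.
  - apply FinFun.Injective_map_NoDup; auto; intros a b E; congruence.
  - intros [a b] H1 H2; apply in_map_iff in H1; destruct H1 as [c [E _]].
    inversion E; subst; apply in_prod_iff in H2; tauto.
Qed.

Definition lunion {I} (l m : list I) : list I := nodup dec_eq (l ++ m).

Lemma lunion_NoDup {I} (l m : list I) : NoDup (lunion l m).
Proof. apply NoDup_nodup. Qed.

Lemma lunion_l {I} (l m : list I) : incl l (lunion l m).
Proof. intros x Hx; apply nodup_In, in_app_iff; auto. Qed.

Lemma lunion_r {I} (l m : list I) : incl m (lunion l m).
Proof. intros x Hx; apply nodup_In, in_app_iff; auto. Qed.

Lemma has_sum_unique {I} (f : I -> R) s r : has_sum f s -> has_sum f r -> s = r.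
Proof.
  intros Hs Hr; apply cond_eq; intros eps He.
  destruct (Hs (eps / 2)) as [l [_ Hl]]; [lra|].
  destruct (Hr (eps / 2)) as [m [_ Hm]]; [lra|].
  specialize (Hl _ (lunion_NoDup l m) (lunion_l l m)).
  specialize (Hm _ (lunion_NoDup l m) (lunion_r l m)).
  apply Rabs_def2 in Hl; apply Rabs_def2 in Hm; apply Rabs_def1; lra.
Qed.

Lemma tsum_eq {I} (f : I -> R) s : has_sum f s -> tsum f = s.
Proof.
  intros H; apply (has_sum_unique f); auto.
  unfold tsum; apply epsilon_spec; eauto.
Qed.

Lemma has_sum_plus {I} (f g : I -> R) s r :
  has_sum f s -> has_sum g r -> has_sum (fun i => f i + g i) (s + r).
Proof.
  intros Hs Hr eps He.
  destruct (Hs (eps / 2)) as [l [_ Hl]]; [lra|].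
  destruct (Hr (eps / 2)) as [m [_ Hm]]; [lra|].
  exists (lunion l m); split; [apply lunion_NoDup|intros k Hk Hi].
  specialize (Hl k Hk (fun x H => Hi x (lunion_l l m x H))).
  specialize (Hm k Hk (fun x H => Hi x (lunion_r l m x H))).
  rewrite lsum_plus.
  apply Rabs_def2 in Hl; apply Rabs_def2 in Hm; apply Rabs_def1; lra.
Qed.

Lemma has_sum_scal {I} (c : R) (f : I -> R) s :
  has_sum f s -> has_sum (fun i => c * f i) (c * s).
Proof.
  intros Hs eps He.
  assert (Hc : 0 < Rabs c + 1) by (pose proof (Rabs_pos c); lra).
  destruct (Hs (eps / (Rabs c + 1))) as [l [Hl0 Hl]]; [now apply Rdiv_lt_0_compat|].
  exists l; split; auto; intros k Hk Hi; specialize (Hl k Hk Hi).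
  rewrite lsum_scal.
  replace (c * lsum f k - c * s) with (c * (lsum f k - s)) by ring; rewrite Rabs_mult.
  apply Rle_lt_trans with ((Rabs c) * (eps / (Rabs c + 1))).
  - apply Rmult_le_compat_l; [apply Rabs_pos|lra].
  - apply Rlt_le_trans with ((Rabs c + 1) * (eps / (Rabs c + 1))).
    + apply Rmult_lt_compat_r; [now apply Rdiv_lt_0_compat|lra].
    + right; field; lra.
Qed.

Lemma has_sum_ext {I} (f g : I -> R) s : (forall i, f i = g i) -> has_sum f s -> has_sum g s.
Proof.
  intros H Hs eps He; destruct (Hs eps He) as [l [H1 H2]].
  exists l; split; auto; intros k Hk Hi; rewrite (lsum_ext g f); auto.
Qed.

Lemma tsum_ext {I} (f g : I -> R) : (forall i, f i = g i) -> tsum f = tsum g.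
Proof.
  intros H; replace g with f; auto.
  now apply FunctionalExtensionality.functional_extensionality.
Qed.

Lemma summable_le {I} (f g : I -> R) :
  (forall i, Rabs (f i) <= g i) -> summable g -> summable f.
Proof.
  intros H [B HB]; exists B; intros l Hl.
  eapply Rle_trans; [|apply HB, Hl]; apply lsum_le; intros i.
  eapply Rle_trans; [apply H|apply Rle_abs].
Qed.

Lemma summable_ext {I} (f g : I -> R) : (forall i, f i = g i) -> summable f -> summable g.
Proof.
  intros H [B HB]; exists B; intros l Hl.
  rewrite (lsum_ext _ (fun i => Rabs (f i))); auto; intros; now rewrite H.
Qed.

Lemma summable_abs {I} (f : I -> R) : summable f -> summable (fun i => Rabs (f i)).
Proof.
  intros [B HB]; exists B; intros l Hl.
  rewrite (lsum_ext _ (fun i => Rabs (f i))); auto; intros; apply Rabs_Rabsolu.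
Qed.

Lemma summable_plus {I} (f g : I -> R) :
  summable f -> summable g -> summable (fun i => f i + g i).
Proof.
  intros [B HB] [C HC]; exists (B + C); intros l Hl.
  eapply Rle_trans; [apply lsum_le; intros i; apply Rabs_triang|].
  rewrite lsum_plus; specialize (HB l Hl); specialize (HC l Hl); lra.
Qed.

Lemma summable_scal {I} (c : R) (f : I -> R) : summable f -> summable (fun i => c * f i).
Proof.
  intros [B HB]; exists (Rabs c * B); intros l Hl.
  rewrite (lsum_ext _ (fun i => Rabs c * Rabs (f i))).
  - rewrite lsum_scal; apply Rmult_le_compat_l; auto using Rabs_pos.
  - intros; apply Rabs_mult.
Qed.

Lemma summable_comp {I J} (f : I -> R) (p : J -> I) :
  (forall i j, p i = p j -> i = j) -> summable f -> summable (fun j => f (p j)).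
Proof.
  intros Hp [B HB]; exists B; intros l Hl.
  rewrite <- (lsum_map (fun i => Rabs (f i)) p); apply HB.
  now apply FinFun.Injective_map_NoDup.
Qed.

Lemma summable_prod {I J} (f : I -> R) (g : J -> R) :
  summable f -> summable g -> summable (fun v => f (fst v) * g (snd v)).
Proof.
  intros [B HB] [C HC]; exists (B * C); intros l Hl.
  set (l1 := nodup dec_eq (map fst l)); set (l2 := nodup dec_eq (map snd l)).
  assert (H1 := HB l1 (NoDup_nodup _ _)); assert (H2 := HC l2 (NoDup_nodup _ _)).
  rewrite (lsum_ext _ (fun v => Rabs (f (fst v)) * Rabs (g (snd v)))).
  2: intros; apply Rabs_mult.
  eapply Rle_trans; [apply (lsum_incl _ l (list_prod l1 l2)); auto|].
  - intros; apply Rmult_le_pos; apply Rabs_pos.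
  - intros [a b] Hv; apply in_prod_iff; split; apply nodup_In, in_map_iff;
      exists (a, b); auto.
  - rewrite (lsum_list_prod (fun i => Rabs (f i)) (fun j => Rabs (g j))).
    apply Rmult_le_compat; auto; apply lsum_nonneg; intros; apply Rabs_pos.
Qed.

Lemma nonneg_has_sum {I} (f : I -> R) :
  (forall i, 0 <= f i) -> summable f -> exists s, has_sum f s.
Proof.
  intros Hf [B HB].
  destruct (completeness (fun x => exists l, NoDup l /\ x = lsum f l)) as [s [Hs1 Hs2]].
  - exists B; intros x [l [Hl ->]]; eapply Rle_trans; [|apply HB, Hl].
    apply lsum_le; intros; apply Rle_abs.
  - exists 0, nil; split; [constructor|reflexivity].
  - exists s; intros eps He.
    destruct (classic (exists l, NoDup l /\ s - eps < lsum f l)) as [[l [Hl Hsl]]|HN].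
    + exists l; split; auto; intros m Hm Hi.
      assert (lsum f m <= s) by (apply Hs1; eauto).
      assert (lsum f l <= lsum f m) by (apply lsum_incl; auto).
      apply Rabs_def1; lra.
    + exfalso; assert (s <= s - eps); [|lra].
      apply Hs2; intros x [l [Hl ->]].
      destruct (Rle_dec (lsum f l) (s - eps)); auto.
      exfalso; apply HN; exists l; split; auto; lra.
Qed.

Lemma summable_has_sum {I} (f : I -> R) : summable f -> has_sum f (tsum f).
Proof.
  intros H; unfold tsum; apply epsilon_spec.
  destruct (nonneg_has_sum (fun i => Rabs (f i) + f i)) as [s Hs].
  - intros i; assert (H1 := Rle_abs (- f i)); rewrite Rabs_Ropp in H1; lra.
  - apply summable_plus; auto using summable_abs.
  - destruct (nonneg_has_sum (fun i => Rabs (f i))) as [r Hr]; auto using summable_abs, Rabs_pos.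
    exists (s + -1 * r).
    apply (has_sum_ext (fun i => (Rabs (f i) + f i) + -1 * Rabs (f i))); [intros; ring|].
    apply has_sum_plus; auto using has_sum_scal.
Qed.

Lemma tsum_plus {I} (f g : I -> R) :
  summable f -> summable g -> tsum (fun i => f i + g i) = tsum f + tsum g.
Proof. intros; apply tsum_eq, has_sum_plus; now apply summable_has_sum. Qed.

Lemma tsum_scal {I} (c : R) (f : I -> R) :
  summable f -> tsum (fun i => c * f i) = c * tsum f.
Proof. intros; apply tsum_eq, has_sum_scal; now apply summable_has_sum. Qed.

Lemma lsum_le_tsum {I} (f : I -> R) l :
  (forall i, 0 <= f i) -> summable f -> NoDup l -> lsum f l <= tsum f.
Proof.
  intros Hf Hs Hl; apply le_epsilon; intros eps He.
  destruct (summable_has_sum f Hs eps He) as [m [Hm H]].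
  specialize (H (lunion l m) (lunion_NoDup _ _) (lunion_r _ _)).
  assert (lsum f l <= lsum f (lunion l m)) by (apply lsum_incl; auto using lunion_l).
  apply Rabs_def2 in H; lra.
Qed.

Lemma tsum_pos {I} (f : I -> R) i :
  (forall j, 0 <= f j) -> summable f -> 0 < f i -> 0 < tsum f.
Proof.
  intros Hf Hs Hi; eapply Rlt_le_trans; [|apply (lsum_le_tsum f (i :: nil)); auto].
  - simpl; lra.
  - constructor; [intros []|constructor].
Qed.

Lemma tsum_prod {I J} (f : I -> R) (g : J -> R) :
  summable f -> summable g ->
  tsum (fun v => f (fst v) * g (snd v)) = tsum f * tsum g.
Proof.
  intros Hf Hg.
  assert (Hp := summable_has_sum _ (summable_prod f g Hf Hg)).
  set (p := tsum (fun v => f (fst v) * g (snd v))) in *.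
  apply summable_has_sum in Hf; apply summable_has_sum in Hg.
  set (s := tsum f) in *; set (r := tsum g) in *.
  apply cond_eq; intros eps He.
  (* The error is at most d from [p] plus d (1 + |s| + |r|) from the product of the two partial
     sums, hence the denominator. *)
  set (d := Rmin 1 (eps / (2 + Rabs s + Rabs r))).
  assert (Hden : 0 < 2 + Rabs s + Rabs r)
    by (pose proof (Rabs_pos s); pose proof (Rabs_pos r); lra).
  assert (Hd : 0 < d) by (apply Rmin_pos; [lra|now apply Rdiv_lt_0_compat]).
  assert (Hd1 : d <= 1) by apply Rmin_l.
  assert (Hd2 : d * (2 + Rabs s + Rabs r) <= eps).
  { apply Rle_trans with (eps / (2 + Rabs s + Rabs r) * (2 + Rabs s + Rabs r)).
    - apply Rmult_le_compat_r; [lra|apply Rmin_r].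
    - right; field; lra. }
  destruct (Hp d Hd) as [l [_ Hl]].
  destruct (Hf d Hd) as [l1 [_ Hl1]].
  destruct (Hg d Hd) as [l2 [_ Hl2]].
  (* A rectangle that contains [l] and whose sides contain [l1] and [l2]. *)
  set (m1 := lunion (map fst l) l1); set (m2 := lunion (map snd l) l2).
  specialize (Hl1 m1 (lunion_NoDup _ _) (lunion_r _ _)).
  specialize (Hl2 m2 (lunion_NoDup _ _) (lunion_r _ _)).
  specialize (Hl (list_prod m1 m2)
    (NoDup_list_prod _ _ (lunion_NoDup _ _) (lunion_NoDup _ _))).
  rewrite lsum_list_prod in Hl.
  assert (Hi : incl l (list_prod m1 m2)).
  { intros [a b] Hv; apply in_prod_iff; split; apply lunion_l, in_map_iff; exists (a, b); auto. }
  specialize (Hl Hi).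
  set (x := lsum f m1) in *; set (y := lsum g m2) in *.
  assert (Rabs (x * y - s * r) < d * (1 + Rabs s + Rabs r)).
  { replace (x * y - s * r) with ((x - s) * (y - r) + (s * (y - r) + r * (x - s))) by ring.
    eapply Rle_lt_trans; [apply Rabs_triang|].
    eapply Rle_lt_trans; [apply Rplus_le_compat_l, Rabs_triang|].
    rewrite !Rabs_mult.
    assert (Rabs (x - s) * Rabs (y - r) < d * 1).
    { apply Rmult_le_0_lt_compat; auto using Rabs_pos; lra. }
    assert (Rabs s * Rabs (y - r) <= Rabs s * d)
      by (apply Rmult_le_compat_l; [apply Rabs_pos|lra]).
    assert (Rabs r * Rabs (x - s) <= Rabs r * d)
      by (apply Rmult_le_compat_l; [apply Rabs_pos|lra]).
    lra. }
  replace (p - s * r) with ((x * y - s * r) - (x * y - p)) by ring.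
  eapply Rle_lt_trans; [apply Rabs_triang|]; rewrite Rabs_Ropp; lra.
Qed.

(** The maps need to be mutually inverse on the supports only. Inverse substitutions can therefore
    be written with floor division, whatever they do outside the relevant congruence classes. *)
Lemma tsum_bij {I J} (f : I -> R) (h : J -> R) (p : J -> I) (q : I -> J) :
  summable f ->
  (forall j, h j <> 0 -> q (p j) = j /\ f (p j) = h j) ->
  (forall i, f i <> 0 -> p (q i) = i /\ h (q i) = f i) ->
  tsum h = tsum f.
Proof.
  intros Hs Hj Hi; apply tsum_eq; intros eps He.
  destruct (summable_has_sum f Hs eps He) as [l0 [_ Hl0]].
  exists (nodup dec_eq (map q l0)); split; [apply NoDup_nodup|]; intros l Hl Hin.
  (* [l1] is the image of the support part of [l], and [l2] collects the members of [l0] missing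
     from it. There [f] vanishes, so appending [l2] covers [l0] without changing the sum. *)
  set (l1 := map p (filter (fun j => decb (h j <> 0)) l)).
  set (l2 := filter (fun i => decb (~ In i l1)) (nodup dec_eq l0)).
  assert (H1 : lsum f l1 = lsum h l).
  { unfold l1; rewrite lsum_map, <- (lsum_filter h (fun j => decb (h j <> 0))).
    - apply lsum_ext; intros j H; apply filter_In in H; destruct H as [_ H].
      apply decb_elim in H; exact (proj2 (Hj j H)).
    - intros j H; apply NNPP; intros H'; apply decb_intro in H'; congruence. }
  assert (H2 : lsum f l2 = 0).
  { apply lsum_zero; intros i H; apply filter_In in H; destruct H as [Hil0 H].
    apply decb_elim in H; apply NNPP; intros Hfi; apply H.
    destruct (Hi i Hfi) as [E1 E2]; rewrite <- E1; apply in_map, filter_In; split.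
    - apply Hin, nodup_In, in_map; now apply nodup_In in Hil0.
    - apply decb_intro; congruence. }
  replace (lsum h l) with (lsum f (l1 ++ l2)) by (rewrite lsum_app; lra).
  apply Hl0.
  - apply NoDup_app.
    + unfold l1.
      assert (Hnd : NoDup (filter (fun j => decb (h j <> 0)) l)) by now apply NoDup_filter.
      assert (Hall : forall j, In j (filter (fun j => decb (h j <> 0)) l) -> h j <> 0).
      { intros j H; apply filter_In in H; now apply decb_elim. }
      clear - Hnd Hall Hj; induction Hnd as [|x m Hx Hm IH]; simpl; constructor.
      * intros H; apply in_map_iff in H; destruct H as [y [E Hy]].
        apply Hx; replace x with y; auto.
        rewrite <- (proj1 (Hj x (Hall x (or_introl eq_refl)))), <- E.
        symmetry; apply Hj, Hall; now right.
      * apply IH; intros; apply Hall; now right.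
    + apply NoDup_filter, NoDup_nodup.
    + intros i H H'; apply filter_In in H'; destruct H' as [_ H']; now apply decb_elim in H'.
  - intros i Hil0; apply in_app_iff; destruct (classic (In i l1)) as [H|H]; [now left|right].
    apply filter_In; split; [now apply nodup_In|now apply decb_intro].
Qed.

(** Tannery's theorem, that is dominated convergence for sums. *)
Lemma tsum_lim {I} (a : nat -> I -> R) (b g : I -> R) :
  summable g -> (forall n i, Rabs (a n i) <= g i) ->
  (forall i, is_lim_seq (fun n => a n i) (b i)) ->
  is_lim_seq (fun n => tsum (a n)) (tsum b).
Proof.
  intros Hg Ha Hl.
  assert (Hb : forall i, Rabs (b i) <= g i).
  { intros i; apply (is_lim_seq_le (fun n => Rabs (a n i)) (fun _ => g i) (Rabs (b i)) (g i)).
    - intros; apply Ha.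
    - apply (is_lim_seq_abs (fun n => a n i) (b i)), Hl.
    - apply is_lim_seq_const. }
  assert (Sg := summable_has_sum g Hg).
  assert (Sa : forall n, has_sum (a n) (tsum (a n))).
  { intros n; apply summable_has_sum, (summable_le _ g); auto. }
  assert (Sb : has_sum b (tsum b)) by (apply summable_has_sum, (summable_le _ g); auto).
  apply is_lim_seq_spec; intros eps.
  (* Outside [l0] every family dominated by [g] contributes less than 3 d; the two tails and the
     finite part add up to less than 7 d. *)
  set (d := eps / 8).
  assert (Hd : 0 < d) by (unfold d; pose proof (cond_pos eps); lra).
  destruct (Sg d Hd) as [l0 [Hl0 Htail]].
  assert (Tail : forall (c : I -> R) s, (forall i, Rabs (c i) <= g i) -> has_sum c s ->
            Rabs (lsum c l0 - s) < 3 * d).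
  { intros c s Hc Sc; destruct (Sc d Hd) as [m [_ Hm]].
    set (k := filter (fun i => decb (~ In i l0)) (nodup dec_eq m)).
    assert (Hk : NoDup (l0 ++ k)).
    { apply NoDup_app; auto.
      - apply NoDup_filter, NoDup_nodup.
      - intros i H H'; apply filter_In in H'; destruct H' as [_ H']; now apply decb_elim in H'. }
    assert (Hm' : incl m (l0 ++ k)).
    { intros i H; apply in_app_iff; destruct (classic (In i l0)); [now left|right].
      apply filter_In; split; [now apply nodup_In|now apply decb_intro]. }
    specialize (Hm _ Hk Hm').
    assert (H1 := Htail _ Hk (fun i H => proj2 (in_app_iff l0 k i) (or_introl H))).
    assert (H2 := Htail _ Hl0 (fun i H => H)).
    rewrite lsum_app in Hm, H1.
    assert (H3 : Rabs (lsum c k) <= lsum g k).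
    { eapply Rle_trans; [apply lsum_abs|now apply lsum_le]. }
    apply Rabs_def2 in H1; apply Rabs_def2 in H2; apply Rabs_def2 in Hm.
    apply Rabs_le_between in H3; apply Rabs_def1; lra. }
  assert (Hfin : is_lim_seq (fun n => lsum (a n) l0) (lsum b l0)).
  { clear - Hl; induction l0 as [|x l IH]; simpl; [apply is_lim_seq_const|].
    apply (is_lim_seq_plus' _ _ _ _ (Hl x) IH). }
  apply is_lim_seq_spec in Hfin; destruct (Hfin (mkposreal d Hd)) as [N HN].
  exists N; intros n Hn; specialize (HN n Hn); simpl in HN.
  assert (H1 := Tail _ _ (Ha n) (Sa n)); assert (H2 := Tail _ _ Hb Sb).
  apply Rabs_def2 in HN; apply Rabs_def2 in H1; apply Rabs_def2 in H2.
  unfold d in *; apply Rabs_def1; lra.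
Qed.

(** * Gaussian sums and a finite trigonometric identity *)

Lemma lsum_geom (r : R) n : lsum (fun k => r ^ k) (seq 0 n) * (1 - r) = 1 - r ^ n.
Proof.
  induction n as [|n IH]; [simpl; ring|].
  rewrite seq_S, lsum_app, Rmult_plus_distr_r, IH; simpl; ring.
Qed.

Lemma Z_list_bound (l : list Z) : exists n : nat, forall z, In z l -> (Z.abs z < Z.of_nat n)%Z.
Proof.
  induction l as [|x l [n Hn]]; [exists O; intros z []|].
  exists (Nat.max n (S (Z.abs_nat x))); intros z [->|H]; [|apply Hn in H]; lia.
Qed.

Lemma summable_geom (r : R) : 0 <= r < 1 -> summable (fun n : Z => r ^ Z.abs_nat n).
Proof.
  intros Hr; exists (2 * / (1 - r)); intros l Hl.
  destruct (Z_list_bound l) as [n Hn].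
  assert (Hp : forall k, 0 <= r ^ k) by (intros; apply pow_le; lra).
  eapply Rle_trans.
  - apply (lsum_incl _ l (map Z.of_nat (seq 0 n) ++ map (fun k => (- Z.of_nat k)%Z) (seq 0 n)));
      auto using Rabs_pos.
    intros z Hz; apply Hn in Hz; apply in_app_iff.
    destruct (Z_le_gt_dec 0 z); [left|right]; apply in_map_iff; exists (Z.abs_nat z);
      (split; [lia|apply in_seq; lia]).
  - rewrite lsum_app, !lsum_map.
    rewrite (lsum_ext _ (fun k => r ^ k)), (lsum_ext (fun _ => Rabs (r ^ Z.abs_nat (- _))) (fun k => r ^ k)).
    + assert (H := lsum_geom r n).
      assert (lsum (fun k => r ^ k) (seq 0 n) <= / (1 - r)); [|lra].
      apply (Rmult_le_reg_r (1 - r)); [lra|]; rewrite H, Rinv_l; [|lra].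
      specialize (Hp n); lra.
    + intros k _; rewrite Rabs_pos_eq; auto; f_equal; lia.
    + intros k _; rewrite Rabs_pos_eq; auto; f_equal; lia.
Qed.

Lemma exp_pow (x : R) n : exp x ^ n = exp (INR n * x).
Proof.
  induction n as [|n IH]; simpl pow.
  - simpl; rewrite Rmult_0_l, exp_0; ring.
  - rewrite IH, <- exp_plus, S_INR; f_equal; ring.
Qed.

Lemma exp_le (x y : R) : x <= y -> exp x <= exp y.
Proof. intros [H| ->]; [left; now apply exp_increasing|lra]. Qed.

Lemma summable_gauss (x : R) : 0 < x -> summable (fun n : Z => exp (- (x * IZR (n * n)))).
Proof.
  intros Hx; apply (summable_le _ (fun n => exp (- x) ^ Z.abs_nat n)).
  - intros n; rewrite Rabs_pos_eq by (left; apply exp_pos).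
    rewrite exp_pow; apply exp_le.
    assert (INR (Z.abs_nat n) <= IZR (n * n)); [|nra].
    rewrite INR_IZR_INZ; apply IZR_le; nia.
  - apply summable_geom; split; [left; apply exp_pos|].
    rewrite <- exp_0; apply exp_increasing; lra.
Qed.

(** The weights are integers, so that identities between them are congruence statements, settled by
    [lia] or by finite computation. *)
Definition th (c : Z -> Z) (x : R) : R :=
  tsum (fun n => IZR (c n) * exp (- (x * IZR (n * n)))).

Definition bounded1 {I : Type} (c : I -> Z) : Prop := forall i, (-1 <= c i <= 1)%Z.

Lemma summable_weight {I} (c : I -> Z) (g : I -> R) :
  bounded1 c -> (forall i, 0 <= g i) -> summable g -> summable (fun i => IZR (c i) * g i).
Proof.
  intros Hc Hg; apply summable_le; intros i.
  rewrite Rabs_mult, (Rabs_pos_eq (g i)); auto.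
  rewrite <- (Rmult_1_l (g i)) at 2; apply Rmult_le_compat_r; auto.
  destruct (Hc i) as [H1 H2]; apply IZR_le in H1, H2; apply Rabs_le; lra.
Qed.

Lemma summable_th (c : Z -> Z) (x : R) : bounded1 c -> 0 < x ->
  summable (fun n => IZR (c n) * exp (- (x * IZR (n * n)))).
Proof.
  intros Hc Hx; apply summable_weight; auto using summable_gauss.
  intros; left; apply exp_pos.
Qed.

Definition indic (b : bool) : Z := if b then 1%Z else 0%Z.
(** [ones], [sgn] and [odd] are the weights of Jacobi's th3, th4 and th2, the half-integers of th2
    being doubled to odd integers. *)
Definition ones (n : Z) : Z := 1%Z.
Definition sgn (n : Z) : Z := if (n mod 2 =? 0)%Z then 1%Z else (-1)%Z.
Definition odd (n : Z) : Z := indic (n mod 2 =? 1)%Z.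
Definition chi (n : Z) : Z :=
  match (n mod 8)%Z with 1%Z | 7%Z => 1%Z | 3%Z | 5%Z => (-1)%Z | _ => 0%Z end.

Lemma tsum_lsum {I J} (F : I -> J -> R) (l : list I) :
  (forall i, summable (F i)) ->
  summable (fun j => lsum (fun i => F i j) l) /\
  tsum (fun j => lsum (fun i => F i j) l) = lsum (fun i => tsum (F i)) l.
Proof.
  intros H; induction l as [|x l [IH1 IH2]]; simpl.
  - split; [exists 0; intros l _; right; apply lsum_zero; intros; apply Rabs_R0|].
    apply tsum_eq; intros eps He; exists nil; split; [constructor|]; intros.
    rewrite lsum_zero; auto; rewrite Rminus_0_r, Rabs_R0; auto.
  - split; [now apply summable_plus|]; rewrite tsum_plus, IH2; auto.
Qed.

Lemma finite_support {I} (f : I -> R) (l : list I) :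
  NoDup l -> (forall i, ~ In i l -> f i = 0) -> summable f /\ tsum f = lsum f l.
Proof.
  intros Hl Hf.
  assert (Key : forall (g : I -> R) k, (forall i, ~ In i l -> g i = 0) -> NoDup k ->
            lsum g k = lsum g (filter (fun i => decb (In i k)) l)).
  { intros g k Hg Hk; rewrite <- (lsum_filter g (fun i => decb (In i l)) k).
    - apply lsum_perm, NoDup_Permutation; auto using NoDup_filter.
      intros i; split; intros H; apply filter_In in H; destruct H as [H1 H2];
        apply decb_elim in H2; apply filter_In; split; auto using @decb_intro.
    - intros i Hi; apply Hg; intros H; apply decb_intro in H; congruence. }
  split.
  - exists (lsum (fun i => Rabs (f i)) l); intros k Hk.
    rewrite (Key (fun i => Rabs (f i)) k); auto.
    + apply lsum_incl; auto using NoDup_filter, Rabs_pos.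
      intros i H; now apply filter_In in H.
    + intros i H; rewrite Hf; auto; apply Rabs_R0.
  - apply tsum_eq; intros eps He; exists l; split; auto; intros k Hk Hi.
    rewrite (Key f k Hf Hk), (lsum_perm f _ l).
    + rewrite Rminus_diag, Rabs_R0; auto.
    + apply NoDup_Permutation; auto using NoDup_filter.
      intros i; split; intros H; [now apply filter_In in H|].
      apply filter_In; split; auto; apply decb_intro; auto.
Qed.

(* [W m s] is the binomial coefficient (2m choose m+s), for an integer s of any sign. *)
Fixpoint W (m : nat) (s : Z) : R :=
  match m with
  | O => if Z.eqb s 0 then 1 else 0
  | S m => W m (s - 1) + 2 * W m s + W m (s + 1)
  end.

Lemma W_nonneg m s : 0 <= W m s.
Proof.
  revert s; induction m as [|m IH]; intros s; simpl; [destruct Z.eqb; lra|].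
  pose proof (IH (s - 1)%Z); pose proof (IH s); pose proof (IH (s + 1)%Z); lra.
Qed.

Lemma W_opp m s : W m (- s) = W m s.
Proof.
  revert s; induction m as [|m IH]; intros s; simpl.
  - destruct (Z.eqb_spec (- s) 0), (Z.eqb_spec s 0); auto; lia.
  - replace (- s - 1)%Z with (- (s + 1))%Z by ring.
    replace (- s + 1)%Z with (- (s - 1))%Z by ring.
    rewrite !IH; ring.
Qed.

Lemma W_0_pos m : 0 < W m 0.
Proof.
  induction m as [|m IH]; simpl; [lra|].
  pose proof (W_nonneg m (-1)); pose proof (W_nonneg m 1); lra.
Qed.

(** The quotient of neighbouring binomial coefficients, cleared of denominators so that it holds for
    every integer s and passes through the Pascal recursion. *)
Lemma W_ratio m s : (INR m - IZR s) * W m s = (INR m + IZR s + 1) * W m (s + 1).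
Proof.
  revert s; induction m as [|m IH]; intros s.
  - simpl; destruct (Z.eqb_spec s 0) as [H|H], (Z.eqb_spec (s + 1) 0) as [H'|H']; try (exfalso; lia).
    + subst; simpl; ring.
    + replace s with (-1)%Z by lia; simpl; ring.
    + ring.
  - rewrite S_INR; simpl.
    assert (H1 := IH (s - 1)%Z); assert (H2 := IH s); assert (H3 := IH (s + 1)%Z).
    replace (s - 1 + 1)%Z with s in H1 by ring; replace (s + 1 - 1)%Z with s by ring.
    rewrite minus_IZR in H1; rewrite plus_IZR in H3; nra.
Qed.

Lemma W_out m s : (Z.of_nat m < s)%Z -> W m s = 0.
Proof.
  revert s; induction m as [|m IH]; intros s H; simpl.
  - destruct (Z.eqb_spec s 0); auto; lia.
  - rewrite !IH; try lia; ring.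
Qed.

Lemma summable_W m : summable (W m).
Proof.
  induction m as [|m IH]; simpl.
  - apply (finite_support _ (0%Z :: nil)).
    + constructor; [intros []|constructor].
    + intros i H; destruct (Z.eqb_spec i 0); auto; subst; simpl in H; tauto.
  - apply summable_plus; [apply summable_plus|].
    + apply (summable_comp (W m) (fun s => (s - 1)%Z)); auto; intros; lia.
    + now apply summable_scal.
    + apply (summable_comp (W m) (fun s => (s + 1)%Z)); auto; intros; lia.
Qed.

Lemma summable_W_cos m (g : Z -> R) : (forall s, Rabs (g s) <= 1) ->
  summable (fun s => W m s * g s).
Proof.
  intros Hg; apply (summable_le _ (W m)); [|apply summable_W].
  intros s; rewrite Rabs_mult, (Rabs_pos_eq _ (W_nonneg m s)).
  rewrite <- (Rmult_1_r (W m s)) at 2; apply Rmult_le_compat_l; auto using W_nonneg.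
Qed.

Lemma Rabs_cos_le x : Rabs (cos x) <= 1.
Proof. apply Rabs_le, COS_bound. Qed.

(** The binomial expansion of (e^{it} + e^{-it})^{2m} in real form. Multiplication by (2 cos t)^2 =
    2 + 2 cos 2t shifts s by one in both directions, which is the recursion of [W] after
    reindexing. *)
Lemma W_cos m t : tsum (fun s => W m s * cos (2 * IZR s * t)) = (2 * cos t) ^ (2 * m).
Proof.
  induction m as [|m IH].
  - destruct (finite_support (fun s => W 0 s * cos (2 * IZR s * t)) (0%Z :: nil)) as [_ ->].
    + constructor; [intros []|constructor].
    + intros i H; simpl; destruct (Z.eqb_spec i 0); [|ring]; subst; simpl in H; tauto.
    + simpl; replace (2 * 0 * t) with 0 by ring; rewrite cos_0; ring.
  - replace (2 * S m)%nat with (2 + 2 * m)%nat by lia; rewrite pow_add, <- IH.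
    assert (E : (2 * cos t) ^ 2 = 2 + 2 * cos (2 * t)).
    { rewrite cos_2a_cos; ring. }
    rewrite E, <- tsum_scal.
    2: apply summable_W_cos; intros; apply Rabs_cos_le.
    simpl W.
    rewrite (tsum_ext _ (fun s => (W m (s - 1) * cos (2 * IZR s * t) +
        2 * (W m s * cos (2 * IZR s * t))) + W m (s + 1) * cos (2 * IZR s * t))) by (intros; ring).
    rewrite (tsum_ext (fun i => (2 + 2 * cos (2 * t)) * _) (fun s =>
        (W m s * cos (2 * IZR (s + 1) * t) + 2 * (W m s * cos (2 * IZR s * t)))
         + W m s * cos (2 * IZR (s - 1) * t))).
    2: { intros s; rewrite plus_IZR, minus_IZR.
         replace (2 * (IZR s + 1) * t) with (2 * IZR s * t + 2 * t) by ring.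
         replace (2 * (IZR s - 1) * t) with (2 * IZR s * t - 2 * t) by ring.
         rewrite cos_plus, cos_minus; ring. }
    assert (B : forall p : Z -> R, summable (fun s => W m s * cos (p s)))
      by (intros; apply summable_W_cos; intros; apply Rabs_cos_le).
    assert (B1 : summable (fun s => W m (s - 1) * cos (2 * IZR s * t))).
    { apply (summable_ext (fun s => W m (s - 1) * cos (2 * IZR ((s - 1) + 1) * t))).
      - intros s; do 4 f_equal; f_equal; ring.
      - apply (summable_comp (fun s => W m s * cos (2 * IZR (s + 1) * t)) (fun s => (s - 1)%Z)); auto;
        intros; lia. }
    assert (B2 : summable (fun s => W m (s + 1) * cos (2 * IZR s * t))).
    { apply (summable_ext (fun s => W m (s + 1) * cos (2 * IZR ((s + 1) - 1) * t))).
      - intros s; do 4 f_equal; f_equal; ring.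
      - apply (summable_comp (fun s => W m s * cos (2 * IZR (s - 1) * t)) (fun s => (s + 1)%Z)); auto;
        intros; lia. }
    rewrite !tsum_plus; auto using summable_plus, summable_scal.
    f_equal; [f_equal|].
    + symmetry; apply (tsum_bij _ _ (fun s => (s + 1)%Z) (fun s => (s - 1)%Z)); auto.
      * intros j _; split; [lia|]; do 2 f_equal; lia.
      * intros j _; split; [lia|]; do 2 f_equal; do 3 f_equal; lia.
    + symmetry; apply (tsum_bij _ _ (fun s => (s - 1)%Z) (fun s => (s + 1)%Z)); auto.
      * intros j _; split; [lia|]; do 2 f_equal; lia.
      * intros j _; split; [lia|]; do 2 f_equal; do 3 f_equal; lia.
Qed.

(** The residues modulo n = 2h + 1, taken symmetrically: the angles pi k / n then stay within
    [-pi/2, pi/2], where cos^2 has its only peak at 0. *)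
Definition zrange (h : nat) : list Z := map (fun i => (Z.of_nat i - Z.of_nat h)%Z) (seq 0 (2 * h + 1)).

Lemma zrange_NoDup h : NoDup (zrange h).
Proof. apply FinFun.Injective_map_NoDup; [intros x y; lia|apply seq_NoDup]. Qed.

Lemma zrange_In h z : In z (zrange h) <-> (Z.abs z <= Z.of_nat h)%Z.
Proof.
  unfold zrange; rewrite in_map_iff; split.
  - intros [i [<- H]]; apply in_seq in H; lia.
  - intros H; exists (Z.to_nat (z + Z.of_nat h)); rewrite in_seq; lia.
Qed.

Lemma dirichlet_telescope (x : R) h n :
  2 * sin (x / 2) * lsum (fun k => cos (IZR k * x)) (map (fun i => (Z.of_nat i - Z.of_nat h)%Z) (seq 0 n))
  = sin ((INR n - INR h - / 2) * x) + sin ((INR h + / 2) * x).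
Proof.
  induction n as [|n IH].
  - simpl; replace ((0 - INR h - / 2) * x) with (- ((INR h + / 2) * x)) by ring; rewrite sin_neg; ring.
  - rewrite seq_S, map_app, lsum_app, Rmult_plus_distr_l, IH, S_INR; simpl.
    rewrite minus_IZR, <- !INR_IZR_INZ.
    replace ((INR n + 1 - INR h - / 2) * x) with ((INR n - INR h) * x + x / 2) by field.
    replace ((INR n - INR h - / 2) * x) with ((INR n - INR h) * x - x / 2) by field.
    rewrite sin_plus, sin_minus; ring.
Qed.

Lemma cos_sum h (s : Z) (n := (2 * Z.of_nat h + 1)%Z) :
  lsum (fun k => cos (2 * IZR s * (PI * IZR k / IZR n))) (zrange h)
  = if Z.eqb (s mod n) 0 then IZR n else 0.
Proof.
  assert (Hn : (0 < n)%Z) by (unfold n; lia).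
  assert (Hn' : 0 < IZR n) by (now apply IZR_lt).
  assert (En : IZR n = 2 * INR h + 1) by (unfold n; rewrite plus_IZR, mult_IZR, <- INR_IZR_INZ; ring).
  set (x := 2 * IZR s * PI / IZR n).
  rewrite (lsum_ext _ (fun k => cos (IZR k * x))) by (intros; f_equal; unfold x; field; lra).
  destruct (Z.eqb_spec (s mod n) 0) as [H|H].
  - apply Z.div_exact in H; [|lia]; set (j := (s / n)%Z) in *.
    rewrite (lsum_ext _ (fun _ => 1)).
    + assert (L : forall l : list Z, lsum (fun _ => 1) l = INR (length l)).
      { induction l as [|a l IH]; simpl lsum; [reflexivity|]; simpl length; rewrite S_INR, IH; ring. }
      rewrite L; unfold zrange; rewrite length_map, length_seq, plus_INR, mult_INR, En; simpl; ring.
    + intros k _; replace (IZR k * x) with (IZR 0 + 2 * IZR (k * j) * PI).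
      * rewrite <- cos_0.
        assert (P : forall z : Z, cos (0 + 2 * IZR z * PI) = cos 0).
        { intros z; destruct (Z_le_gt_dec 0 z).
          - replace z with (Z.of_nat (Z.to_nat z)) by lia; rewrite <- INR_IZR_INZ; apply cos_period.
          - rewrite <- (cos_period (0 + 2 * IZR z * PI) (Z.to_nat (- z))); f_equal.
            rewrite INR_IZR_INZ, Z2Nat.id, opp_IZR by lia; ring. }
        apply P.
      * unfold x; rewrite H, !mult_IZR; field; lra.
  - assert (Hx : sin (x / 2) <> 0).
    { intros E; apply sin_eq_0_0 in E; destruct E as [j Hj]; apply H.
      assert (IZR s = IZR (j * n)).
      { rewrite mult_IZR; apply (Rmult_eq_reg_r (PI / IZR n)).
        - transitivity (x / 2); [unfold x; field; lra|rewrite Hj; field; lra].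
        - apply Rgt_not_eq, Rdiv_lt_0_compat; [apply PI_RGT_0|auto]. }
      apply eq_IZR in H0; rewrite H0; apply Z.mod_mul; lia. }
    assert (T := dirichlet_telescope x h (2 * h + 1)); fold (zrange h) in T.
    (* Since n = 2h + 1, the angle (h + 1/2) x is exactly pi s. *)
    assert (S0 : sin ((INR h + / 2) * x) = 0).
    { apply sin_eq_0_1; exists s; unfold x; rewrite En; field; rewrite <- En; lra. }
    replace (INR (2 * h + 1) - INR h - / 2) with (INR h + / 2) in T.
    + rewrite S0 in T; destruct (Rmult_integral (2 * sin (x / 2)) (lsum (fun k => cos (IZR k * x)) (zrange h))); lra.
    + rewrite plus_INR, mult_INR; simpl; field.
Qed.

(** Expanding each power by [W_cos] and summing over the angles, orthogonality keeps only the
    frequencies s divisible by n. *)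
Lemma polya_identity h m (n := (2 * Z.of_nat h + 1)%Z) :
  lsum (fun k => (2 * cos (PI * IZR k / IZR n)) ^ (2 * m)) (zrange h)
  = IZR n * tsum (fun j => W m (n * j)).
Proof.
  assert (Hn : (0 < n)%Z) by (unfold n; lia).
  rewrite (lsum_ext _ (fun k => tsum (fun s => W m s * cos (2 * IZR s * (PI * IZR k / IZR n)))))
    by (intros; now rewrite W_cos).
  destruct (tsum_lsum (fun k s => W m s * cos (2 * IZR s * (PI * IZR k / IZR n))) (zrange h)) as [H1 <-].
  { intros; apply summable_W_cos; intros; apply Rabs_cos_le. }
  rewrite <- tsum_scal.
  2: apply (summable_comp (W m)); [intros; nia|apply summable_W].
  assert (E : forall s, lsum (fun k => W m s * cos (2 * IZR s * (PI * IZR k / IZR n))) (zrange h)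
     = W m s * if Z.eqb (s mod n) 0 then IZR n else 0).
  { intros s; rewrite lsum_scal; f_equal; apply cos_sum. }
  symmetry; apply (tsum_bij _ _ (fun j => (n * j)%Z) (fun s => (s / n)%Z)); auto.
  - intros j _; split.
    + rewrite Z.mul_comm; apply Z.div_mul; lia.
    + rewrite E, Z.mul_comm, Z.mod_mul by lia; simpl; ring.
  - intros s Hs; rewrite E in Hs |- *; destruct (Z.eqb_spec (s mod n) 0) as [H|H]; [|lra].
    apply Z.div_exact in H; [|lia]; rewrite <- H; split; auto; ring.
Qed.

(** * Inversion of the theta function *)

(** For i < s the ratio of consecutive values is 1 - (2i + 1) / (m + i + 1) <= exp (- (2i + 1) / D),
    and the odd numbers below 2s add up to s^2. *)
Lemma W_upper m (s : nat) (D : R) : INR m + INR s <= D -> 0 < D ->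
  W m (Z.of_nat s) <= W m 0 * exp (- (INR s ^ 2 / D)).
Proof.
  intros HD HD0; induction s as [|s IH].
  - simpl INR; replace (- (0 ^ 2 / D)) with 0 by (field; lra); rewrite exp_0; simpl Z.of_nat; lra.
  - rewrite S_INR in *; assert (IH' := IH ltac:(lra)); clear IH.
    assert (R := W_ratio m (Z.of_nat s)); rewrite <- INR_IZR_INZ in R.
    replace (Z.of_nat s + 1)%Z with (Z.of_nat (S s)) in R by lia.
    assert (P0 := pos_INR m); assert (P1 := pos_INR s).
    assert (N0 := W_nonneg m (Z.of_nat s)); assert (N1 := W_nonneg m (Z.of_nat (S s))).
    set (w := W m (Z.of_nat s)) in *; set (w1 := W m (Z.of_nat (S s))) in *.
    assert (E : - ((INR s + 1) ^ 2 / D) = - (INR s ^ 2 / D) + - ((2 * INR s + 1) / D)) by (field; lra).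
    rewrite E, exp_plus, <- Rmult_assoc.
    assert (F : w1 = w * (1 - (2 * INR s + 1) / (INR m + INR s + 1))).
    { apply (Rmult_eq_reg_l (INR m + INR s + 1)); [|lra]; rewrite <- R; field; lra. }
    assert (G : (2 * INR s + 1) / D <= (2 * INR s + 1) / (INR m + INR s + 1)).
    { apply Rmult_le_compat_l; [lra|]; apply Rinv_le_contravar; lra. }
    assert (H := exp_ineq1_le (- ((2 * INR s + 1) / D))).
    rewrite F; apply Rle_trans with (w * exp (- ((2 * INR s + 1) / D))).
    + apply Rmult_le_compat_l; lra.
    + apply Rmult_le_compat_r; auto; left; apply exp_pos.
Qed.

(** The same product, inverted: the reciprocal ratio is 1 + (2i + 1) / (m - i) <= exp ((2i + 1) /
    D), because D bounds m - i from below for every i < s. *)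
Lemma W_lower m (s : nat) (D : R) : 0 < D <= INR m - INR s + 1 ->
  W m 0 * exp (- (INR s ^ 2 / D)) <= W m (Z.of_nat s).
Proof.
  intros [HD0 HD]; induction s as [|s IH].
  - simpl INR; replace (- (0 ^ 2 / D)) with 0 by (field; lra); rewrite exp_0; simpl Z.of_nat; lra.
  - rewrite S_INR in *; assert (IH' := IH ltac:(lra)); clear IH.
    assert (R := W_ratio m (Z.of_nat s)); rewrite <- INR_IZR_INZ in R.
    replace (Z.of_nat s + 1)%Z with (Z.of_nat (S s)) in R by lia.
    assert (P0 := pos_INR m); assert (P1 := pos_INR s).
    assert (N0 := W_nonneg m (Z.of_nat s)); assert (N1 := W_nonneg m (Z.of_nat (S s))).
    set (w := W m (Z.of_nat s)) in *; set (w1 := W m (Z.of_nat (S s))) in *.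
    assert (E : - ((INR s + 1) ^ 2 / D) = - (INR s ^ 2 / D) + - ((2 * INR s + 1) / D)) by (field; lra).
    rewrite E, exp_plus, <- Rmult_assoc.
    assert (F : w = w1 * (1 + (2 * INR s + 1) / (INR m - INR s))).
    { apply (Rmult_eq_reg_l (INR m - INR s)); [|lra]; rewrite R; field; lra. }
    assert (G : (2 * INR s + 1) / (INR m - INR s) <= (2 * INR s + 1) / D).
    { apply Rmult_le_compat_l; [lra|]; apply Rinv_le_contravar; lra. }
    assert (H := exp_ineq1_le ((2 * INR s + 1) / D)).
    set (e := exp ((2 * INR s + 1) / D)) in *.
    assert (w <= w1 * e) by (rewrite F; apply Rmult_le_compat_l; lra).
    rewrite (exp_Ropp ((2 * INR s + 1) / D)); fold e.
    assert (He : 0 < e) by apply exp_pos.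
    apply Rle_trans with (w * / e).
    + apply Rmult_le_compat_r; auto; left; now apply Rinv_0_lt_compat.
    + apply (Rmult_le_reg_r e); auto; rewrite Rmult_assoc, Rinv_l; lra.
Qed.

Lemma lim_exp_ratio (v w : nat -> R) (v0 : R) :
  is_lim_seq v v0 -> is_lim_seq w 0 ->
  is_lim_seq (fun n => exp (- (v n ^ 2 / (1 + w n)))) (exp (- v0 ^ 2)).
Proof.
  intros Hv Hw.
  apply (is_lim_seq_continuous (fun x => exp (- x)) (fun n => v n ^ 2 / (1 + w n)) (v0 ^ 2)).
  - apply derivable_continuous_pt; reg.
  - replace (v0 ^ 2) with (v0 ^ 2 / (1 + 0)) by field.
    apply is_lim_seq_div'; [|apply is_lim_seq_plus'; auto; apply is_lim_seq_const|lra].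
    simpl; apply is_lim_seq_mult'; auto; apply is_lim_seq_mult'; auto; apply is_lim_seq_const.
Qed.

Lemma sin_lower x : 0 <= x <= PI -> x * (1 - x ^ 2 / 6) <= sin x.
Proof.
  intros Hx; destruct (sin_bound x 0) as [H _]; try lra.
  unfold sin_approx, sin_term in H; simpl in H; lra.
Qed.

Lemma pow_exp_le (x y : R) m : 0 <= x -> x <= exp y -> x ^ m <= exp (INR m * y).
Proof. intros; rewrite <- exp_pow; apply pow_incr; auto. Qed.

(** From cos^2 = 1 - sin^2 <= exp (- sin^2) and [sin_lower]. *)
Lemma cos2_upper (x : R) m : 0 <= x <= PI ->
  (1 - x ^ 2 / 6) >= 0 -> (cos x ^ 2) ^ m <= exp (- (INR m * (x * (1 - x ^ 2 / 6)) ^ 2)).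
Proof.
  intros Hx H6; assert (S := sin_lower x Hx).
  replace (- (INR m * (x * (1 - x ^ 2 / 6)) ^ 2)) with (INR m * - (x * (1 - x ^ 2 / 6)) ^ 2) by ring.
  apply pow_exp_le; [apply pow2_ge_0|].
  assert (0 <= x * (1 - x ^ 2 / 6)) by (apply Rmult_le_pos; lra).
  assert (E := sin2_cos2 x); unfold Rsqr in E.
  assert (H1 := exp_ineq1_le (- (x * (1 - x ^ 2 / 6)) ^ 2)); nra.
Qed.

(** From cos^2 >= 1 - x^2, which is the inverse of 1 + x^2 / (1 - x^2), itself at most exp (x^2 / (1
    - x^2)). *)
Lemma cos2_lower (x : R) m : 0 <= x < 1 ->
  exp (- (INR m * (x ^ 2 / (1 - x ^ 2)))) <= (cos x ^ 2) ^ m.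
Proof.
  intros Hx.
  replace (- (INR m * (x ^ 2 / (1 - x ^ 2)))) with (INR m * - (x ^ 2 / (1 - x ^ 2))) by ring.
  rewrite <- exp_pow; apply pow_incr; split; [left; apply exp_pos|].
  assert (E := sin2_cos2 x); unfold Rsqr in E.
  assert (S : 0 <= sin x <= x).
  { assert (P := PI2_1); split; [apply sin_ge_0; lra|].
    destruct (Req_dec x 0) as [->|]; [rewrite sin_0; lra|left; apply sin_lt_x; lra]. }
  assert (H := exp_ineq1_le (x ^ 2 / (1 - x ^ 2))).
  rewrite exp_Ropp.
  apply Rle_trans with (/ (1 + x ^ 2 / (1 - x ^ 2))).
  - apply Rinv_le_contravar; auto.
    replace (1 + x ^ 2 / (1 - x ^ 2)) with (/ (1 - x ^ 2)) by (field; nra).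
    apply Rinv_0_lt_compat; nra.
  - replace (/ (1 + x ^ 2 / (1 - x ^ 2))) with (1 - x ^ 2) by (field; nra); nra.
Qed.

Section Polya.
Variable a : R.
Hypothesis Ha : 0 < a.

(** With m = M^2 and n odd, close to a M, the exponents (n j)^2 / m and m (pi k / n)^2 tend to a^2
    j^2 and pi^2 k^2 / a^2. Only h and n depend on [a]. *)
Let M (N : nat) : R := INR (S N).
Let m (N : nat) : nat := (S N * S N)%nat.
Let h (N : nat) : nat := Z.to_nat (up (a * M N / 2)).
Let n (N : nat) : Z := (2 * Z.of_nat (h N) + 1)%Z.

Lemma M_pos N : 1 <= M N.
Proof. unfold M; rewrite S_INR; pose proof (pos_INR N); lra. Qed.

Lemma m_M N : INR (m N) = M N ^ 2.
Proof. unfold m, M; rewrite mult_INR; ring. Qed.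

Lemma n_bounds N : a * M N <= IZR (n N) <= a * M N + 3.
Proof.
  assert (H := M_pos N); destruct (archimed (a * M N / 2)) as [H1 H2].
  assert (H3 : 0 < a * M N) by (apply Rmult_lt_0_compat; lra).
  assert (H4 : (0 < up (a * M N / 2))%Z) by (apply lt_IZR; lra).
  unfold n, h; rewrite plus_IZR, mult_IZR, Z2Nat.id by lia; lra.
Qed.

Lemma inv_M_lim : is_lim_seq (fun N => / M N) 0.
Proof.
  apply (is_lim_seq_inv (fun N => M N) p_infty); [|discriminate].
  apply (is_lim_seq_incr_1 INR p_infty), is_lim_seq_INR.
Qed.

Lemma n_M_lim : is_lim_seq (fun N => IZR (n N) / M N) a.
Proof.
  apply (is_lim_seq_le_le (fun _ => a) _ (fun N => a + 3 * / M N)).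
  - intros N; destruct (n_bounds N); pose proof (M_pos N).
    split; apply (Rmult_le_reg_r (M N)); try lra.
    + replace (IZR (n N) / M N * M N) with (IZR (n N)) by (field; lra); lra.
    + replace (IZR (n N) / M N * M N) with (IZR (n N)) by (field; lra).
      replace ((a + 3 * / M N) * M N) with (a * M N + 3) by (field; lra); lra.
  - apply is_lim_seq_const.
  - replace (Finite a) with (Finite (a + 3 * 0)) by (f_equal; ring).
    apply is_lim_seq_plus'; [apply is_lim_seq_const|].
    apply is_lim_seq_mult'; [apply is_lim_seq_const|apply inv_M_lim].
Qed.

Let rhs (N : nat) (j : Z) : R := W (m N) (n N * j) / W (m N) 0.

Lemma rhs_abs N j : rhs N j = W (m N) (Z.of_nat (Z.abs_nat (n N * j))) / W (m N) 0.
Proof.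
  unfold rhs; f_equal; destruct (Z_le_gt_dec 0 (n N * j)).
  - f_equal; lia.
  - rewrite <- W_opp; f_equal; lia.
Qed.

Lemma abs_nj N j : INR (Z.abs_nat (n N * j)) = IZR (n N) * Rabs (IZR j).
Proof.
  rewrite INR_IZR_INZ, Zabs2Nat.id_abs, abs_IZR, mult_IZR, Rabs_mult; f_equal.
  apply Rabs_pos_eq, IZR_le; unfold n; lia.
Qed.

Lemma rhs_dom N j : Rabs (rhs N j) <= exp (- (a ^ 2 / 2 * IZR (j * j))).
Proof.
  assert (W0 := W_0_pos (m N)); rewrite rhs_abs; set (s := Z.abs_nat (n N * j)).
  assert (Ws := W_nonneg (m N) (Z.of_nat s)).
  rewrite Rabs_pos_eq by (apply Rmult_le_pos; auto; left; now apply Rinv_0_lt_compat).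
  destruct (le_lt_dec s (m N)) as [H|H].
  - assert (Hm : 0 < INR (m N)) by (rewrite m_M; apply pow_lt; pose proof (M_pos N); lra).
    apply le_INR in H.
    apply (Rmult_le_reg_r (W (m N) 0)); auto; unfold Rdiv at 1; rewrite Rmult_assoc, Rinv_l by lra.
    rewrite Rmult_1_r, Rmult_comm.
    (* Here s <= m permits D = 2m; half of the true exponent is enough for a dominating function. *)
    eapply Rle_trans; [apply (W_upper _ s (2 * INR (m N))); lra|].
    apply Rmult_le_compat_l; [lra|]; apply exp_le.
    unfold s; rewrite abs_nj, m_M, mult_IZR.
    destruct (n_bounds N) as [H1 _]; assert (H2 := M_pos N).
    assert (H3 : a * M N * Rabs (IZR j) <= IZR (n N) * Rabs (IZR j))
      by (apply Rmult_le_compat_r; auto using Rabs_pos).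
    assert (H0 : 0 <= a * M N * Rabs (IZR j))
      by (apply Rmult_le_pos; [apply Rmult_le_pos; lra|apply Rabs_pos]).
    assert (H4 : (a * M N * Rabs (IZR j)) ^ 2 <= (IZR (n N) * Rabs (IZR j)) ^ 2)
      by (apply pow_incr; auto).
    apply Ropp_le_contravar; apply (Rmult_le_reg_r (2 * M N ^ 2)); [nra|].
    replace ((IZR (n N) * Rabs (IZR j)) ^ 2 / (2 * M N ^ 2) * (2 * M N ^ 2))
      with ((IZR (n N) * Rabs (IZR j)) ^ 2) by (field; lra).
    rewrite !Rpow_mult_distr, pow2_abs in H4; rewrite !Rpow_mult_distr, pow2_abs.
    replace (a ^ 2 / 2 * (IZR j * IZR j) * (2 * M N ^ 2)) with (a ^ 2 * M N ^ 2 * IZR j ^ 2) by field.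
    lra.
  - rewrite W_out by lia; unfold Rdiv; rewrite Rmult_0_l; left; apply exp_pos.
Qed.

(** With s = v M and m = M^2, taking D = m - s and D = m + s in the two bounds for [W] gives the
    exponents v^2 / (1 - v / M) and v^2 / (1 + v / M), both tending to (a |j|)^2. *)
Lemma rhs_lim j : is_lim_seq (fun N => rhs N j) (exp (- (a ^ 2 * IZR (j * j)))).
Proof.
  set (v := fun N => IZR (n N) / M N * Rabs (IZR j)).
  assert (Hv : is_lim_seq v (a * Rabs (IZR j))).
  { apply is_lim_seq_mult'; [apply n_M_lim|apply is_lim_seq_const]. }
  assert (Hw : is_lim_seq (fun N => v N * / M N) 0).
  { replace (Finite 0) with (Finite (a * Rabs (IZR j) * 0)) by (f_equal; ring).
    apply is_lim_seq_mult'; [auto|apply inv_M_lim]. }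
  replace (a ^ 2 * IZR (j * j)) with ((a * Rabs (IZR j)) ^ 2)
    by (rewrite Rpow_mult_distr, pow2_abs, mult_IZR; ring).
  assert (Sv : forall N, INR (Z.abs_nat (n N * j)) = v N * M N).
  { intros N; rewrite abs_nj; unfold v; field; pose proof (M_pos N); lra. }
  assert (V0 : forall N, 0 <= v N).
  { intros N; apply Rmult_le_pos; [|apply Rabs_pos]; pose proof (n_bounds N); pose proof (M_pos N).
    apply Rmult_le_pos; [nra|left; apply Rinv_0_lt_compat; lra]. }
  apply (is_lim_seq_le_le_loc (fun N => exp (- (v N ^ 2 / (1 + - (v N * / M N)))))
           _ (fun N => exp (- (v N ^ 2 / (1 + v N * / M N))))).
  - apply is_lim_seq_spec in Hw; destruct (Hw (mkposreal _ Rlt_0_1)) as [N0 HN0].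
    exists N0; intros N HN; specialize (HN0 N HN); simpl in HN0.
    rewrite Rminus_0_r in HN0; apply Rabs_def2 in HN0; destruct HN0 as [HN0 _].
    assert (HM := M_pos N); assert (W0 := W_0_pos (m N)); specialize (V0 N).
    assert (HV : v N < M N).
    { apply (Rmult_lt_reg_r (/ M N)); [apply Rinv_0_lt_compat; lra|]; rewrite Rinv_r; lra. }
    rewrite rhs_abs; set (s := Z.abs_nat (n N * j)); assert (Hs := Sv N); fold s in Hs.
    assert (Hm := m_M N).
    split; apply (Rmult_le_reg_l (W (m N) 0)); auto;
      replace (W (m N) 0 * (W (m N) (Z.of_nat s) / W (m N) 0)) with (W (m N) (Z.of_nat s))
        by (field; lra).
    + eapply Rle_trans; [|apply (W_lower (m N) s (INR (m N) - INR s))]; rewrite Hm, Hs.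
      * right; do 3 f_equal; field; nra.
      * nra.
    + eapply Rle_trans; [apply (W_upper (m N) s (INR (m N) + INR s))|]; rewrite Hm, Hs; try nra.
      right; do 3 f_equal; field; nra.
  - apply lim_exp_ratio; auto.
    replace (Finite 0) with (Finite (- 0)) by (f_equal; ring).
    now apply (is_lim_seq_opp _ (Finite 0)).
  - now apply lim_exp_ratio.
Qed.

(** The finite sum over angles, divided by 4^m and extended by 0 to all of Z so that dominated
    convergence applies. The absolute value puts the angle in [0, pi/2]. *)
Let lhs (N : nat) (k : Z) : R :=
  if Z.leb (Z.abs k) (Z.of_nat (h N)) then (cos (PI * Rabs (IZR k) / IZR (n N)) ^ 2) ^ m N else 0.

Lemma angle_bounds N k : (Z.abs k <= Z.of_nat (h N))%Z ->
  0 <= PI * Rabs (IZR k) / IZR (n N) <= PI / 2.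
Proof.
  intros Hk; assert (P := PI_RGT_0).
  assert (Hn : 0 < IZR (n N)) by (apply IZR_lt; unfold n; lia).
  assert (H2 : 2 * Rabs (IZR k) <= IZR (n N)).
  { rewrite <- abs_IZR, <- (mult_IZR 2); apply IZR_le; unfold n; lia. }
  assert (H := Rabs_pos (IZR k)).
  split; apply (Rmult_le_reg_r (IZR (n N))); auto;
    replace (PI * Rabs (IZR k) / IZR (n N) * IZR (n N)) with (PI * Rabs (IZR k)) by (field; lra); nra.
Qed.

Lemma lhs_dom N k : Rabs (lhs N k) <= exp (- (/ (a + 3) ^ 2 * IZR (k * k))).
Proof.
  unfold lhs; destruct (Z.leb_spec (Z.abs k) (Z.of_nat (h N))) as [Hk|Hk].
  2: rewrite Rabs_R0; left; apply exp_pos.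
  rewrite Rabs_pos_eq by (apply pow_le, pow2_ge_0).
  assert (Hx := angle_bounds N k Hk); assert (P4 := PI_4); assert (P3 := PI2_3_2).
  set (x := PI * Rabs (IZR k) / IZR (n N)) in *.
  (* From x <= pi/2 <= 2. Together with pi / 3 >= 1 and n <= (a + 3) M it yields the bound of
     [H1]. *)
  assert (Hx6 : / 3 <= 1 - x ^ 2 / 6) by nra.
  eapply Rle_trans; [apply cos2_upper; lra|]; apply exp_le, Ropp_le_contravar.
  rewrite m_M, mult_IZR.
  destruct (n_bounds N) as [_ Hn]; assert (HM := M_pos N).
  assert (Hn0 : 0 < IZR (n N)) by (apply IZR_lt; unfold n; lia).
  assert (H1 : Rabs (IZR k) / (a + 3) <= M N * (x * (1 - x ^ 2 / 6))).
  { assert (Hk0 := Rabs_pos (IZR k)).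
    apply Rle_trans with (M N * (Rabs (IZR k) / IZR (n N))).
    - apply (Rmult_le_reg_r ((a + 3) * IZR (n N))); [nra|].
      replace (Rabs (IZR k) / (a + 3) * ((a + 3) * IZR (n N))) with (Rabs (IZR k) * IZR (n N))
        by (field; lra).
      replace (M N * (Rabs (IZR k) / IZR (n N)) * ((a + 3) * IZR (n N)))
        with (Rabs (IZR k) * (M N * (a + 3))) by (field; lra).
      apply Rmult_le_compat_l; nra.
    - apply Rmult_le_compat_l; [lra|].
      apply Rle_trans with (x * / 3); [|apply Rmult_le_compat_l; lra].
      unfold x; replace (PI * Rabs (IZR k) / IZR (n N) * / 3)
        with (PI / 3 * (Rabs (IZR k) / IZR (n N))) by (field; lra).
      rewrite <- (Rmult_1_l (Rabs (IZR k) / IZR (n N))) at 1.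
      apply Rmult_le_compat_r; [|lra].
      apply Rmult_le_pos; [auto|left; now apply Rinv_0_lt_compat]. }
  replace (/ (a + 3) ^ 2 * (IZR k * IZR k)) with ((Rabs (IZR k) / (a + 3)) ^ 2).
  - replace (M N ^ 2 * (x * (1 - x ^ 2 / 6)) ^ 2) with ((M N * (x * (1 - x ^ 2 / 6))) ^ 2) by ring.
    apply pow_incr; split; auto.
    apply Rmult_le_pos; [apply Rabs_pos|left; apply Rinv_0_lt_compat; lra].
  - unfold Rdiv; rewrite Rpow_mult_distr, pow2_abs, pow_inv; ring.
Qed.

Lemma lhs_lim k : is_lim_seq (fun N => lhs N k) (exp (- (PI ^ 2 / a ^ 2 * IZR (k * k)))).
Proof.
  set (x := fun N => PI * Rabs (IZR k) / IZR (n N)).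
  assert (Hn0 : forall N, 0 < IZR (n N)) by (intros; apply IZR_lt; unfold n; lia).
  assert (Hv : is_lim_seq (fun N => M N * x N) (PI * Rabs (IZR k) / a)).
  { apply (is_lim_seq_ext (fun N => PI * Rabs (IZR k) / (IZR (n N) / M N))).
    - intros N; unfold x; field; specialize (Hn0 N); pose proof (M_pos N); lra.
    - apply is_lim_seq_div'; [apply is_lim_seq_const|apply n_M_lim|lra]. }
  assert (Hx : is_lim_seq x 0).
  { apply (is_lim_seq_ext (fun N => M N * x N * / M N)).
    - intros N; field; pose proof (M_pos N); lra.
    - replace (Finite 0) with (Finite (PI * Rabs (IZR k) / a * 0)) by (f_equal; ring).
      apply is_lim_seq_mult'; [auto|apply inv_M_lim]. }
  assert (Hx2 : is_lim_seq (fun N => x N ^ 2) 0).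
  { apply (is_lim_seq_ext (fun N => x N * x N)); [intros; ring|].
    replace (Finite 0) with (Finite (0 * 0)) by (f_equal; ring).
    now apply is_lim_seq_mult'. }
  replace (PI ^ 2 / a ^ 2 * IZR (k * k)) with ((PI * Rabs (IZR k) / a) ^ 2).
  2: { unfold Rdiv; rewrite !Rpow_mult_distr, pow2_abs, pow_inv, mult_IZR; ring. }
  apply (is_lim_seq_le_le_loc (fun N => exp (- ((M N * x N) ^ 2 / (1 + - x N ^ 2))))
           _ (fun N => exp (- ((M N * x N * (1 - x N ^ 2 / 6)) ^ 2 / (1 + 0))))).
  - assert (Hx' := Hx); apply is_lim_seq_spec in Hx'; destruct (Hx' (mkposreal _ Rlt_0_1)) as [N0 HN0]; clear Hx'.
    exists N0; intros N HN; specialize (HN0 N HN); simpl in HN0.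
    rewrite Rminus_0_r in HN0; apply Rabs_def2 in HN0; destruct HN0 as [HN0 _].
    assert (P := PI2_3_2).
    assert (Xn : 0 <= x N).
    { apply Rmult_le_pos; [|left; apply Rinv_0_lt_compat; auto].
      apply Rmult_le_pos; [lra|apply Rabs_pos]. }
    (* As x < 1 means pi |k| < n, eventually k lies in the range and [lhs] is not its default 0. *)
    assert (Hk : (Z.abs k <= Z.of_nat (h N))%Z).
    { apply Z.lt_succ_r; assert (2 * Z.abs k < n N)%Z; [|unfold n in *; lia].
      apply lt_IZR; rewrite mult_IZR, abs_IZR; unfold x in HN0.
      assert (PI * Rabs (IZR k) < IZR (n N)).
      { apply (Rmult_lt_reg_r (/ IZR (n N))); [apply Rinv_0_lt_compat; auto|].
        rewrite Rinv_r; [exact HN0|specialize (Hn0 N); lra]. }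
      pose proof (Rabs_pos (IZR k)); nra. }
    unfold lhs; destruct (Z.leb_spec (Z.abs k) (Z.of_nat (h N))); [|lia]; fold (x N).
    assert (Hm := m_M N); split.
    + replace ((M N * x N) ^ 2 / (1 + - x N ^ 2)) with (INR (m N) * (x N ^ 2 / (1 - x N ^ 2)))
        by (rewrite Hm; field; nra).
      apply cos2_lower; lra.
    + replace ((M N * x N * (1 - x N ^ 2 / 6)) ^ 2 / (1 + 0))
        with (INR (m N) * (x N * (1 - x N ^ 2 / 6)) ^ 2) by (rewrite Hm; field).
      apply cos2_upper; [lra|nra].
  - apply lim_exp_ratio; auto.
    replace (Finite 0) with (Finite (- 0)) by (f_equal; ring).
    now apply (is_lim_seq_opp _ (Finite 0)).
  - apply lim_exp_ratio; [|apply is_lim_seq_const].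
    replace (PI * Rabs (IZR k) / a) with (PI * Rabs (IZR k) / a * (1 - 0 / 6)) by (field; lra).
    apply is_lim_seq_mult'; auto.
    apply is_lim_seq_minus'; [apply is_lim_seq_const|].
    apply is_lim_seq_div'; [auto|apply is_lim_seq_const|lra].
Qed.

(** Normalising both sides isolates M W(m, 0) / 4^m, the one factor whose limit is not yet known. *)
Lemma lhs_rhs N :
  tsum (lhs N) = IZR (n N) / M N * (M N * W (m N) 0 / 4 ^ m N) * tsum (rhs N).
Proof.
  assert (W0 := W_0_pos (m N)); assert (HM := M_pos N).
  assert (H4 : 0 < 4 ^ m N) by (apply pow_lt; lra).
  assert (P := polya_identity (h N) (m N)); cbv zeta in P; fold (n N) in P.
  destruct (finite_support (lhs N) (zrange (h N))) as [_ ->].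
  - apply zrange_NoDup.
  - intros k Hk; unfold lhs; destruct (Z.leb_spec (Z.abs k) (Z.of_nat (h N))); auto.
    exfalso; apply Hk, zrange_In; auto.
  - rewrite (lsum_ext _ (fun k => 4 ^ m N * lhs N k)) in P.
    + rewrite lsum_scal in P; apply (Rmult_eq_reg_l (4 ^ m N)); [|lra]; rewrite P.
      rewrite (tsum_ext _ (fun j => W (m N) 0 * rhs N j)).
      * rewrite tsum_scal; [field; lra|].
        apply (summable_le _ _ (rhs_dom N)), summable_gauss; nra.
      * intros j; unfold rhs; field; lra.
    + intros k Hk; apply zrange_In in Hk; unfold lhs.
      destruct (Z.leb_spec (Z.abs k) (Z.of_nat (h N))); [|lia].
      rewrite pow_mult, <- Rpow_mult_distr; f_equal.
      replace (cos (PI * IZR k / IZR (n N))) with (cos (PI * Rabs (IZR k) / IZR (n N))); [ring|].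
      unfold Rabs; destruct (Rcase_abs (IZR k)); auto.
      rewrite <- cos_neg; f_equal; field; apply eq_IZR_contrapositive; unfold n; lia.
Qed.

(** The two theta sums and n / M converge, so the central binomial factor has to converge to the
    quotient of their limits. *)
Lemma central_lim : is_lim_seq (fun N => M N * W (m N) 0 / 4 ^ m N)
  (th ones (PI ^ 2 / a ^ 2) / (a * th ones (a ^ 2))).
Proof.
  assert (Hp : 0 < PI ^ 2 / a ^ 2).
  { apply Rdiv_lt_0_compat; apply pow_lt; auto; apply PI_RGT_0. }
  assert (L : is_lim_seq (fun N => tsum (lhs N)) (th ones (PI ^ 2 / a ^ 2))).
  { unfold th; rewrite (tsum_ext _ (fun k => exp (- (PI ^ 2 / a ^ 2 * IZR (k * k)))))
      by (intros; unfold ones; ring).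
    apply (tsum_lim _ _ _ (summable_gauss (/ (a + 3) ^ 2) ltac:(apply Rinv_0_lt_compat; nra))
             lhs_dom lhs_lim). }
  assert (Q : is_lim_seq (fun N => tsum (rhs N)) (th ones (a ^ 2))).
  { unfold th; rewrite (tsum_ext _ (fun k => exp (- (a ^ 2 * IZR (k * k)))))
      by (intros; unfold ones; ring).
    apply (tsum_lim _ _ _ (summable_gauss (a ^ 2 / 2) ltac:(nra)) rhs_dom rhs_lim). }
  assert (Pos : 0 < th ones (a ^ 2)).
  { apply (tsum_pos _ 0%Z).
    - intros; unfold ones; rewrite Rmult_1_l; left; apply exp_pos.
    - apply summable_th; [unfold bounded1, ones; lia|nra].
    - unfold ones; rewrite Rmult_1_l; apply exp_pos. }
  assert (Pr : forall N, 0 < tsum (rhs N)).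
  { intros N; assert (W0 := W_0_pos (m N)); apply (tsum_pos _ 0%Z).
    - intros j; apply Rmult_le_pos; [apply W_nonneg|left; now apply Rinv_0_lt_compat].
    - apply (summable_le _ _ (rhs_dom N)), summable_gauss; nra.
    - unfold rhs; rewrite Z.mul_0_r; now apply Rdiv_lt_0_compat. }
  apply (is_lim_seq_ext (fun N => tsum (lhs N) / (IZR (n N) / M N * tsum (rhs N)))).
  - intros N; rewrite lhs_rhs; specialize (Pr N); pose proof (M_pos N).
    assert (0 < IZR (n N)) by (apply IZR_lt; unfold n; lia).
    assert (0 < 4 ^ m N) by (apply pow_lt; lra).
    field; repeat split; lra.
  - apply is_lim_seq_div'; auto; [apply is_lim_seq_mult'; auto; apply n_M_lim|nra].
Qed.

End Polya.

Lemma th_ones_pos x : 0 < x -> 0 < th ones x.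
Proof.
  intros Hx; apply (tsum_pos _ 0%Z).
  - intros; unfold ones; rewrite Rmult_1_l; left; apply exp_pos.
  - apply summable_th; [unfold bounded1, ones; lia|auto].
  - unfold ones; rewrite Rmult_1_l; apply exp_pos.
Qed.

(* The sequence of [central_lim] does not depend on [a]: comparing its limits for [sqrt x] and
   for [sqrt PI] makes Wallis' formula unnecessary. *)
Lemma th_ones_inv x : 0 < x -> th ones (PI ^ 2 / x) = sqrt (x / PI) * th ones x.
Proof.
  intros Hx; assert (P := PI_RGT_0).
  assert (L1 := central_lim (sqrt x) (sqrt_lt_R0 x Hx)).
  assert (L2 := central_lim (sqrt PI) (sqrt_lt_R0 PI P)).
  rewrite !pow2_sqrt in L1, L2 by lra.
  apply is_lim_seq_unique in L1; apply is_lim_seq_unique in L2.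
  assert (E := f_equal real (eq_trans (eq_sym L1) L2)).
  change (th ones (PI ^ 2 / x) / (sqrt x * th ones x) = th ones (PI ^ 2 / PI) / (sqrt PI * th ones PI)) in E.
  replace (PI ^ 2 / PI) with PI in E by (field; lra).
  assert (Hs := sqrt_lt_R0 x Hx); assert (Hp := sqrt_lt_R0 PI P).
  assert (T1 := th_ones_pos x Hx); assert (T2 := th_ones_pos PI P).
  rewrite sqrt_div by lra.
  apply (Rmult_eq_reg_r (/ (sqrt x * th ones x))).
  - transitivity (th ones (PI ^ 2 / x) / (sqrt x * th ones x)); [reflexivity|rewrite E; field; lra].
  - apply Rinv_neq_0_compat; nra.
Qed.

(** * Weights modulo 8 and binary theta series *)

Ltac Zify.zify_post_hook ::= Z.to_euclidean_division_equations.

Lemma bounded1_ones : bounded1 ones. Proof. unfold bounded1, ones; lia. Qed.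
Lemma bounded1_sgn : bounded1 sgn.
Proof. intros n; unfold sgn; destruct (n mod 2 =? 0)%Z; lia. Qed.
Lemma bounded1_odd : bounded1 odd.
Proof. intros n; unfold odd, indic; destruct (n mod 2 =? 1)%Z; lia. Qed.
Lemma chi_cases n : ((n mod 2 = 0 /\ chi n = 0) \/ (n mod 2 = 1 /\ (chi n = 1 \/ chi n = -1)))%Z.
Proof.
  unfold chi; assert (H : (n mod 8 = 0 \/ n mod 8 = 1 \/ n mod 8 = 2 \/ n mod 8 = 3 \/
    n mod 8 = 4 \/ n mod 8 = 5 \/ n mod 8 = 6 \/ n mod 8 = 7)%Z) by lia.
  destruct H as [H|[H|[H|[H|[H|[H|[H|H]]]]]]]; rewrite H; lia.
Qed.
Lemma bounded1_chi : bounded1 chi.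
Proof. intros n; destruct (chi_cases n) as [|[_ []]]; lia. Qed.
Lemma bounded1_indic {I} (b : I -> bool) : bounded1 (fun i => indic (b i)).
Proof. intros i; unfold indic; destruct (b i); lia. Qed.
Lemma bounded1_mult {I} (c d : I -> Z) : bounded1 c -> bounded1 d -> bounded1 (fun i => (c i * d i)%Z).
Proof. intros Hc Hd i; specialize (Hc i); specialize (Hd i); nia. Qed.
Lemma bounded1_comp {I J} (c : I -> Z) (p : J -> I) : bounded1 c -> bounded1 (fun j => c (p j)).
Proof. intros H j; apply H. Qed.

#[export] Hint Resolve bounded1_ones bounded1_sgn bounded1_odd bounded1_chi bounded1_indic
  bounded1_mult : bnd.
Ltac bnd := repeat first [apply bounded1_mult | apply bounded1_indic |
  apply (bounded1_comp _ _ bounded1_ones) | apply (bounded1_comp _ _ bounded1_sgn) |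
  apply (bounded1_comp _ _ bounded1_odd) | apply (bounded1_comp _ _ bounded1_chi)].

Definition form (a b : Z) (v : Z * Z) : Z := (a * (fst v * fst v) + b * (snd v * snd v))%Z.

(** A theta series in two variables with weight [c] and quadratic form [q]; Jacobi's constant th2 is
    [P2] below. *)
Definition th2 (c : Z * Z -> Z) (q : Z * Z -> Z) (y : R) : R :=
  tsum (fun v => IZR (c v) * exp (- (y * IZR (q v)))).

Lemma form_exp a b y v : exp (- (y * IZR (form a b v))) =
  exp (- (IZR a * y * IZR (fst v * fst v))) * exp (- (IZR b * y * IZR (snd v * snd v))).
Proof.
  rewrite <- exp_plus; f_equal; unfold form; rewrite plus_IZR, (mult_IZR a), (mult_IZR b); ring.
Qed.

Lemma IZR_pos a : (0 < a)%Z -> 0 < IZR a.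
Proof. apply IZR_lt. Qed.

Lemma summable_th2 c a b y : bounded1 c -> (0 < a)%Z -> (0 < b)%Z -> 0 < y ->
  summable (fun v => IZR (c v) * exp (- (y * IZR (form a b v)))).
Proof.
  intros Hc Ha Hb Hy; apply IZR_pos in Ha, Hb.
  apply summable_weight; auto; [intros; left; apply exp_pos|].
  eapply summable_ext; [intros v; symmetry; apply form_exp|].
  apply (summable_prod (fun n => exp (- (IZR a * y * IZR (n * n)))) (fun n => exp (- (IZR b * y * IZR (n * n)))));
    apply summable_gauss; nra.
Qed.

Lemma th_mult c d a b y : bounded1 c -> bounded1 d -> (0 < a)%Z -> (0 < b)%Z -> 0 < y ->
  th c (IZR a * y) * th d (IZR b * y) = th2 (fun v => (c (fst v) * d (snd v))%Z) (form a b) y.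
Proof.
  intros Hc Hd Ha Hb Hy; apply IZR_pos in Ha, Hb; unfold th, th2.
  rewrite <- tsum_prod by (apply summable_th; auto; nra).
  apply tsum_ext; intros v; rewrite form_exp, (mult_IZR (c (fst v))); ring.
Qed.

(** A change of variables between quadratic forms: [p] is the linear substitution, [p'] its inverse,
    meaningful only on the congruence classes that carry the weight. The identity of forms is
    required in one direction; the other follows. *)
Lemma th2_bij c q c' a b (p p' : Z * Z -> Z * Z) y :
  bounded1 c' -> (0 < a)%Z -> (0 < b)%Z -> 0 < y ->
  (forall v, c v <> 0%Z -> p' (p v) = v /\ c' (p v) = c v /\ form a b (p v) = q v) ->
  (forall v, c' v <> 0%Z -> p (p' v) = v /\ c (p' v) = c' v) ->
  th2 c q y = th2 c' (form a b) y.
Proof.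
  intros Hc Ha Hb Hy H H'; apply (tsum_bij _ _ p p').
  - apply summable_th2; auto.
  - intros v Hv; destruct (H v) as [H1 [H2 H3]].
    + intros E; apply Hv; cbv beta; rewrite E; ring.
    + rewrite H1, H2, H3; auto.
  - intros v Hv; destruct (H' v) as [H1 H2].
    + intros E; apply Hv; cbv beta; rewrite E; ring.
    + split; auto; destruct (H (p' v)) as [_ [_ H3]].
      * rewrite H2; intros E; apply Hv; cbv beta; rewrite E; ring.
      * rewrite <- H3, H1, H2; auto.
Qed.

Lemma th2_plus c c1 c2 a b y : bounded1 c1 -> bounded1 c2 ->
  (0 < a)%Z -> (0 < b)%Z -> 0 < y -> (forall v, c v = (c1 v + c2 v)%Z) ->
  th2 c (form a b) y = th2 c1 (form a b) y + th2 c2 (form a b) y.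
Proof.
  intros; unfold th2; rewrite <- tsum_plus by (apply summable_th2; auto).
  apply tsum_ext; intros v; rewrite H4, plus_IZR; ring.
Qed.

Lemma th2_minus c c1 c2 a b y : bounded1 c -> bounded1 c2 ->
  (0 < a)%Z -> (0 < b)%Z -> 0 < y -> (forall v, c v = (c1 v - c2 v)%Z) ->
  th2 c (form a b) y = th2 c1 (form a b) y - th2 c2 (form a b) y.
Proof.
  intros; rewrite (th2_plus c1 c c2); auto; [ring|].
  intros v; rewrite H4; ring.
Qed.

Lemma th2_ext c c' q y : (forall v, c v = c' v) -> th2 c q y = th2 c' q y.
Proof. intros H; apply tsum_ext; intros v; now rewrite H. Qed.

Lemma th2_scale c k a b y : th2 c (form (k * a) (k * b)) y = th2 c (form a b) (IZR k * y).
Proof.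
  apply tsum_ext; intros v; f_equal; f_equal; f_equal.
  rewrite (Rmult_comm (IZR k)), Rmult_assoc, <- mult_IZR; f_equal; f_equal; unfold form; ring.
Qed.

Lemma th2_reflect c a b y : bounded1 c -> (0 < a)%Z -> (0 < b)%Z -> 0 < y ->
  th2 (fun v => c (fst v, (- snd v)%Z)) (form a b) y = th2 c (form a b) y.
Proof.
  intros; apply (th2_bij _ _ _ _ _ (fun v => (fst v, (- snd v)%Z)) (fun v => (fst v, (- snd v)%Z))); auto.
  - intros [i j] _; cbn [fst snd]; rewrite Z.opp_involutive; repeat split; auto; unfold form; cbn [fst snd]; ring.
  - intros [i j] _; cbn [fst snd]; rewrite Z.opp_involutive; auto.
Qed.

Ltac ind_cases := repeat
  match goal with
  | H : context [Z.eqb ?a ?b] |- _ => destruct (Z.eqb_spec a b)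
  | |- context [Z.eqb ?a ?b] => destruct (Z.eqb_spec a b)
  end.
Ltac crush := unfold odd, sgn, ones, indic in *; cbn [fst snd] in *; ind_cases; try lia.

(** * Duplication formulas *)

Lemma th_split x : 0 < x -> th ones x = th ones (4 * x) + th odd x
  /\ th sgn x = th ones (4 * x) - th odd x.
Proof.
  intros Hx.
  assert (E : th ones (4 * x) = th (fun n => indic (n mod 2 =? 0)%Z) x).
  { apply (tsum_bij _ _ (fun n => (2 * n)%Z) (fun n => (n / 2)%Z)).
    - apply summable_th; auto; apply bounded1_indic.
    - intros j _; split; [lia|]; unfold ones, indic.
      destruct (Z.eqb_spec ((2 * j) mod 2) 0); [|lia]; do 2 f_equal.
      rewrite !mult_IZR; ring.
    - intros j H; unfold ones, indic in *.
      destruct (Z.eqb_spec (j mod 2) 0) as [e|e]; [|exfalso; apply H; ring]; split; [lia|].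
      do 2 f_equal; replace j with (2 * (j / 2))%Z at 3 4 by lia; rewrite !mult_IZR; ring. }
  rewrite E; unfold th; split; [rewrite <- tsum_plus|unfold Rminus].
  - apply tsum_ext; intros n; rewrite <- Rmult_plus_distr_r, <- plus_IZR; do 2 f_equal; crush.
  - apply summable_th; auto; apply bounded1_indic.
  - apply summable_th; auto with bnd.
  - replace (- tsum (fun n => IZR (odd n) * exp (- (x * IZR (n * n)))))
      with (-1 * tsum (fun n => IZR (odd n) * exp (- (x * IZR (n * n))))) by ring.
    rewrite <- tsum_scal, <- tsum_plus.
    + apply tsum_ext; intros n; rewrite <- Rmult_assoc, <- Rmult_plus_distr_r.
      rewrite <- (mult_IZR (-1)), <- plus_IZR; do 2 f_equal; crush.
    + apply summable_th; auto; apply bounded1_indic.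
    + apply summable_scal, summable_th; auto with bnd.
    + apply summable_th; auto with bnd.
Qed.

(** By multiplicativity the left side is chi (u^2 - 4 n^2), and u^2 - 4 n^2 is 1 or 5 modulo 8
    according to the parity of n. *)
Lemma chi_mult_dup u n : (u mod 2 = 1)%Z -> (chi (u + 2 * n) * chi (u - 2 * n) = sgn n)%Z.
Proof.
  intros Hu; unfold sgn.
  assert (E1 : ((u + 2 * n) mod 8 = (u mod 8 + 2 * (n mod 4)) mod 8)%Z) by lia.
  assert (E2 : ((u - 2 * n) mod 8 = (u mod 8 - 2 * (n mod 4)) mod 8)%Z) by lia.
  assert (E3 : (n mod 2 = (n mod 4) mod 2)%Z) by lia.
  assert (H : (u mod 8 = 1 \/ u mod 8 = 3 \/ u mod 8 = 5 \/ u mod 8 = 7)%Z) by lia.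
  assert (H' : (n mod 4 = 0 \/ n mod 4 = 1 \/ n mod 4 = 2 \/ n mod 4 = 3)%Z) by lia.
  unfold chi; rewrite E1, E2, E3.
  destruct H as [H|[H|[H|H]]], H' as [H'|[H'|[H'|H']]]; rewrite H, H'; reflexivity.
Qed.

Lemma chi_opp n : chi (- n) = chi n.
Proof.
  unfold chi; assert (E : ((- n) mod 8 = (8 - n mod 8) mod 8)%Z) by lia.
  assert (H : (n mod 8 = 0 \/ n mod 8 = 1 \/ n mod 8 = 2 \/ n mod 8 = 3 \/
    n mod 8 = 4 \/ n mod 8 = 5 \/ n mod 8 = 6 \/ n mod 8 = 7)%Z) by lia.
  rewrite E; destruct H as [H|[H|[H|[H|[H|[H|[H|H]]]]]]]; rewrite H; reflexivity.
Qed.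

(** The substitution i = u + 2n, j = u - 2n turns i^2 + j^2 into 2 u^2 + 8 n^2. For odd i, j exactly
    one of (i + j) / 2 and (i - j) / 2 is odd; [D] keeps the pairs where it is the first, and j ->
    -j exchanges the two halves, whence the factor 2. *)
Lemma square_dup (c d : Z -> Z) y : 0 < y -> bounded1 c -> bounded1 d ->
  (forall n, c n <> 0 -> n mod 2 = 1)%Z ->
  (forall n, c (- n) = c n)%Z ->
  (forall u n, u mod 2 = 1 -> c (u + 2 * n) * c (u - 2 * n) = d n)%Z ->
  th c y ^ 2 = 2 * (th odd (2 * y) * th d (8 * y)).
Proof.
  intros Hy Bc Bd Hodd Hopp Hd.
  replace (th c y ^ 2) with (th c (1 * y) * th c (1 * y)) by (rewrite Rmult_1_l; ring).
  rewrite !th_mult; auto with bnd; try lia.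
  set (D := fun v : Z * Z => (c (fst v) * c (snd v) * indic (((fst v + snd v) / 2) mod 2 =? 1))%Z).
  assert (BD : bounded1 D).
  { unfold D; apply bounded1_mult; [apply bounded1_mult|apply bounded1_indic];
      apply bounded1_comp; auto. }
  rewrite (th2_plus _ D (fun v => D (fst v, (- snd v)%Z))); auto; try lia.
  - rewrite th2_reflect; auto; try lia.
    assert (E : th2 (fun v => (odd (fst v) * d (snd v))%Z) (form 2 8) y = th2 D (form 1 1) y).
    { apply (th2_bij _ _ _ _ _ (fun v => (fst v + 2 * snd v, fst v - 2 * snd v)%Z)
        (fun v => ((fst v + snd v) / 2, (fst v - snd v) / 4)%Z)); auto; try lia.
      - intros [u n] H; unfold D; cbn [fst snd] in *.
        assert (Hu : (u mod 2 = 1)%Z) by (revert H; crush).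
        rewrite Hd; auto.
        replace ((u + 2 * n + (u - 2 * n)) / 2)%Z with u by lia.
        replace ((u + 2 * n - (u - 2 * n)) / 4)%Z with n by lia.
        rewrite Hu; repeat split; [|unfold form; cbn [fst snd]; ring].
        unfold odd, indic; rewrite Hu; cbn [fst snd]; ring.
      - intros [i j] H; unfold D in *; cbn [fst snd] in *.
        assert (Hi : c i <> 0%Z) by (intros E; apply H; rewrite E; ring).
        assert (Hj : c j <> 0%Z) by (intros E; apply H; rewrite E; ring).
        apply Hodd in Hi, Hj.
        assert (Hu : (((i + j) / 2) mod 2 = 1)%Z) by (revert H; unfold indic; destruct (Z.eqb_spec (((i + j) / 2) mod 2) 1); [auto|lia]).
        assert (E1 : ((i + j) / 2 + 2 * ((i - j) / 4) = i)%Z) by lia.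
        assert (E2 : ((i + j) / 2 - 2 * ((i - j) / 4) = j)%Z) by lia.
        rewrite <- (Hd ((i + j) / 2)%Z), E1, E2; auto; split; auto.
        unfold odd; rewrite Hu; cbn [fst snd]; ring. }
    rewrite E; ring.
  - intros v; apply BD.
  - intros [i j]; unfold D; cbn [fst snd]; rewrite Hopp.
    destruct (Z.eq_dec (c i) 0) as [E|Hi]; [rewrite E; ring|].
    destruct (Z.eq_dec (c j) 0) as [E|Hj]; [rewrite E; ring|].
    apply Hodd in Hi, Hj; unfold indic.
    destruct (Z.eqb_spec (((i + j) / 2) mod 2) 1), (Z.eqb_spec (((i + - j) / 2) mod 2) 1); lia.
Qed.

Lemma chi_square y : 0 < y -> th chi y ^ 2 = 2 * (th odd (2 * y) * th sgn (8 * y)).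
Proof.
  intros Hy; apply square_dup; auto with bnd.
  - intros n; destruct (chi_cases n); lia.
  - apply chi_opp.
  - apply chi_mult_dup.
Qed.

Lemma odd_square y : 0 < y -> th odd y ^ 2 = 2 * (th odd (2 * y) * th ones (8 * y)).
Proof.
  intros Hy; apply square_dup; auto with bnd.
  - intros n; crush.
  - intros n; crush.
  - intros u n; crush.
Qed.

(** The substitution i = m + n, j = m - n turns 2 m^2 + 2 n^2 into i^2 + j^2 over pairs of equal
    parity, with sign (-1)^{m+n} = (-1)^j. On the pairs of opposite parity, exchanging i and j
    reverses the sign, so that they cancel. *)
Lemma sgn_square y : 0 < y -> th sgn (2 * y) ^ 2 = th ones y * th sgn y.
Proof.
  intros Hy.
  replace (th sgn (2 * y) ^ 2) with (th sgn (2 * y) * th sgn (2 * y)) by ring.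
  replace (th ones y * th sgn y) with (th ones (1 * y) * th sgn (1 * y)) by (now rewrite Rmult_1_l).
  rewrite !th_mult; auto with bnd; try lia.
  set (D := fun v : Z * Z => (indic ((fst v + snd v) mod 2 =? 0) * sgn (snd v))%Z).
  set (E := fun v : Z * Z => (indic ((fst v + snd v) mod 2 =? 1) * sgn (snd v))%Z).
  assert (BD : bounded1 D) by (unfold D; bnd).
  assert (BE : bounded1 E) by (unfold E; bnd).
  rewrite (th2_plus (fun v => (ones (fst v) * sgn (snd v))%Z) D E); auto; try lia.
  2: intros [i j]; unfold D, E; crush.
  assert (Z0 : th2 E (form 1 1) y = th2 (fun v => (- E v)%Z) (form 1 1) y).
  { apply (th2_bij _ _ _ _ _ (fun v => (snd v, fst v)) (fun v => (snd v, fst v))); auto; try lia.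
    - intros v; specialize (BE v); lia.
    - intros [i j] H; unfold E in *; repeat split; [crush|unfold form; cbn [fst snd]; ring].
    - intros [i j] H; unfold E in *; split; auto; crush. }
  assert (Z1 : th2 (fun v => (- E v)%Z) (form 1 1) y = th2 (fun v => 0%Z) (form 1 1) y - th2 E (form 1 1) y).
  { apply th2_minus; auto; try lia. intros v; specialize (BE v); lia. }
  assert (Z2 : th2 (fun v => 0%Z) (form 1 1) y = 0).
  { apply tsum_eq; intros eps He; exists nil; split; [constructor|]; intros.
    rewrite lsum_zero by (intros; ring); rewrite Rminus_0_r, Rabs_R0; auto. }
  replace (th2 E (form 1 1) y) with 0 by lra; rewrite Rplus_0_r.
  apply (th2_bij _ _ _ _ _ (fun v => (fst v + snd v, fst v - snd v)%Z)
    (fun v => ((fst v + snd v) / 2, (fst v - snd v) / 2)%Z)); auto; try lia.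
  - intros [i j] _; unfold D; cbn [fst snd]; repeat split; [f_equal; lia|crush|unfold form; cbn [fst snd]; ring].
  - intros [i j] H; unfold D in *; cbn [fst snd] in *.
    assert ((i + j) mod 2 = 0)%Z by (revert H; crush).
    split; [f_equal; lia|crush].
Qed.

(** With z = pi^2 / (4x), th odd z = th ones z - th ones (4z) and th sgn x = 2 th ones (4x) - th
    ones x; inversion of [th ones] matches z with 4x and 4z with x. *)
Lemma odd_inv x : 0 < x -> th odd (PI ^ 2 / (4 * x)) = sqrt (x / PI) * th sgn x.
Proof.
  intros Hx; assert (P := PI_RGT_0).
  assert (Hz : 0 < PI ^ 2 / (4 * x)) by (apply Rdiv_lt_0_compat; [apply pow_lt|]; lra).
  destruct (th_split _ Hz) as [E1 _]; destruct (th_split _ Hx) as [E2 E3].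
  rewrite th_ones_inv in E1 by lra.
  replace (4 * (PI ^ 2 / (4 * x))) with (PI ^ 2 / x) in E1 by (field; lra).
  rewrite th_ones_inv in E1 by lra.
  replace (4 * x / PI) with (2 ^ 2 * (x / PI)) in E1 by (field; lra).
  rewrite sqrt_mult, sqrt_pow2 in E1; try lra.
  - replace (th sgn x) with (2 * th ones (4 * x) - th ones x) by lra; lra.
  - left; now apply Rdiv_lt_0_compat.
Qed.

(** Without the [odd] term, the difference of the two sides is twice the sum of e^{-y (4m^2 +
    12n^2)} over m + n odd. The substitution i = m + 3n, j = m - n makes the form i^2 + 3j^2 over
    odd pairs with i = j modulo 4, which are half of all odd pairs by j -> -j. *)
Lemma theta_degree3 y : 0 < y ->
  th ones (4 * y) * th ones (12 * y) = th odd y * th odd (3 * y) + th sgn (4 * y) * th sgn (12 * y).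
Proof.
  intros Hy.
  replace (th odd y) with (th odd (1 * y)) by (now rewrite Rmult_1_l).
  rewrite !th_mult; auto with bnd; try lia.
  set (E := fun v : Z * Z => indic ((fst v + snd v) mod 2 =? 1)%Z).
  set (D := fun v : Z * Z => (odd (fst v) * odd (snd v) * indic ((fst v - snd v) mod 4 =? 0))%Z).
  assert (BD : bounded1 D) by (unfold D; bnd).
  assert (BE : bounded1 E) by (unfold E; bnd).
  rewrite (th2_plus (fun v => (odd (fst v) * odd (snd v))%Z) D (fun v => D (fst v, (- snd v)%Z))); auto; try lia.
  2: intros v; apply BD.
  2: intros [i j]; unfold D; crush.
  rewrite th2_reflect; auto; try lia.
  rewrite (th2_plus _ E (fun v => (1 - E v)%Z)); auto; try lia.
  2: intros [i j]; unfold E; crush.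
  2: intros [i j]; unfold E; crush.
  rewrite (th2_minus (fun v => (sgn (fst v) * sgn (snd v))%Z) (fun v => (1 - E v)%Z) E); auto; try lia.
  2: bnd.
  2: intros [i j]; unfold E; crush.
  replace (th2 E (form 4 12) y) with (th2 D (form 1 3) y); [ring|symmetry].
  apply (th2_bij _ _ _ _ _ (fun v => (fst v + 3 * snd v, fst v - snd v)%Z)
    (fun v => ((fst v + 3 * snd v) / 4, (fst v - snd v) / 4)%Z)); auto; try lia.
  - intros [i j] H; unfold D, E in *; cbn [fst snd] in *; repeat split; [f_equal; lia|crush|unfold form; cbn [fst snd]; ring].
  - intros [i j] H; unfold D, E in *; cbn [fst snd] in *.
    split; [|crush].
    assert (i mod 2 = 1 /\ (i - j) mod 4 = 0)%Z by (revert H; crush).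
    f_equal; lia.
Qed.

(** * Theta identities of degree 15 *)

(** For j odd, the classes i = k j modulo 8 with k = 1, -1, 3, -3 exhaust the odd i, and chi i chi j
    = chi k is 1 on the first two and -1 on the others. [evensum] supplies the classes with j even
    that the substitutions below reach. *)
Definition oddcong (k : Z) (v : Z * Z) : Z :=
  (odd (snd v) * indic ((fst v - k * snd v) mod 8 =? 0))%Z.

Definition evensum (r : Z) (v : Z * Z) : Z :=
  (indic (snd v mod 2 =? 0) * indic ((fst v + snd v) mod 8 =? r))%Z.

Lemma bounded1_oddcong k : bounded1 (oddcong k).
Proof. unfold oddcong; bnd. Qed.

Lemma bounded1_evensum r : bounded1 (evensum r).
Proof. unfold evensum; bnd. Qed.

#[export] Hint Resolve bounded1_oddcong bounded1_evensum : bnd.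

Ltac mod8 i := let H := fresh in
  assert (H : (i mod 8 = 0 \/ i mod 8 = 1 \/ i mod 8 = 2 \/ i mod 8 = 3 \/
    i mod 8 = 4 \/ i mod 8 = 5 \/ i mod 8 = 6 \/ i mod 8 = 7)%Z)
  by (clear; lia); destruct H as [H|[H|[H|[H|[H|[H|[H|H]]]]]]]; rewrite !H.

Lemma lin_mod8 i j k : ((i - k * j) mod 8 = (i mod 8 - k * (j mod 8)) mod 8)%Z.
Proof. now rewrite Zminus_mod, <- Zmult_mod_idemp_r, <- Zminus_mod_idemp_l, <- Zminus_mod. Qed.

Lemma odd_mod8 n : odd n = odd (n mod 8).
Proof. unfold odd; do 2 f_equal; lia. Qed.

Lemma chi_mod8 n : chi n = chi (n mod 8).
Proof. unfold chi; now rewrite Z.mod_mod by lia. Qed.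

Lemma odd_oddcong v : (odd (fst v) * odd (snd v) =
  (oddcong 1 v + oddcong (-1) v) + (oddcong 3 v + oddcong (-3) v))%Z.
Proof.
  destruct v as [i j]; unfold oddcong; cbn [fst snd]; rewrite !(lin_mod8 i j), (odd_mod8 i), (odd_mod8 j).
  mod8 i; mod8 j; reflexivity.
Qed.

Lemma chi_oddcong v : (chi (fst v) * chi (snd v) =
  (oddcong 1 v + oddcong (-1) v) - (oddcong 3 v + oddcong (-3) v))%Z.
Proof.
  destruct v as [i j]; unfold oddcong; cbn [fst snd]; rewrite !(lin_mod8 i j), (odd_mod8 j), (chi_mod8 i), (chi_mod8 j).
  mod8 i; mod8 j; reflexivity.
Qed.

Lemma th2_oddcong_opp k a b y : (0 < a)%Z -> (0 < b)%Z -> 0 < y ->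
  th2 (oddcong (- k)) (form a b) y = th2 (oddcong k) (form a b) y.
Proof.
  intros; rewrite <- th2_reflect; auto with bnd.
  apply th2_ext; intros [i j]; unfold oddcong; cbn [fst snd].
  replace (odd (- j)) with (odd j) by crush.
  do 4 f_equal; ring.
Qed.

Lemma oddcong_pair k v : (k = 1 \/ k = 3)%Z -> (-1 <= oddcong k v + oddcong (-k) v <= 1)%Z.
Proof.
  destruct v as [i j]; unfold oddcong; cbn [fst snd]; rewrite !(lin_mod8 i j), (odd_mod8 j).
  intros [->| ->]; mod8 i; mod8 j; unfold odd, indic; simpl; lia.
Qed.

Lemma odd_chi_split a b y : (0 < a)%Z -> (0 < b)%Z -> 0 < y ->
  th odd (IZR a * y) * th odd (IZR b * y)
    = 2 * th2 (oddcong 1) (form a b) y + 2 * th2 (oddcong 3) (form a b) y /\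
  th chi (IZR a * y) * th chi (IZR b * y)
    = 2 * th2 (oddcong 1) (form a b) y - 2 * th2 (oddcong 3) (form a b) y.
Proof.
  intros Ha Hb Hy; rewrite !th_mult; auto with bnd.
  assert (B1 : bounded1 (fun v => oddcong 1 v + oddcong (-1) v)%Z) by (intros v; apply (oddcong_pair 1); auto).
  assert (B3 : bounded1 (fun v => oddcong 3 v + oddcong (-3) v)%Z) by (intros v; apply (oddcong_pair 3); auto).
  assert (Bc : bounded1 (fun v : Z * Z => chi (fst v) * chi (snd v))%Z) by bnd.
  rewrite (th2_plus _ _ _ a b y B1 B3 Ha Hb Hy odd_oddcong).
  rewrite (th2_minus _ _ _ a b y Bc B3 Ha Hb Hy chi_oddcong).
  rewrite (th2_plus (fun v => oddcong 1 v + oddcong (-1) v)%Z (oddcong 1) (oddcong (-1))); auto with bnd.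
  rewrite (th2_plus (fun v => oddcong 3 v + oddcong (-3) v)%Z (oddcong 3) (oddcong (-3))); auto with bnd.
  rewrite (th2_oddcong_opp 1), (th2_oddcong_opp 3); auto; split; ring.
Qed.

(* [i = -j + 8 l] with [j] odd turns [i^2 + 15 j^2] into [4 ((2 j - l)^2 + 15 l^2)]. *)
Lemma oddcong1_evensum4 y : 0 < y ->
  th2 (oddcong 1) (form 1 15) y = th2 (evensum 4) (form 1 15) y.
Proof.
  intros Hy; rewrite <- (th2_oddcong_opp 1) by (auto; lia).
  apply (th2_bij _ _ _ _ _
    (fun v => (4 * snd v - (fst v + snd v) / 4, (fst v + snd v) / 4)%Z)
    (fun v => (4 * snd v - (fst v + snd v) / 4, (fst v + snd v) / 4)%Z)); auto with bnd; try lia.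
  - intros [i j] H; unfold oddcong, evensum in *; cbn [fst snd] in *.
    assert (Hm : (j mod 2 = 1 /\ (i + j) mod 8 = 0)%Z) by (revert H; crush).
    assert (E : (i = 8 * ((i + j) / 8) - j)%Z) by lia.
    set (l := ((i + j) / 8)%Z) in *; rewrite E in *.
    replace ((8 * l - j + j) / 4)%Z with (2 * l)%Z by lia.
    repeat split; [f_equal; lia|crush|unfold form; cbn [fst snd]; ring].
  - intros [i j] H; unfold oddcong, evensum in *; cbn [fst snd] in *.
    assert (Hm : (j mod 2 = 0 /\ (i + j) mod 8 = 4)%Z) by (revert H; crush).
    split; [f_equal; lia|crush].
Qed.

(** The substitution i = 3m + 5n, j = m - n turns 24 m^2 + 40 n^2 into i^2 + 15 j^2, and i - 3j =
    8n. For j even, i = 3j modulo 8 says the same as i + j = 0 modulo 8. *)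
Lemma ones_24_40 y : 0 < y -> th ones (24 * y) * th ones (40 * y)
  = th2 (oddcong 3) (form 1 15) y + th2 (evensum 0) (form 1 15) y.
Proof.
  intros Hy; rewrite th_mult; auto with bnd; try lia.
  rewrite <- (th2_plus (fun v => indic ((fst v - 3 * snd v) mod 8 =? 0)%Z)); auto with bnd; try lia.
  2: intros [i j]; unfold oddcong, evensum; crush.
  apply (th2_bij _ _ _ _ _ (fun v => (3 * fst v + 5 * snd v, fst v - snd v)%Z)
    (fun v => ((fst v + 5 * snd v) / 8, (fst v - 3 * snd v) / 8)%Z)); auto with bnd; try lia.
  - bnd.
  - intros [i j] _; cbn [fst snd]; repeat split; [f_equal; lia|crush|unfold form; cbn [fst snd]; ring].
  - intros [i j] H; cbn [fst snd] in *.
    assert (Hm : ((i - 3 * j) mod 8 = 0)%Z) by (revert H; crush).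
    split; [f_equal; lia|crush].
Qed.

(** The same substitution; the sign (-1)^{m+n} becomes (-1)^j. *)
Lemma sgn_24_40 y : 0 < y -> th sgn (24 * y) * th sgn (40 * y)
  = th2 (evensum 0) (form 1 15) y - th2 (oddcong 3) (form 1 15) y.
Proof.
  intros Hy; rewrite th_mult; auto with bnd; try lia.
  rewrite <- (th2_minus (fun v => indic ((fst v - 3 * snd v) mod 8 =? 0) * sgn (snd v))%Z); auto with bnd; try lia.
  3: intros [i j]; unfold oddcong, evensum; crush.
  2: bnd.
  apply (th2_bij _ _ _ _ _ (fun v => (3 * fst v + 5 * snd v, fst v - snd v)%Z)
    (fun v => ((fst v + 5 * snd v) / 8, (fst v - 3 * snd v) / 8)%Z)); auto with bnd; try lia.
  - bnd.
  - intros [i j] _; cbn [fst snd]; repeat split; [f_equal; lia|crush|unfold form; cbn [fst snd]; ring].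
  - intros [i j] H; cbn [fst snd] in *.
    assert (Hm : ((i - 3 * j) mod 8 = 0)%Z) by (revert H; crush).
    split; [f_equal; lia|crush].
Qed.

(** The same substitution halved, for m and n odd: now i - 3j = 4n, which is 4 modulo 8. This is i =
    -j for j odd, and i + j = 4 for j even. *)
Lemma odd_6_10 y : 0 < y -> th odd (6 * y) * th odd (10 * y)
  = th2 (oddcong 1) (form 1 15) y + th2 (evensum 4) (form 1 15) y.
Proof.
  intros Hy; rewrite th_mult; auto with bnd; try lia.
  rewrite <- (th2_oddcong_opp 1) by (auto; lia).
  rewrite <- (th2_plus (fun v => indic ((fst v - 3 * snd v) mod 8 =? 4)%Z)); auto with bnd; try lia.
  2: intros [i j]; unfold oddcong, evensum; crush.
  apply (th2_bij _ _ _ _ _ (fun v => ((3 * fst v + 5 * snd v) / 2, (fst v - snd v) / 2)%Z)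
    (fun v => ((fst v + 5 * snd v) / 4, (fst v - 3 * snd v) / 4)%Z)); auto with bnd; try lia.
  - bnd.
  - intros [i j] H; cbn [fst snd] in *.
    assert (Hm : (i mod 2 = 1 /\ j mod 2 = 1)%Z) by (revert H; crush).
    assert (Ei : (i = 2 * (i / 2) + 1)%Z) by lia; assert (Ej : (j = 2 * (j / 2) + 1)%Z) by lia.
    set (a := (i / 2)%Z) in *; set (b := (j / 2)%Z) in *; rewrite Ei, Ej in *.
    replace ((3 * (2 * a + 1) + 5 * (2 * b + 1)) / 2)%Z with (3 * a + 5 * b + 4)%Z by lia.
    replace ((2 * a + 1 - (2 * b + 1)) / 2)%Z with (a - b)%Z by lia.
    repeat split; [f_equal; lia|crush|unfold form; cbn [fst snd]; ring].
  - intros [i j] H; cbn [fst snd] in *.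
    assert (Hm : ((i - 3 * j) mod 8 = 4)%Z) by (revert H; crush).
    split; [f_equal; lia|crush].
Qed.

(** For j = 2 modulo 4, the reflection j -> -j changes i + j by 4 modulo 8, so these parts of the
    two series cancel. What is left has i = 4m, j = 4n with sign (-1)^{m+n}. *)
Lemma sgn_16_240 y : 0 < y -> th sgn (16 * y) * th sgn (240 * y)
  = th2 (evensum 0) (form 1 15) y - th2 (evensum 4) (form 1 15) y.
Proof.
  intros Hy; rewrite th_mult; auto with bnd; try lia.
  set (D := fun r s v => (indic (snd v mod 4 =? r) * indic ((fst v + snd v) mod 8 =? s))%Z : Z).
  assert (BD : forall r s, bounded1 (D r s)) by (intros; unfold D; bnd).
  rewrite (th2_plus (evensum 0) (D 0%Z 0%Z) (D 2%Z 0%Z)); auto; try lia.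
  2: intros [i j]; unfold D, evensum; crush.
  rewrite (th2_plus (evensum 4) (D 0%Z 4%Z) (D 2%Z 4%Z)); auto; try lia.
  2: intros [i j]; unfold D, evensum; crush.
  rewrite <- (th2_reflect (D 2%Z 4%Z)); auto; try lia.
  rewrite (th2_ext (fun v => D 2%Z 4%Z (fst v, (- snd v)%Z)) (D 2%Z 0%Z)).
  2: intros [i j]; unfold D; crush.
  replace (th2 (D 0%Z 0%Z) (form 1 15) y + th2 (D 2%Z 0%Z) (form 1 15) y - (th2 (D 0%Z 4%Z) (form 1 15) y + th2 (D 2%Z 0%Z) (form 1 15) y))
    with (th2 (D 0%Z 0%Z) (form 1 15) y - th2 (D 0%Z 4%Z) (form 1 15) y) by ring.
  rewrite <- (th2_minus (fun v => D 0%Z 0%Z v - D 0%Z 4%Z v)%Z); auto; try lia.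
  2: intros [i j]; unfold D; crush.
  apply (th2_bij _ _ _ _ _ (fun v => (4 * fst v, 4 * snd v)%Z) (fun v => (fst v / 4, snd v / 4)%Z)); auto; try lia.
  - intros [i j]; unfold D; crush.
  - intros [i j] _; unfold D; cbn [fst snd]; repeat split; [f_equal; lia|crush|unfold form; cbn [fst snd]; ring].
  - intros [i j] H; unfold D in *; cbn [fst snd] in *.
    assert (Hm : (j mod 4 = 0 /\ (i + j) mod 4 = 0)%Z) by (revert H; crush).
    split; [f_equal; lia|crush].
Qed.

Lemma theta15_odd y : 0 < y ->
  2 * (th odd (6 * y) * th odd (10 * y)) = th odd y * th odd (15 * y) + th chi y * th chi (15 * y).
Proof.
  intros Hy; destruct (odd_chi_split 1 15 y) as [H1 H2]; try lia; auto.
  rewrite Rmult_1_l in H1, H2; rewrite H1, H2, odd_6_10, oddcong1_evensum4; auto; ring.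
Qed.

Lemma theta15_ones y : 0 < y ->
  2 * (th ones (24 * y) * th ones (40 * y))
  = 2 * (th sgn (16 * y) * th sgn (240 * y)) + th odd y * th odd (15 * y).
Proof.
  intros Hy; destruct (odd_chi_split 1 15 y) as [H1 _]; try lia; auto.
  rewrite Rmult_1_l in H1; rewrite H1, ones_24_40, sgn_16_240, oddcong1_evensum4; auto; ring.
Qed.

Lemma theta15_sgn y : 0 < y ->
  2 * (th sgn (24 * y) * th sgn (40 * y))
  = 2 * (th sgn (16 * y) * th sgn (240 * y)) + th chi y * th chi (15 * y).
Proof.
  intros Hy; destruct (odd_chi_split 1 15 y) as [_ H2]; try lia; auto.
  rewrite Rmult_1_l in H2; rewrite H2, sgn_24_40, sgn_16_240, oddcong1_evensum4; auto; ring.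
Qed.

(* Here [m = 3 n + 8 l] turns [3 m^2 + 5 n^2] into [2 ((4 n + 9 l)^2 + 15 l^2)]. *)
Lemma theta15_chi y : 0 < y ->
  th odd (3 * y) * th odd (5 * y) - th chi (3 * y) * th chi (5 * y)
  = 2 * (th odd (2 * y) * th odd (30 * y)).
Proof.
  intros Hy; destruct (odd_chi_split 3 5 y) as [H1 H2]; try lia; auto; rewrite H1, H2.
  destruct (odd_chi_split 1 15 (2 * y)) as [H3 _]; try lia; try lra.
  replace (30 * y) with (15 * (2 * y)) by ring; rewrite Rmult_1_l in H3; rewrite H3.
  assert (E : th2 (oddcong 3) (form 3 5) y
    = th2 (oddcong 3) (form 1 15) (2 * y) + th2 (oddcong 1) (form 1 15) (2 * y)); [|lra].
  assert (Hy2 : 0 < 2 * y) by lra.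
  rewrite oddcong1_evensum4, <- (th2_oddcong_opp 3 1 15), <- (th2_reflect (evensum 4)); auto with bnd; try lia.
  rewrite <- (th2_plus (fun v => indic ((fst v - snd v) mod 8 =? 4)%Z)); auto with bnd; try lia; try lra.
  2: intros v; apply bounded1_evensum.
  2: intros [i j]; unfold oddcong, evensum; crush.
  rewrite <- (th2_scale _ 2 1 15); cbn [Z.mul Pos.mul Pos.add].
  apply (th2_bij _ _ _ _ _
    (fun v => (4 * snd v + 9 * ((fst v - 3 * snd v) / 8), (fst v - 3 * snd v) / 8)%Z)
    (fun v => (3 * ((fst v - 9 * snd v) / 4) + 8 * snd v, (fst v - 9 * snd v) / 4)%Z)); auto with bnd; try lia.
  - bnd.
  - intros [i j] H; unfold oddcong in *; cbn [fst snd] in *.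
    assert (Hm : (j mod 2 = 1 /\ (i - 3 * j) mod 8 = 0)%Z) by (revert H; crush).
    assert (E : (i = 8 * ((i - 3 * j) / 8) + 3 * j)%Z) by lia.
    set (l := ((i - 3 * j) / 8)%Z) in *; rewrite E in *.
    repeat split; [f_equal; lia|crush|unfold form; cbn [fst snd]; ring].
  - intros [i j] H; unfold oddcong in *; cbn [fst snd] in *.
    assert (Hm : ((i - j) mod 8 = 4)%Z) by (revert H; crush).
    split; [f_equal; lia|crush].
Qed.

(** * The tetracode and the cubic relation *)

(** Splitting by residues modulo 3 provides the variables of the weight enumerator: class 0 gives x,
    classes 1 and 2 both give y. *)
Definition chi3 (r n : Z) : Z := (chi n * indic (n mod 3 =? r))%Z.

Lemma bounded1_chi3 r : bounded1 (chi3 r).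
Proof. unfold chi3; apply bounded1_mult; [apply bounded1_chi|apply bounded1_indic]. Qed.

Lemma chi_triple n : (chi (3 * n) = - chi n)%Z.
Proof.
  rewrite (chi_mod8 (3 * n)), (chi_mod8 n), <- Zmult_mod_idemp_r; mod8 n; reflexivity.
Qed.

Lemma th_chi3_0 y : 0 < y -> th (chi3 0) y = - th chi (9 * y).
Proof.
  intros Hy; replace (- th chi (9 * y)) with (-1 * th chi (9 * y)) by ring; unfold th.
  rewrite <- tsum_scal by (apply summable_th; auto with bnd; lra).
  symmetry; apply (tsum_bij _ _ (fun n => (3 * n)%Z) (fun n => (n / 3)%Z)).
  - apply summable_th; auto using bounded1_chi3.
  - intros n _; split; [lia|]; unfold chi3; rewrite chi_triple.
    unfold indic; destruct (Z.eqb_spec ((3 * n) mod 3) 0); [|lia].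
    replace (- chi n * 1)%Z with (-1 * chi n)%Z by ring; rewrite (mult_IZR (-1)).
    replace (y * IZR (3 * n * (3 * n))) with (9 * y * IZR (n * n)) by (rewrite !mult_IZR; ring).
    ring.
  - intros n; unfold chi3, indic; destruct (Z.eqb_spec (n mod 3) 0) as [e|e].
    + intros _; assert (Hm : exists m, n = (3 * m)%Z) by (exists (n / 3)%Z; lia).
      destruct Hm as [m ->]; replace (3 * m / 3)%Z with m by lia; split; auto.
      rewrite chi_triple; replace (- chi m * 1)%Z with (-1 * chi m)%Z by ring; rewrite (mult_IZR (-1)).
      replace (y * IZR (3 * m * (3 * m))) with (9 * y * IZR (m * m)) by (rewrite !mult_IZR; ring).
      ring.
    + intros H; exfalso; apply H; rewrite Z.mul_0_r; ring.
Qed.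

Lemma th_chi3_2 y : 0 < y -> th (chi3 2) y = th (chi3 1) y.
Proof.
  intros Hy; unfold th; apply (tsum_bij _ _ (fun n => (- n)%Z) (fun n => (- n)%Z)).
  - apply summable_th; auto using bounded1_chi3.
  - intros n _; split; [lia|]; rewrite Z.mul_opp_opp; do 2 f_equal.
    unfold chi3; rewrite chi_opp; f_equal; crush.
  - intros n _; split; [lia|]; rewrite Z.mul_opp_opp; do 2 f_equal.
    unfold chi3; rewrite chi_opp; f_equal; crush.
Qed.

Lemma th_chi_split3 y : 0 < y -> th chi y = th (chi3 0) y + 2 * th (chi3 1) y.
Proof.
  intros Hy; replace (th (chi3 0) y + 2 * th (chi3 1) y)
    with (th (chi3 0) y + (th (chi3 1) y + th (chi3 2) y)) by (rewrite th_chi3_2; auto; ring).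
  assert (H := fun r => summable_th (chi3 r) y (bounded1_chi3 r) Hy).
  unfold th; rewrite <- !tsum_plus; auto using summable_plus.
  apply tsum_ext; intros n; rewrite <- !Rmult_plus_distr_r, <- !plus_IZR; do 2 f_equal.
  unfold chi3; crush.
Qed.

Definition Z4 : Type := ((Z * Z) * (Z * Z))%type.
Definition chi4 (v : Z4) : Z :=
  let '((a, b), (c, d)) := v in (chi a * chi b * (chi c * chi d))%Z.
Definition norm4 (v : Z4) : Z :=
  let '((a, b), (c, d)) := v in ((a * a + b * b) + (c * c + d * d))%Z.
Definition tetracode (v : Z4) : bool :=
  let '((a, b), (c, d)) := v in andb ((b + c + d) mod 3 =? 0)%Z ((a - c + d) mod 3 =? 0)%Z.
Definition tetracode_words : list Z4 := (
  ((0, 0), (0, 0)) :: ((2, 2), (0, 1)) :: ((1, 1), (0, 2)) :: ((1, 2), (1, 0)) :: ((0, 1), (1, 1)) ::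
  ((2, 0), (1, 2)) :: ((2, 1), (2, 0)) :: ((1, 0), (2, 1)) :: ((0, 2), (2, 2)) :: nil)%Z.

(* An integer matrix with orthogonal rows of norm 3; its image is the lattice of the vectors
   reducing to the tetracode modulo 3, so this lattice is a copy of Z^4 scaled by sqrt 3. *)
Definition tetra (w : Z4) : Z4 :=
  let '((a, b), (c, d)) := w in ((b + c + d, a + c - d), (a - b + d, a + b - c))%Z.
Definition tetra_inv (v : Z4) : Z4 :=
  let '((a, b), (c, d)) := v in
  (((b + c + d) / 3, (a - c + d) / 3), ((a + b - d) / 3, (a - b + c) / 3))%Z.

Lemma norm4_tetra w : norm4 (tetra w) = (3 * norm4 w)%Z.
Proof. destruct w as [[a b] [c d]]; unfold norm4, tetra; ring. Qed.

Lemma tetracode_tetra w : tetracode (tetra w) = true.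
Proof.
  destruct w as [[a b] [c d]]; unfold tetracode, tetra.
  apply andb_true_intro; split; apply Z.eqb_eq; lia.
Qed.

Lemma tetra_invK w : tetra_inv (tetra w) = w.
Proof. destruct w as [[a b] [c d]]; unfold tetra_inv, tetra; repeat f_equal; lia. Qed.

Lemma tetraK v : tetracode v = true -> tetra (tetra_inv v) = v.
Proof.
  destruct v as [[a b] [c d]]; unfold tetracode, tetra, tetra_inv; intros H.
  apply andb_prop in H; destruct H as [H1 H2]; apply Z.eqb_eq in H1, H2.
  repeat f_equal; lia.
Qed.

Lemma chi_congr m n : (m mod 8 = n mod 8)%Z -> chi m = chi n.
Proof. intros H; rewrite (chi_mod8 m), H; symmetry; apply chi_mod8. Qed.

(** Both sides depend only on the coordinates modulo 8, so a computation over 8^4 vectors decides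
    it. *)
Lemma chi4_tetra w : chi4 (tetra w) = (- chi4 w)%Z.
Proof.
  set (l := (0 :: 1 :: 2 :: 3 :: 4 :: 5 :: 6 :: 7 :: nil)%Z).
  assert (C : forallb (fun w => (chi4 (tetra w) =? - chi4 w)%Z)
    (list_prod (list_prod l l) (list_prod l l)) = true) by (vm_compute; reflexivity).
  rewrite forallb_forall in C.
  assert (L : forall n, In (n mod 8)%Z l) by (intros n; simpl; lia).
  destruct w as [[a b] [c d]].
  specialize (C ((a mod 8, b mod 8), (c mod 8, d mod 8))%Z
    (in_prod _ _ _ _ (in_prod _ _ _ _ (L a) (L b)) (in_prod _ _ _ _ (L c) (L d)))).
  apply Z.eqb_eq in C; unfold chi4, tetra in *; rewrite <- !chi_mod8 in C; rewrite <- C.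
  f_equal; f_equal; apply chi_congr; lia.
Qed.

(** As a sum over the nine words of products of residue conditions, the indicator makes the lattice
    sum a sum of products of four one-variable series. *)
Lemma tetracode_indic v : indic (tetracode v) =
  fold_right Z.add 0%Z (map (fun r : Z4 =>
    indic (fst (fst v) mod 3 =? fst (fst r)) * indic (snd (fst v) mod 3 =? snd (fst r)) *
    (indic (fst (snd v) mod 3 =? fst (snd r)) * indic (snd (snd v) mod 3 =? snd (snd r))))%Z
   tetracode_words).
Proof.
  destruct v as [[a b] [c d]]; unfold tetracode; cbn [fst snd].
  replace ((b + c + d) mod 3)%Z with ((b mod 3 + c mod 3 + d mod 3) mod 3)%Z by lia.
  replace ((a - c + d) mod 3)%Z with ((a mod 3 - c mod 3 + d mod 3) mod 3)%Z by lia.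
  assert (M : forall n, (n mod 3 = 0 \/ n mod 3 = 1 \/ n mod 3 = 2)%Z) by (intros; lia).
  destruct (M a) as [->|[->| ->]], (M b) as [->|[->| ->]], (M c) as [->|[->| ->]], (M d) as [->|[->| ->]];
    reflexivity.
Qed.

Lemma tsum_prod4 (f g h k : Z -> R) : summable f -> summable g -> summable h -> summable k ->
  summable (fun v : Z4 => f (fst (fst v)) * g (snd (fst v)) * (h (fst (snd v)) * k (snd (snd v)))) /\
  tsum (fun v : Z4 => f (fst (fst v)) * g (snd (fst v)) * (h (fst (snd v)) * k (snd (snd v))))
  = tsum f * tsum g * (tsum h * tsum k).
Proof.
  intros Hf Hg Hh Hk.
  assert (H1 := summable_prod f g Hf Hg); assert (H2 := summable_prod h k Hh Hk).
  split; [exact (summable_prod _ _ H1 H2)|].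
  rewrite <- (tsum_prod f g), <- (tsum_prod h k) by auto; exact (tsum_prod _ _ H1 H2).
Qed.

(** Put x = [th (chi3 0) y] = - [th chi (9 * y)] and w = [th (chi3 1) y]. Every nonzero word has
    exactly one zero coordinate, so the lattice sum is x^4 + 8 x w^3; by [chi4_tetra] it equals -
    [th chi (3 * y) ^ 4]. Finally 2w = [th chi y + th chi (9 * y)]. *)
Lemma chi_cubic y : 0 < y ->
  th chi (3 * y) ^ 4 + th chi (9 * y) ^ 4 = th chi (9 * y) * (th chi y + th chi (9 * y)) ^ 3.
Proof.
  intros Hy.
  set (g := fun (c : Z -> Z) x n => IZR (c n) * exp (- (x * IZR (n * n)))).
  assert (S3 := summable_th chi (3 * y) bounded1_chi ltac:(lra)); fold (g chi (3 * y)) in S3.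
  assert (Sr := fun r => summable_th (chi3 r) y (bounded1_chi3 r) Hy).
  destruct (tsum_prod4 _ _ _ _ S3 S3 S3 S3) as [_ P3].
  set (term := fun (r v : Z4) =>
    g (chi3 (fst (fst r))) y (fst (fst v)) * g (chi3 (snd (fst r))) y (snd (fst v)) *
    (g (chi3 (fst (snd r))) y (fst (snd v)) * g (chi3 (snd (snd r))) y (snd (snd v)))).
  destruct (tsum_lsum term tetracode_words) as [Ss Et].
  { intros r; exact (proj1 (tsum_prod4 _ _ _ _ (Sr _) (Sr _) (Sr _) (Sr _))). }
  rewrite (lsum_ext _ (fun r : Z4 => th (chi3 (fst (fst r))) y * th (chi3 (snd (fst r))) y *
    (th (chi3 (fst (snd r))) y * th (chi3 (snd (snd r))) y))) in Et.
  2: intros r _; exact (proj2 (tsum_prod4 _ _ _ _ (Sr _) (Sr _) (Sr _) (Sr _))).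
  unfold tetracode_words in Et at 2; cbn [lsum fold_right fst snd] in Et.
  rewrite !th_chi3_2 in Et by auto.
  assert (Ef : forall v, lsum (fun r => term r v) tetracode_words =
    IZR (chi4 v * indic (tetracode v)) * exp (- (y * IZR (norm4 v)))).
  { intros v; rewrite tetracode_indic, mult_IZR.
    assert (Et4 : forall r, term r v = IZR (chi4 v) * exp (- (y * IZR (norm4 v))) *
      IZR (indic (fst (fst v) mod 3 =? fst (fst r)) * indic (snd (fst v) mod 3 =? snd (fst r)) *
        (indic (fst (snd v) mod 3 =? fst (snd r)) * indic (snd (snd v) mod 3 =? snd (snd r))))%Z).
    { intros r; unfold term, g, chi3, chi4, norm4; destruct v as [[a b] [c d]]; cbn [fst snd].
      rewrite !plus_IZR, !(mult_IZR (_ * _)), !mult_IZR, !Rmult_plus_distr_l, !Ropp_plus_distr, !exp_plus; ring. }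
    rewrite (lsum_ext _ _ _ (fun r _ => Et4 r)), lsum_scal.
    rewrite (Rmult_assoc _ (IZR _)), (Rmult_comm (IZR (fold_right _ _ _))), <- Rmult_assoc; f_equal.
    clear; induction tetracode_words as [|r l IH]; [reflexivity|].
    cbn [lsum fold_right map]; rewrite plus_IZR, <- IH; reflexivity. }
  assert (E : th chi (3 * y) * th chi (3 * y) * (th chi (3 * y) * th chi (3 * y)) =
    - tsum (fun v => lsum (fun r => term r v) tetracode_words)).
  { unfold th at 1 2 3 4; fold (g chi (3 * y)); rewrite <- P3.
    replace (- tsum (fun v => lsum (fun r => term r v) tetracode_words))
      with (-1 * tsum (fun v => lsum (fun r => term r v) tetracode_words)) by ring.
    rewrite <- tsum_scal by auto.
    assert (Eh : forall w : Z4, g chi (3 * y) (fst (fst w)) * g chi (3 * y) (snd (fst w)) *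
      (g chi (3 * y) (fst (snd w)) * g chi (3 * y) (snd (snd w)))
      = IZR (chi4 w) * exp (- (y * IZR (3 * norm4 w)))).
    { intros [[a b] [c d]]; unfold g, chi4, norm4; cbn [fst snd].
      replace (y * IZR (3 * (a * a + b * b + (c * c + d * d))))
        with ((3 * y * IZR (a * a) + 3 * y * IZR (b * b)) + (3 * y * IZR (c * c) + 3 * y * IZR (d * d)))
        by (rewrite (mult_IZR 3), !plus_IZR; ring).
      rewrite !Ropp_plus_distr, !exp_plus, (mult_IZR (_ * _)), (mult_IZR (chi a)), (mult_IZR (chi c)); ring. }
    assert (Ei : forall w, -1 * lsum (fun r => term r (tetra w)) tetracode_words
      = IZR (chi4 w) * exp (- (y * IZR (3 * norm4 w)))).
    { intros w; rewrite Ef, chi4_tetra, norm4_tetra, tetracode_tetra; unfold indic.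
      replace (- chi4 w * 1)%Z with (-1 * chi4 w)%Z by ring; rewrite (mult_IZR (-1)); ring. }
    apply (tsum_bij _ _ tetra tetra_inv).
    - now apply summable_scal.
    - intros w _; rewrite Eh, Ei; split; auto using tetra_invK.
    - intros v Hv.
      assert (Hc : tetracode v = true).
      { destruct (tetracode v) eqn:Hc; auto; exfalso; apply Hv.
        rewrite Ef, Hc; unfold indic; rewrite Z.mul_0_r; ring. }
      split; [now apply tetraK|]; rewrite Eh, <- Ei, tetraK; auto. }
  rewrite (th_chi_split3 y) by auto.
  assert (D0 := th_chi3_0 y Hy).
  replace (th chi (9 * y)) with (- th (chi3 0) y) by lra.
  replace (th chi (3 * y) ^ 4)
    with (th chi (3 * y) * th chi (3 * y) * (th chi (3 * y) * th chi (3 * y))) by ring.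
  rewrite E, Et; ring.
Qed.

(** * Positivity, and the relation with psi *)

Lemma th_odd_pos x : 0 < x -> 0 < th odd x.
Proof.
  intros Hx; apply (tsum_pos _ 1%Z).
  - intros n; apply Rmult_le_pos; [|left; apply exp_pos].
    apply IZR_le; crush.
  - apply summable_th; auto with bnd.
  - apply Rmult_lt_0_compat; [apply IZR_lt; reflexivity|apply exp_pos].
Qed.

(** The terms alternate in sign, but inversion leads to [th odd], whose terms are nonnegative. *)
Lemma th_sgn_pos x : 0 < x -> 0 < th sgn x.
Proof.
  intros Hx; assert (P := PI_RGT_0).
  assert (H := th_odd_pos (PI ^ 2 / (4 * x)) ltac:(apply Rdiv_lt_0_compat; [apply pow_lt|]; lra)).
  rewrite odd_inv in H by auto.
  assert (0 < sqrt (x / PI)) by (apply sqrt_lt_R0, Rdiv_lt_0_compat; lra).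
  apply (Rmult_lt_reg_l (sqrt (x / PI))); lra.
Qed.

(** With x and z the values at y and 9y, the cubic relation reads [th chi (3 * y) ^ 4] = z x (x^2 +
    3xz + 3z^2). The left side is positive by [chi_square], and the quadratic form is positive
    definite. *)
Lemma th_chi_descent y : 0 < y -> 0 < th chi (9 * y) -> 0 < th chi y.
Proof.
  intros Hy Hz; assert (C := chi_cubic y Hy).
  assert (Q : 0 < th chi (3 * y) ^ 4).
  { replace (th chi (3 * y) ^ 4) with ((th chi (3 * y) ^ 2) ^ 2) by ring.
    apply pow_lt; rewrite chi_square by lra.
    assert (H1 := th_odd_pos (2 * (3 * y)) ltac:(lra)); assert (H2 := th_sgn_pos (8 * (3 * y)) ltac:(lra)); nra. }
  set (x := th chi y) in *; set (z := th chi (9 * y)) in *.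
  assert (E : 0 < z * (x * (x ^ 2 + 3 * x * z + 3 * z ^ 2))) by nra.
  assert (F : 0 < x ^ 2 + 3 * x * z + 3 * z ^ 2).
  { assert (0 < z ^ 2) by (now apply pow_lt); assert (0 <= (x + 3 / 2 * z) ^ 2) by apply pow2_ge_0; lra. }
  assert (0 < x * (x ^ 2 + 3 * x * z + 3 * z ^ 2)) by (apply (Rmult_lt_reg_l z); [auto|rewrite Rmult_0_r; auto]).
  apply (Rmult_lt_reg_r (x ^ 2 + 3 * x * z + 3 * z ^ 2)); [auto|rewrite Rmult_0_l; auto].
Qed.

Lemma pow9_ge k : INR k <= 9 ^ k.
Proof.
  induction k as [|k IH]; [simpl; lra|].
  rewrite S_INR; simpl pow; assert (H := pow_R1_Rle 9 k ltac:(lra)); lra.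
Qed.

(** Only n = 1 and n = -1 survive. Where [chi n] is nonzero, n^2 - 1 >= 0, so the terms for k = 0
    dominate all later ones. *)
Lemma th_chi_lim y : 0 < y -> is_lim_seq (fun k => exp (9 ^ k * y) * th chi (9 ^ k * y)) 2.
Proof.
  intros Hy.
  set (a := fun (k : nat) (n : Z) => IZR (chi n) * exp (- (9 ^ k * y * IZR (n * n - 1)))).
  set (b := fun n : Z => if (n * n =? 1)%Z then 1 else 0).
  assert (Eb : tsum b = 2).
  { destruct (finite_support b (1 :: -1 :: nil)%Z) as [_ ->].
    - repeat constructor; simpl; lia.
    - intros n Hn; unfold b; destruct (Z.eqb_spec (n * n) 1); auto.
      exfalso; apply Hn; simpl; nia.
    - unfold b; simpl; ring. }
  assert (C0 : forall n, chi n <> 0%Z -> (1 <= n * n)%Z).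
  { intros n Hn; destruct (chi_cases n); [lia|nia]. }
  assert (P9 : forall k, 1 <= 9 ^ k) by (intros; apply pow_R1_Rle; lra).
  apply (is_lim_seq_ext (fun k => tsum (a k))).
  - intros k; unfold th; rewrite <- tsum_scal.
    + apply tsum_ext; intros n; unfold a; rewrite minus_IZR.
      replace (- (9 ^ k * y * (IZR (n * n) - 1))) with (9 ^ k * y + - (9 ^ k * y * IZR (n * n))) by ring.
      rewrite exp_plus; ring.
    + apply summable_th; auto with bnd; specialize (P9 k); nra.
  - rewrite <- Eb; apply (tsum_lim a b (fun n => exp y * exp (- (y * IZR (n * n))))).
    + apply summable_scal, summable_gauss; auto.
    + intros k n; unfold a; destruct (Z.eq_dec (chi n) 0) as [E|E].
      * rewrite E, Rmult_0_l, Rabs_R0; apply Rmult_le_pos; left; apply exp_pos.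
      * rewrite Rabs_mult, (Rabs_pos_eq (exp _)) by (left; apply exp_pos).
        destruct (bounded1_chi n) as [B1 B2]; apply IZR_le in B1, B2.
        rewrite <- exp_plus, <- (Rmult_1_l (exp (y + _))).
        apply Rmult_le_compat; [apply Rabs_pos|left; apply exp_pos|apply Rabs_le; lra|].
        apply exp_le; apply C0, IZR_le in E; rewrite minus_IZR; specialize (P9 k).
        assert (0 <= (9 ^ k - 1) * (y * (IZR (n * n) - 1))); [|nra].
        apply Rmult_le_pos; [lra|]; apply Rmult_le_pos; lra.
    + intros n; unfold a, b; destruct (Z.eqb_spec (n * n) 1) as [E|E].
      * rewrite E; replace (IZR (chi n)) with 1 by (assert (n = 1 \/ n = -1)%Z as [->| ->] by nia; reflexivity).
        apply (is_lim_seq_ext (fun _ => 1)); [|apply is_lim_seq_const].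
        intros k; rewrite Rmult_0_r, Ropp_0, exp_0; ring.
      * destruct (Z.eq_dec (chi n) 0) as [E0|E0].
        { rewrite E0; apply (is_lim_seq_ext (fun _ => 0)); [intros; ring|apply is_lim_seq_const]. }
        replace (Finite 0) with (Finite (IZR (chi n) * 0)) by (f_equal; ring).
        apply is_lim_seq_mult'; [apply is_lim_seq_const|].
        assert (Hn : (1 <= n * n - 1)%Z) by (specialize (C0 n E0); lia); apply IZR_le in Hn.
        apply (is_lim_seq_le_le (fun _ => 0) _ (fun k => exp (- y) ^ k)).
        { intros k; split; [left; apply exp_pos|].
          rewrite exp_pow; apply exp_le; assert (Hk := pow9_ge k); specialize (P9 k).
          assert (INR k * y <= 9 ^ k * y) by (apply Rmult_le_compat_r; lra).
          assert (9 ^ k * y * 1 <= 9 ^ k * y * IZR (n * n - 1)) by (apply Rmult_le_compat_l; nra).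
          lra. }
        { apply is_lim_seq_const. }
        { apply is_lim_seq_geom; rewrite Rabs_pos_eq by (left; apply exp_pos).
          rewrite <- exp_0; apply exp_increasing; lra. }
Qed.

(** The limit 2 gives positivity at some 9^k y, from where k descents lead back to y. *)
Lemma th_chi_pos y : 0 < y -> 0 < th chi y.
Proof.
  intros Hy; assert (L := th_chi_lim y Hy); apply is_lim_seq_spec in L.
  destruct (L (mkposreal _ Rlt_0_1)) as [k Hk]; specialize (Hk k (le_n k)); simpl in Hk.
  apply Rabs_def2 in Hk; destruct Hk as [_ Hk].
  assert (H : 0 < th chi (9 ^ k * y)).
  { apply (Rmult_lt_reg_l (exp (9 ^ k * y))); [apply exp_pos|lra]. }
  clear L Hk; revert H; induction k as [|k IH]; simpl pow; intros H.
  - now rewrite Rmult_1_l in H.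
  - apply IH, th_chi_descent; [apply Rmult_lt_0_compat; auto; apply pow_lt; lra|].
    now rewrite <- Rmult_assoc.
Qed.

Lemma lsum_sum_n (f : nat -> R) n : lsum f (seq 0 (S n)) = sum_n f n.
Proof.
  induction n as [|n IH]; [rewrite sum_O; simpl; ring|].
  rewrite seq_S, lsum_app, IH, sum_Sn; unfold plus; simpl; ring.
Qed.

(** The reflection n -> -1 - n is the change of sign of 2n + 1; it folds Z onto the natural
    numbers. *)
Lemma tsum_symmetric_series (f : Z -> R) : summable f -> (forall n, f (-1 - n)%Z = f n) ->
  is_series (fun n => f (Z.of_nat n)) (tsum f / 2).
Proof.
  intros Hf Hs.
  assert (L : is_lim_seq (sum_n (fun n => f (Z.of_nat n))) (tsum f / 2)); [|exact L].
  apply is_lim_seq_spec; intros eps.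
  destruct (summable_has_sum f Hf eps (cond_pos eps)) as [l0 [_ Hl0]].
  destruct (Z_list_bound l0) as [N HN].
  exists N; intros n Hn.
  set (l := map Z.of_nat (seq 0 (S n)) ++ map (fun k => (-1 - Z.of_nat k)%Z) (seq 0 (S n))).
  assert (E : lsum f l = 2 * sum_n (fun n => f (Z.of_nat n)) n).
  { unfold l; rewrite lsum_app, !lsum_map, <- lsum_sum_n.
    rewrite (lsum_ext (fun j => f (-1 - Z.of_nat j)%Z) (fun j => f (Z.of_nat j))) by auto; ring. }
  assert (D : Rabs (lsum f l - tsum f) < eps).
  { apply Hl0.
    - apply NoDup_app; try (apply FinFun.Injective_map_NoDup; [intros i j; lia|apply seq_NoDup]).
      intros z H1 H2; apply in_map_iff in H1, H2; destruct H1 as [i [<- _]], H2 as [j [H2 _]]; lia.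
    - intros z Hz; apply HN in Hz; apply in_app_iff.
      destruct (Z_le_gt_dec 0 z); [left|right]; apply in_map_iff.
      + exists (Z.to_nat z); rewrite in_seq; lia.
      + exists (Z.to_nat (-1 - z)); rewrite in_seq; lia. }
  rewrite E in D; apply Rabs_def2 in D; assert (H := cond_pos eps); apply Rabs_def1; lra.
Qed.

(** Writing n = 4m + r, k has the parity of r (r + 1) / 2 and 2n + 1 is 2r + 1 modulo 8, so the sign
    is a check over r = 0, 1, 2, 3. *)
Lemma triangular_sign n : exists k : nat, ((n * (n + 1)) / 2 = k)%nat /\
  ((2 * Z.of_nat n + 1) * (2 * Z.of_nat n + 1) = 8 * Z.of_nat k + 1)%Z /\
  IZR (chi (2 * Z.of_nat n + 1)) = (-1) ^ k.
Proof.
  set (m := (n / 4)%nat).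
  assert (K : exists r t, (n = 4 * m + r)%nat /\ (2 * t = r * (r + 1))%nat /\ (r < 4)%nat /\
    chi (2 * Z.of_nat r + 1) = (if Nat.even t then 1 else -1)%Z).
  { exists (n mod 4)%nat.
    assert (H : (n mod 4 = 0 \/ n mod 4 = 1 \/ n mod 4 = 2 \/ n mod 4 = 3)%nat)
      by (assert (B := Nat.mod_upper_bound n 4 ltac:(lia)); lia).
    assert (E := Nat.div_mod_eq n 4); fold m in E.
    destruct H as [H|[H|[H|H]]]; rewrite H in *;
      [exists 0%nat|exists 1%nat|exists 3%nat|exists 6%nat]; repeat split; auto; lia. }
  clearbody m; destruct K as [r [t [E [Ht [Hr Hc]]]]].
  exists (2 * (4 * m * m + m * (2 * r + 1)) + t)%nat.
  assert (E2 : (n * (n + 1) = (2 * (4 * m * m + m * (2 * r + 1)) + t) * 2)%nat) by (rewrite E; nia).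
  split; [rewrite E2; apply Nat.div_mul; lia|split].
  - assert (E3 := f_equal Z.of_nat E2); rewrite !Nat2Z.inj_mul, Nat2Z.inj_add in E3.
    change (Z.of_nat 1) with 1%Z in E3; change (Z.of_nat 2) with 2%Z in E3.
    rewrite Nat2Z.inj_add, Nat2Z.inj_mul in *; change (Z.of_nat 2) with 2%Z in *; nia.
  - rewrite pow_add, pow_1_even, Rmult_1_l.
    rewrite (chi_congr _ (2 * Z.of_nat r + 1)), Hc by (rewrite E; lia).
    destruct (Nat.even t) eqn:Et.
    + apply Nat.even_spec in Et; destruct Et as [u ->]; now rewrite pow_1_even.
    + assert (Ot : Nat.odd t = true) by (unfold Nat.odd; now rewrite Et).
      apply Nat.odd_spec in Ot; destruct Ot as [u ->]; rewrite Nat.add_1_r, pow_1_odd; reflexivity.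
Qed.

(** Completing the square by 8k + 1 = (2n + 1)^2 produces the factor e^y; (-1)^k is absorbed by
    [chi], and the 1/2 comes from counting both signs of 2n + 1. *)
Lemma psi_th_chi y : 0 < y -> psi (- exp (- (8 * y))) = exp y * th chi y / 2.
Proof.
  intros Hy.
  set (f := fun n : Z => IZR (chi (2 * n + 1)) * exp (- (y * IZR ((2 * n + 1) * (2 * n + 1))))).
  assert (Ef : tsum f = th chi y).
  { apply (tsum_bij _ _ (fun n => (2 * n + 1)%Z) (fun n => ((n - 1) / 2)%Z)).
    - apply summable_th; auto with bnd.
    - intros n _; split; [lia|reflexivity].
    - intros n Hn.
      assert (Hn' : (2 * ((n - 1) / 2) + 1 = n)%Z).
      { destruct (chi_cases n) as [[_ E]|[E _]]; [|lia].
        exfalso; apply Hn; rewrite E; ring. }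
      unfold f; rewrite Hn'; auto. }
  assert (Hs : is_series (fun n => f (Z.of_nat n)) (tsum f / 2)).
  { apply tsum_symmetric_series.
    - apply (summable_comp (fun n => IZR (chi n) * exp (- (y * IZR (n * n)))) (fun n => (2 * n + 1)%Z)).
      + intros; lia.
      + apply summable_th; auto with bnd.
    - intros n; unfold f; replace (2 * (-1 - n) + 1)%Z with (- (2 * n + 1))%Z by ring.
      rewrite chi_opp, Z.mul_opp_opp; auto. }
  apply (is_series_scal (exp y)) in Hs; rewrite Ef in Hs; unfold psi.
  transitivity (scal (exp y) (th chi y / 2)); [|change (exp y * (th chi y / 2) = exp y * th chi y / 2); field].
  apply is_series_unique; revert Hs; apply is_series_ext; intros n.
  destruct (triangular_sign n) as [k [-> [E1 E2]]].
  change (exp y * f (Z.of_nat n) = (- exp (- (8 * y))) ^ k); unfold f; rewrite E1, E2.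
  replace (- exp (- (8 * y))) with (-1 * exp (- (8 * y))) by ring.
  rewrite Rpow_mult_distr, exp_pow, plus_IZR, mult_IZR, <- INR_IZR_INZ.
  replace (- (y * (8 * INR k + 1))) with (- y + INR k * - (8 * y)) by ring.
  rewrite exp_plus, exp_Ropp; field; apply Rgt_not_eq, exp_pos.
Qed.

(** * Theta constants in the variable t *)

Definition G (t : R) : R := th chi (PI * t / 8).

Lemma PI_mult_pos t : 0 < t -> 0 < PI * t.
Proof. intros; apply Rmult_lt_0_compat; auto; apply PI_RGT_0. Qed.

Lemma G_pos t : 0 < t -> 0 < G t.
Proof. intros Ht; apply th_chi_pos; assert (H := PI_mult_pos t Ht); lra. Qed.

(** The exponential in the denominator is exactly what cancels the factors e^y of [psi_th_chi]. The
    exponents enter through equations, so that each displayed form costs only a field identity. *)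
Lemma psi_ratio (A B D s t : R) : 0 < s -> 0 < t ->
  A = - (PI * s) -> B = - (PI * t) -> D = - (PI * ((t - s) / 8)) ->
  psi (- exp A) / (exp D * psi (- exp B)) = G s / G t.
Proof.
  intros Hs Ht -> -> ->; assert (H1 := PI_mult_pos s Hs); assert (H2 := PI_mult_pos t Ht).
  replace (PI * s) with (8 * (PI * s / 8)) at 1 by field.
  replace (PI * t) with (8 * (PI * t / 8)) at 1 by field.
  rewrite !psi_th_chi by lra; fold (G s) (G t).
  replace (PI * s / 8) with (PI * t / 8 + - (PI * ((t - s) / 8))) by field.
  rewrite exp_plus; assert (Gt := G_pos t Ht).
  field; repeat split; try (apply Rgt_not_eq, exp_pos); lra.
Qed.

(* Jacobi's theta constants th2, th3, th4 at the nome e^{- pi t}. *)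
Definition P2 (t : R) : R := th odd (PI * t / 4).
Definition P3 (t : R) : R := th ones (PI * t).
Definition P4 (t : R) : R := th sgn (PI * t).

Lemma P2_inv t : 0 < t -> P2 (/ t) = sqrt t * P4 t.
Proof.
  intros Ht; assert (P := PI_RGT_0); unfold P2, P4.
  replace (PI * / t / 4) with (PI ^ 2 / (4 * (PI * t))) by (field; lra).
  rewrite odd_inv by now apply PI_mult_pos.
  do 2 f_equal; field; lra.
Qed.

Lemma sqrt_sqrt_inv t : 0 < t -> sqrt t * sqrt (/ t) = 1.
Proof.
  intros Ht; rewrite <- sqrt_mult; [|lra|left; now apply Rinv_0_lt_compat].
  rewrite Rinv_r by lra; apply sqrt_1.
Qed.

Lemma P4_inv t : 0 < t -> P4 (/ t) = sqrt t * P2 t.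
Proof.
  intros Ht; assert (H := P2_inv (/ t) ltac:(now apply Rinv_0_lt_compat)).
  rewrite Rinv_inv in H; rewrite H, <- Rmult_assoc, sqrt_sqrt_inv by auto; ring.
Qed.

Lemma P3_inv t : 0 < t -> P3 (/ t) = sqrt t * P3 t.
Proof.
  intros Ht; assert (P := PI_RGT_0); unfold P3.
  replace (PI * / t) with (PI ^ 2 / (PI * t)) by (field; lra).
  rewrite th_ones_inv by now apply PI_mult_pos.
  do 2 f_equal; field; lra.
Qed.

Lemma P2_pos t : 0 < t -> 0 < P2 t.
Proof. intros Ht; apply th_odd_pos; assert (H := PI_mult_pos t Ht); lra. Qed.
Lemma P3_pos t : 0 < t -> 0 < P3 t.
Proof. intros Ht; now apply th_ones_pos, PI_mult_pos. Qed.
Lemma P4_pos t : 0 < t -> 0 < P4 t.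
Proof. intros Ht; now apply th_sgn_pos, PI_mult_pos. Qed.

Lemma G_square t : 0 < t -> G t ^ 2 = 2 * (P2 t * P4 t).
Proof.
  intros Ht; unfold G, P2, P4; assert (H := PI_mult_pos t Ht).
  rewrite chi_square by lra; do 2 f_equal; f_equal; field.
Qed.

Lemma eq_of_squares (x y : R) : 0 <= x -> 0 <= y -> x ^ 2 = y ^ 2 -> x = y.
Proof. intros Hx Hy H; rewrite <- (sqrt_pow2 x), <- (sqrt_pow2 y), H; auto. Qed.

(** Inversion exchanges the factors of G^2 = 2 P2 P4; positivity selects the root. *)
Lemma G_inv t : 0 < t -> G (/ t) = sqrt t * G t.
Proof.
  intros Ht; assert (Ht' : 0 < / t) by now apply Rinv_0_lt_compat.
  assert (H1 := G_pos _ Ht); assert (H2 := G_pos _ Ht'); assert (H3 := sqrt_lt_R0 t Ht).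
  apply eq_of_squares; [lra|nra|].
  rewrite Rpow_mult_distr, !G_square, P2_inv, P4_inv by auto; ring.
Qed.

Lemma G_cubic t : 0 < t -> G t ^ 4 + G (3 * t) ^ 4 = G (3 * t) * (G (t / 3) + G (3 * t)) ^ 3.
Proof.
  intros Ht; assert (H := PI_mult_pos t Ht).
  assert (C := chi_cubic (PI * t / 24) ltac:(lra)); unfold G.
  replace (PI * t / 8) with (3 * (PI * t / 24)) by field.
  replace (PI * (3 * t) / 8) with (9 * (PI * t / 24)) by field.
  replace (PI * (t / 3) / 8) with (PI * t / 24) by field; auto.
Qed.

Lemma P_degree3 t : 0 < t -> P3 t * P3 (3 * t) = P2 t * P2 (3 * t) + P4 t * P4 (3 * t).
Proof.
  intros Ht; assert (H := PI_mult_pos t Ht); unfold P2, P3, P4.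
  assert (C := theta_degree3 (PI * t / 4) ltac:(lra)).
  replace (4 * (PI * t / 4)) with (PI * t) in C by field.
  replace (12 * (PI * t / 4)) with (PI * (3 * t)) in C by field.
  replace (3 * (PI * t / 4)) with (PI * (3 * t) / 4) in C by field; auto.
Qed.

(** By the duplication formulas the products in the [theta15] identities, taken at pi t / 8, are
    products of these roots: for the pair (t, 15t), [odd] gives 2ab, [chi] gives 2ac and [sgn] at
    doubled argument gives bc. [OO], [XX] and [SS] state this for any pair. *)
Lemma P_degree15 t (a := sqrt (P2 t * P2 (15 * t))) (b := sqrt (P3 t * P3 (15 * t)))
    (c := sqrt (P4 t * P4 (15 * t))) (a' := sqrt (P2 (3 * t) * P2 (5 * t)))
    (b' := sqrt (P3 (3 * t) * P3 (5 * t))) (c' := sqrt (P4 (3 * t) * P4 (5 * t))) :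
  0 < t ->
  (a' ^ 2 = a * (b + c) /\ b' ^ 2 = b * (a + c) /\ c' ^ 2 = c * (a + b) /\ a' * (b' - c') = a ^ 2) /\
  (G t * G (15 * t) = 2 * (a * c) /\ G (3 * t) * G (5 * t) = 2 * (a' * c')).
Proof.
  intros Ht; assert (H := PI_mult_pos t Ht).
  assert (T : forall k, 0 < k -> 0 < k * t) by (intros; now apply Rmult_lt_0_compat).
  assert (S2 : forall u v, 0 < u -> 0 < v -> sqrt (P2 u * P2 v) ^ 2 = P2 u * P2 v).
  { intros u v Hu Hv; apply pow2_sqrt, Rmult_le_pos; left; now apply P2_pos. }
  assert (S3 : forall u v, 0 < u -> 0 < v -> sqrt (P3 u * P3 v) ^ 2 = P3 u * P3 v).
  { intros u v Hu Hv; apply pow2_sqrt, Rmult_le_pos; left; now apply P3_pos. }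
  assert (S4 : forall u v, 0 < u -> 0 < v -> sqrt (P4 u * P4 v) ^ 2 = P4 u * P4 v).
  { intros u v Hu Hv; apply pow2_sqrt, Rmult_le_pos; left; now apply P4_pos. }
  assert (N : forall u v, 0 <= sqrt u * sqrt v) by (intros; apply Rmult_le_pos; apply sqrt_pos).
  assert (OO : forall u v, 0 < u -> 0 < v -> th odd (PI * u / 8) * th odd (PI * v / 8)
    = 2 * (sqrt (P2 u * P2 v) * sqrt (P3 u * P3 v))).
  { intros u v Hu Hv; assert (Hu' := PI_mult_pos u Hu); assert (Hv' := PI_mult_pos v Hv).
    apply eq_of_squares.
    - apply Rmult_le_pos; left; apply th_odd_pos; lra.
    - specialize (N (P2 u * P2 v) (P3 u * P3 v)); lra.
    - rewrite !Rpow_mult_distr, !odd_square, S2, S3 by lra; unfold P2, P3.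
      replace (2 * (PI * u / 8)) with (PI * u / 4) by field; replace (8 * (PI * u / 8)) with (PI * u) by field.
      replace (2 * (PI * v / 8)) with (PI * v / 4) by field; replace (8 * (PI * v / 8)) with (PI * v) by field.
      ring. }
  assert (XX : forall u v, 0 < u -> 0 < v -> G u * G v = 2 * (sqrt (P2 u * P2 v) * sqrt (P4 u * P4 v))).
  { intros u v Hu Hv; apply eq_of_squares.
    - apply Rmult_le_pos; left; now apply G_pos.
    - specialize (N (P2 u * P2 v) (P4 u * P4 v)); lra.
    - rewrite !Rpow_mult_distr, !G_square, S2, S4 by lra; ring. }
  assert (SS : forall u v, 0 < u -> 0 < v -> th sgn (2 * (PI * u)) * th sgn (2 * (PI * v))
    = sqrt (P3 u * P3 v) * sqrt (P4 u * P4 v)).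
  { intros u v Hu Hv; assert (Hu' := PI_mult_pos u Hu); assert (Hv' := PI_mult_pos v Hv).
    apply eq_of_squares.
    - apply Rmult_le_pos; left; apply th_sgn_pos; lra.
    - apply N.
    - rewrite !Rpow_mult_distr, !sgn_square, S3, S4 by lra; unfold P3, P4; ring. }
  assert (H15 := T 15 ltac:(lra)); assert (H3 := T 3 ltac:(lra)); assert (H5 := T 5 ltac:(lra)).
  assert (E1 := theta15_odd (PI * t / 8) ltac:(lra)).
  assert (E2 := theta15_ones (PI * t / 8) ltac:(lra)).
  assert (E3 := theta15_sgn (PI * t / 8) ltac:(lra)).
  assert (E4 := theta15_chi (PI * t / 8) ltac:(lra)).
  replace (15 * (PI * t / 8)) with (PI * (15 * t) / 8) in E1, E2, E3 by field.
  replace (3 * (PI * t / 8)) with (PI * (3 * t) / 8) in E4 by field.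
  replace (5 * (PI * t / 8)) with (PI * (5 * t) / 8) in E4 by field.
  replace (6 * (PI * t / 8)) with (PI * (3 * t) / 4) in E1 by field.
  replace (10 * (PI * t / 8)) with (PI * (5 * t) / 4) in E1 by field.
  replace (24 * (PI * t / 8)) with (PI * (3 * t)) in E2, E3 by field.
  replace (40 * (PI * t / 8)) with (PI * (5 * t)) in E2, E3 by field.
  replace (16 * (PI * t / 8)) with (2 * (PI * t)) in E2, E3 by field.
  replace (240 * (PI * t / 8)) with (2 * (PI * (15 * t))) in E2, E3 by field.
  replace (2 * (PI * t / 8)) with (PI * t / 4) in E4 by field.
  replace (30 * (PI * t / 8)) with (PI * (15 * t) / 4) in E4 by field.
  rewrite OO in E1, E2, E4 by auto; rewrite SS in E2, E3 by auto.
  fold (G t) (G (15 * t)) (G (3 * t)) (G (5 * t)) in E1, E3, E4; rewrite XX in E1, E3, E4 by auto.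
  fold (P2 t) (P2 (3 * t)) (P2 (5 * t)) (P2 (15 * t)) in E1, E4.
  fold (P3 (3 * t)) (P3 (5 * t)) in E2; fold (P4 (3 * t)) (P4 (5 * t)) in E3.
  rewrite <- (S2 (3 * t) (5 * t)) in E1 by auto; rewrite <- (S3 (3 * t) (5 * t)) in E2 by auto.
  rewrite <- (S4 (3 * t) (5 * t)) in E3 by auto; rewrite <- (S2 t (15 * t)) in E4 by auto.
  fold a b c a' b' c' in E1, E2, E3, E4.
  split; [repeat split; lra|split; apply XX; auto].
Qed.

(** * Evaluation *)

(** Here u = a / b and v = c / b. Since 4uv = p^2 - d^2 with d = v - u, the cubic constraint becomes
    p d^2 = p^2 + p - 1, and the two equations in k serve to eliminate k. *)
Lemma sum_of_moduli_eq (u v k : R) (p := u + v) : 0 < u -> 0 < v -> 0 < k ->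
  0 < 1 - u ^ 2 - v ^ 2 ->
  (1 + v - u) * (1 - u - v) * (1 + u - v) = 4 * (u * v) ->
  u * (1 + v) + k ^ 2 * (v * (1 + u)) = k * (u + v) ->
  k ^ 2 * u ^ 2 + v ^ 2 = k ->
  0 < p < 1 /\ 4 * (u * v) * p = (1 - p) ^ 2 * (1 + p) /\ p ^ 2 + (3 - sqrt 5) * p - 1 = 0.
Proof.
  intros Hu Hv Hk Hb C K1 K2.
  assert (Hr : 0 < u * v) by (now apply Rmult_lt_0_compat).
  assert (Hp : 0 < p) by (unfold p; lra).
  assert (R1 : 4 * (u * v) * p = (1 - p) ^ 2 * (1 + p)).
  { unfold p; nra. }
  assert (Hp1 : p < 1).
  { assert (E : 0 < (1 - p) * (1 + p) ^ 2).
    { replace ((1 - p) * (1 + p) ^ 2) with (2 * p * (1 - u ^ 2 - v ^ 2)).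
      - apply Rmult_lt_0_compat; lra.
      - replace (2 * p * (1 - u ^ 2 - v ^ 2)) with (2 * p * (1 - p ^ 2) + 4 * (u * v) * p)
          by (unfold p; ring).
        rewrite R1; ring. }
    assert (0 < (1 + p) ^ 2) by (apply pow_lt; lra).
    assert (0 < 1 - p); [|lra].
    apply (Rmult_lt_reg_r ((1 + p) ^ 2)); lra. }
  (* Divided by k, both equations become linear in z and d y, with coefficients polynomial in p, d^2
     and uv; the relation z^2 - y^2 = 4 then closes the system. *)
  set (z := k + / k); set (y := / k - k); set (d := v - u).
  assert (Zy : z ^ 2 - y ^ 2 = 4) by (unfold z, y; field; lra).
  assert (D2 : p * d ^ 2 = p ^ 2 + p - 1).
  { replace (p * d ^ 2) with (p ^ 3 - 4 * (u * v) * p) by (unfold p, d; ring); rewrite R1; ring. }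
  assert (E1 : d * y = (p + 2 * (u * v)) * z - 2 * p).
  { assert (E : u * (1 + v) / k + k * (v * (1 + u)) = u + v).
    { apply (Rmult_eq_reg_l k); [|lra]; rewrite <- K1; field; lra. }
    replace (2 * p) with (2 * (u * (1 + v) / k + k * (v * (1 + u)))) by (unfold p; rewrite E; ring).
    unfold d, y, p, z; field; lra. }
  assert (E2 : (p ^ 2 + d ^ 2) * z + 2 * p * (d * y) = 4).
  { assert (E : k * u ^ 2 + v ^ 2 / k = 1).
    { apply (Rmult_eq_reg_l k); [|lra]; transitivity (k ^ 2 * u ^ 2 + v ^ 2); [field; lra|lra]. }
    transitivity (4 * (k * u ^ 2 + v ^ 2 / k)); [|rewrite E; ring].
    unfold d, y, p, z; field; lra. }
  set (q := p ^ 2 + 2 * p - 1).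
  assert (Qz : q * z = 4 * p).
  { rewrite E1 in E2.
    assert (E : (p ^ 2 + 1) * (q * z) = (p ^ 2 + 1) * (4 * p)).
    { transitivity (((3 * p ^ 3 + p * d ^ 2) + p * (4 * (u * v) * p)) * z).
      - rewrite R1, D2; unfold q; ring.
      - transitivity (p * ((p ^ 2 + d ^ 2) * z + 2 * p * ((p + 2 * (u * v)) * z - 2 * p)) + 4 * p ^ 3); [ring|].
        rewrite E2; ring. }
    apply Rmult_eq_reg_l in E; auto; nra. }
  assert (Qy : q * (d * y) = 2 * (1 - p ^ 2)).
  { apply (Rmult_eq_reg_l p); [|lra]; rewrite E1.
    transitivity ((p ^ 2 + (4 * (u * v) * p) / 2) * (q * z) - 2 * p ^ 2 * q); [field|].
    rewrite Qz, R1; unfold q; field. }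
  (* This is z^2 - y^2 = 4 multiplied by q^2 p d^2 / 4, after inserting [Qz], [Qy] and [D2]. *)
  assert (F : (p ^ 2 + p - 1) * (4 * p ^ 2 - q ^ 2) = p * (1 - p ^ 2) ^ 2).
  { rewrite <- D2.
    transitivity (p * d ^ 2 * ((q * z) ^ 2 - 4 * q ^ 2) / 4); [rewrite Qz; field|].
    transitivity (p * (q * (d * y)) ^ 2 / 4); [|rewrite Qy; field].
    replace (4 * q ^ 2) with ((z ^ 2 - y ^ 2) * q ^ 2) by (rewrite Zy; ring); field. }
  assert (F' : (p ^ 2 + p - 1) * (p ^ 2 + 4 * p - 1) = p * (1 - p ^ 2)).
  { apply (Rmult_eq_reg_l (1 - p ^ 2)); [|nra].
    transitivity ((p ^ 2 + p - 1) * (4 * p ^ 2 - q ^ 2)); [unfold q; ring|rewrite F; ring]. }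
  repeat split; auto.
  assert (S5 : sqrt 5 ^ 2 = 5) by (apply pow2_sqrt; lra).
  assert (S50 := sqrt_pos 5).
  assert (Pd : 0 <= p ^ 2 + p - 1) by (rewrite <- D2; apply Rmult_le_pos; [lra|apply pow2_ge_0]).
  (* [F'] is (p^2 + 3p - 1)^2 = 5 p^2. By [Pd] the second factor is positive. *)
  assert (FF : (p ^ 2 + (3 - sqrt 5) * p - 1) * (p ^ 2 + (3 + sqrt 5) * p - 1) = 0).
  { transitivity ((p ^ 2 + 3 * p - 1) ^ 2 - sqrt 5 ^ 2 * p ^ 2); [ring|rewrite S5; lra]. }
  apply Rmult_integral in FF; destruct FF as [FF|FF]; auto; nra.
Qed.

(** The two roots have product -1, so only one is positive, and the stated value is a positive
    root. *)
Lemma eigen_value (m : R) : 0 < m -> m ^ 2 - 1 = (3 + sqrt 5) * m ->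
  m = (sqrt 3 + 1) * (sqrt 5 + sqrt 3) / 2.
Proof.
  intros Hm E.
  assert (S5 : sqrt 5 ^ 2 = 5) by (apply pow2_sqrt; lra).
  assert (S3 : sqrt 3 ^ 2 = 3) by (apply pow2_sqrt; lra).
  assert (S50 := sqrt_lt_R0 5 ltac:(lra)); assert (S30 := sqrt_lt_R0 3 ltac:(lra)).
  set (s := sqrt 5) in *; set (r := sqrt 3) in *.
  set (m0 := (r + 1) * (s + r) / 2).
  assert (E0 : m0 ^ 2 - 1 = (3 + s) * m0).
  { assert (I : m0 = ((3 + s) + (r * s + r)) / 2).
    { unfold m0; replace 3 with (r ^ 2) by auto; field. }
    rewrite I; apply (Rmult_eq_reg_l 4); [|lra].
    transitivity ((3 + s) ^ 2 + 2 * (3 + s) * (r * s + r) + r ^ 2 * (s + 1) ^ 2 - 4); [field|].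
    rewrite S3; transitivity (2 * (3 + s) ^ 2 + 2 * (3 + s) * (r * s + r) + 2 * (s ^ 2 - 5)); [ring|].
    rewrite S5; field. }
  assert (P0 : 0 < m0) by (unfold m0; nra).
  assert (F : (m - m0) * (m + m0 - (3 + s)) = 0) by nra.
  apply Rmult_integral in F; destruct F as [F|F]; [lra|].
  exfalso; assert (m0 * m0 - m0 * (3 + s) = - (m0 * m)) by (replace m with (3 + s - m0) by lra; ring).
  nra.
Qed.

Lemma quindecic_value (a b c a' b' c' k : R) :
  0 < a -> 0 < b -> 0 < c -> 0 < a' -> 0 < b' -> 0 < c' -> 0 < k ->
  a' ^ 2 = a * (b + c) -> b' ^ 2 = b * (a + c) -> c' ^ 2 = c * (a + b) -> a' * (b' - c') = a ^ 2 ->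
  a' ^ 2 + k ^ 2 * c' ^ 2 = k * b' ^ 2 -> k ^ 2 * a ^ 2 + c ^ 2 = k * b ^ 2 ->
  a' * c' = (sqrt 3 + 1) * (sqrt 5 + sqrt 3) / 2 * (a * c).
Proof.
  intros Ha Hb Hc Ha' Hb' Hc' Hk E1 E2 E3 E4 K1 K2.
  (* The relation for a' (b' - c'), multiplied by b' + c', gives a (b' + c') = a' (b - c); adding
     the two isolates a' b'. *)
  assert (B : 2 * (a' * b') = a ^ 2 + b ^ 2 - c ^ 2).
  { apply (Rmult_eq_reg_l a); [|lra].
    assert (I : a ^ 2 * (b' + c') = a' * (b' ^ 2 - c' ^ 2)) by (rewrite <- E4; ring).
    rewrite E2, E3 in I.
    assert (J : a * (b' + c') = a' * (b - c)).
    { apply (Rmult_eq_reg_l a); [|lra]; transitivity (a ^ 2 * (b' + c')); [ring|rewrite I; ring]. }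
    transitivity (a * (a' * (b' - c')) + a' * (a * (b' + c'))); [ring|].
    rewrite E4, J; transitivity (a ^ 3 + a' ^ 2 * (b - c)); [ring|rewrite E1; ring]. }
  assert (C : 2 * (a' * c') = b ^ 2 - a ^ 2 - c ^ 2) by lra.
  (* Squaring [B] gives (a^2 + b^2 - c^2)^2 = 4ab (b + c)(a + c), from which a factor a + b + c
     splits off. *)
  assert (Cub : (b + c - a) * (b - a - c) * (b + a - c) = 4 * (a * b * c)).
  { apply (Rmult_eq_reg_l (a + b + c)); [|lra].
    assert (Sq : (2 * (a' * b')) ^ 2 = 4 * (a * (b + c)) * (b * (a + c))) by (rewrite <- E1, <- E2; ring).
    rewrite B in Sq; nra. }
  destruct (sum_of_moduli_eq (a / b) (c / b) k) as [Hp [R1 R2]]; auto.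
  - now apply Rdiv_lt_0_compat.
  - now apply Rdiv_lt_0_compat.
  - replace (1 - (a / b) ^ 2 - (c / b) ^ 2) with (2 * (a' * c') / b ^ 2) by (rewrite C; field; lra).
    apply Rdiv_lt_0_compat; [|now apply pow_lt].
    assert (0 < a' * c') by (now apply Rmult_lt_0_compat); lra.
  - transitivity ((b + c - a) * (b - a - c) * (b + a - c) / b ^ 3); [field; lra|].
    rewrite Cub; field; lra.
  - transitivity ((a' ^ 2 + k ^ 2 * c' ^ 2) / b ^ 2); [rewrite E1, E3; field; lra|].
    rewrite K1, E2; field; lra.
  - transitivity ((k ^ 2 * a ^ 2 + c ^ 2) / b ^ 2); [field; lra|rewrite K2; field; lra].
  - set (p := a / b + c / b) in *.
    (* By [C], a' c' / b^2 = (1 - p^2 + 2uv) / 2 with u = a / b and v = c / b; [R1] turns this into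
       a multiple of uv. *)
    assert (M : a' * c' = (1 + p) / (1 - p) * (a * c)).
    { apply (Rmult_eq_reg_l (2 * p * (1 - p) / b ^ 2)).
      - transitivity (p * (1 - p) * (1 - p ^ 2 + 2 * (a / b * (c / b)))).
        + transitivity (p * (1 - p) * (2 * (a' * c')) / b ^ 2); [field; lra|].
          rewrite C; unfold p; field; lra.
        + transitivity ((1 - p) * (p * (1 - p ^ 2)) + (1 - p) * (4 * (a / b * (c / b)) * p) / 2); [field; lra|].
          transitivity ((1 + p) * (4 * (a / b * (c / b)) * p) / 2).
          * rewrite R1; field.
          * field; lra.
      - apply Rgt_not_eq, Rdiv_lt_0_compat; [nra|now apply pow_lt]. }
    rewrite M; f_equal; apply eigen_value; [apply Rdiv_lt_0_compat; lra|].
    assert (S5 : sqrt 5 ^ 2 = 5) by (apply pow2_sqrt; lra).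
    (* Multiplying by the conjugate, (3 - sqrt 5)(3 + sqrt 5) = 4 reduces the claim to (3 - sqrt 5)
       p = 1 - p^2. *)
    apply (Rmult_eq_reg_l ((3 - sqrt 5) * (1 - p) ^ 2)).
    + transitivity ((3 - sqrt 5) * p * 4); [field; lra|].
      transitivity ((9 - sqrt 5 ^ 2) * ((1 + p) * (1 - p))); [|field; lra].
      rewrite S5; lra.
    + assert (sqrt 5 < 3) by (assert (H := sqrt_pos 5); nra).
      apply Rgt_not_eq, Rmult_lt_0_compat; [lra|apply pow_lt; lra].
Qed.

(** At t = 1 / sqrt 5 one has 5t = 1 / t, so inversion ties the constants at t to those at 5t; also
    15t = 3 sqrt 5, and 3t is inverse to sqrt 5 / 3. *)
Lemma G_sqrt5 : G (sqrt 5 / 3) = sqrt 3 * ((sqrt 3 + 1) * (sqrt 5 + sqrt 3) / 2) * G (3 * sqrt 5).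
Proof.
  assert (S5 : sqrt 5 ^ 2 = 5) by (apply pow2_sqrt; lra).
  assert (S3 : sqrt 3 ^ 2 = 3) by (apply pow2_sqrt; lra).
  assert (S50 := sqrt_lt_R0 5 ltac:(lra)); assert (S30 := sqrt_lt_R0 3 ltac:(lra)).
  set (t := / sqrt 5).
  assert (Ht : 0 < t) by (now apply Rinv_0_lt_compat).
  assert (I5 : 5 * t = sqrt 5) by (unfold t; field_simplify_eq; lra).
  assert (I15 : 15 * t = 3 * sqrt 5) by lra.
  assert (I3 : 3 * t = / (sqrt 5 / 3)) by (unfold t; field; lra).
  destruct (P_degree15 t Ht) as [[E1 [E2 [E3 E4]]] [G1 G2]].
  (* The degree 3 relation at t and at 5t supplies the two equations in k. *)
  assert (D1 := P_degree3 t Ht); assert (D5 := P_degree3 (sqrt 5) S50).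
  rewrite I5, I15 in *.
  set (l := sqrt (sqrt 5)).
  assert (L : 0 < l) by (now apply sqrt_lt_R0).
  assert (V2 : P2 t = l * P4 (sqrt 5)) by (now apply P2_inv).
  assert (V3 : P3 t = l * P3 (sqrt 5)) by (now apply P3_inv).
  assert (V4 : P4 t = l * P2 (sqrt 5)) by (now apply P4_inv).
  rewrite V2, V3, V4 in *.
  assert (Q2 := P2_pos _ S50); assert (Q3 := P3_pos _ S50); assert (Q4 := P4_pos _ S50).
  assert (H3 : 0 < 3 * t) by lra; assert (H15 : 0 < 3 * sqrt 5) by lra.
  assert (Q2' := P2_pos _ H3); assert (Q3' := P3_pos _ H3); assert (Q4' := P4_pos _ H3).
  assert (Q2'' := P2_pos _ H15); assert (Q3'' := P3_pos _ H15); assert (Q4'' := P4_pos _ H15).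
  assert (W2 : 0 < P2 (3 * t) * P2 (sqrt 5)) by (now apply Rmult_lt_0_compat).
  assert (W3 : 0 < P3 (3 * t) * P3 (sqrt 5)) by (now apply Rmult_lt_0_compat).
  assert (W4 : 0 < P4 (3 * t) * P4 (sqrt 5)) by (now apply Rmult_lt_0_compat).
  assert (X2 : 0 < l * P4 (sqrt 5) * P2 (3 * sqrt 5)) by (repeat apply Rmult_lt_0_compat; auto).
  assert (X3 : 0 < l * P3 (sqrt 5) * P3 (3 * sqrt 5)) by (repeat apply Rmult_lt_0_compat; auto).
  assert (X4 : 0 < l * P2 (sqrt 5) * P4 (3 * sqrt 5)) by (repeat apply Rmult_lt_0_compat; auto).
  assert (F := fun u (Hu : 0 < u) => pow2_sqrt u (Rlt_le _ _ Hu)).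
  assert (M := quindecic_value _ _ _ _ _ _ (P2 (sqrt 5) / P4 (sqrt 5))
    (sqrt_lt_R0 _ X2) (sqrt_lt_R0 _ X3) (sqrt_lt_R0 _ X4)
    (sqrt_lt_R0 _ W2) (sqrt_lt_R0 _ W3) (sqrt_lt_R0 _ W4) ltac:(now apply Rdiv_lt_0_compat) E1 E2 E3 E4).
  rewrite !F in M by auto.
  assert (M' := M ltac:(
    transitivity (P2 (sqrt 5) / P4 (sqrt 5) * P3 (sqrt 5) * P3 (3 * t));
    [ transitivity (P2 (sqrt 5) / P4 (sqrt 5) * (P4 (sqrt 5) * P2 (3 * t) + P2 (sqrt 5) * P4 (3 * t)));
      [field; lra|];
      replace (P4 (sqrt 5) * P2 (3 * t) + P2 (sqrt 5) * P4 (3 * t)) with (P3 (sqrt 5) * P3 (3 * t));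
      [ring|apply (Rmult_eq_reg_l l); lra]
    | ring ])
    ltac:(
    transitivity (l * (P2 (sqrt 5) / P4 (sqrt 5)) * (P2 (sqrt 5) * P2 (3 * sqrt 5) + P4 (sqrt 5) * P4 (3 * sqrt 5)));
    [ field; lra | rewrite <- D5; ring ])).
  (* Inverting G (3t) and G t, the common factors sqrt (sqrt 5) and G (sqrt 5) cancel and sqrt 3
     remains. *)
  clear M; assert (GG : G (3 * t) * G (sqrt 5) = (sqrt 3 + 1) * (sqrt 5 + sqrt 3) / 2 * (G t * G (3 * sqrt 5))).
  { rewrite G1, G2, M'; ring. }
  rewrite I3 in GG; unfold t in GG; rewrite !G_inv in GG by lra.
  rewrite sqrt_div in GG by lra; fold l in GG.
  assert (Gp := G_pos (sqrt 5) S50).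
  apply (Rmult_eq_reg_l (l / sqrt 3 * G (sqrt 5))).
  - transitivity (l / sqrt 3 * G (sqrt 5 / 3) * G (sqrt 5)); [ring|rewrite GG; field; lra].
  - apply Rgt_not_eq; repeat apply Rmult_lt_0_compat; auto; now apply Rinv_0_lt_compat.
Qed.

(** * From the values of [G] to the quotients *)

Lemma Rpower_root (x y : R) (n : nat) : (0 < n)%nat -> 0 < y -> y ^ n = x -> Rpower x (1 / INR n) = y.
Proof.
  intros Hn Hy <-; rewrite <- (Rpower_pow n y Hy), Rpower_mult.
  replace (INR n * (1 / INR n)) with 1 by (field; apply not_0_INR; lia).
  now apply Rpower_1.
Qed.

Lemma Rpower_fourth_root (x y : R) : 0 < y -> y ^ 4 = x -> Rpower x (1 / 4) = y.
Proof. intros; replace 4 with (INR 4) by (simpl; ring); apply Rpower_root; auto; lia. Qed.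

Lemma sqrt_sqrt_pow4 x : 0 <= x -> sqrt (sqrt x) ^ 4 = x.
Proof.
  intros Hx; replace (sqrt (sqrt x) ^ 4) with ((sqrt (sqrt x) ^ 2) ^ 2) by ring.
  rewrite !pow2_sqrt; auto using sqrt_pos.
Qed.

(** The arguments r/5, 3r/5 and r/15 are the inverses of r, r/3 and 3r, so [G_sqrt5] is the only
    input beyond inversion. *)
Lemma evaluations_sqrt5 (r := sqrt 5) (f := sqrt r) (m := (sqrt 3 + 1) * (sqrt 5 + sqrt 3) / 2) :
  G (r / 5) = f * G r /\ G (3 * r / 5) = f * m * G (3 * r) /\
  G (r / 15) = sqrt 3 * f * G (3 * r) /\ G (r / 3) = sqrt 3 * m * G (3 * r).
Proof.
  assert (S5 : r ^ 2 = 5) by (apply pow2_sqrt; lra).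
  assert (R0 : 0 < r) by (apply sqrt_lt_R0; lra); assert (S30 := sqrt_lt_R0 3 ltac:(lra)).
  assert (I1 : r / 5 = / r) by (apply (Rmult_eq_reg_l r); [field_simplify; lra|lra]).
  assert (I2 : 3 * r / 5 = / (r / 3)) by (replace (3 * r / 5) with (3 * (r / 5)) by field; rewrite I1; field; lra).
  assert (I3 : r / 15 = / (3 * r)) by (replace (r / 15) with (/ 3 * (r / 5)) by field; rewrite I1; field; lra).
  assert (V := G_sqrt5); fold r in V; fold m in V.
  rewrite I1, I2, I3, !G_inv, sqrt_div, sqrt_mult, V by lra; fold f.
  repeat split; auto; unfold m; fold r; field; lra.
Qed.

(** At t = r/3 = 1/r, inversion gives G (r/3)^4 = 3 G(r)^4, so the cubic relation becomes 4 G(r)^3 =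
    (G(r/9) + G(r))^3: hence the cube root of 4. *)
Lemma evaluations_sqrt3 (r := sqrt 3) (h := sqrt r) (c := Rpower 4 (1 / 3)) :
  G (r / 3) = h * G r /\ G (r / 9) = (c - 1) * G r /\ G (r / 9) = r * h * G (3 * r) /\
  0 < c - 1.
Proof.
  assert (S3 : r ^ 2 = 3) by (apply pow2_sqrt; lra).
  assert (R0 : 0 < r) by (apply sqrt_lt_R0; lra).
  assert (I1 : r / 3 = / r) by (apply (Rmult_eq_reg_l r); [field_simplify; lra|lra]).
  assert (I3 : r / 9 = / (3 * r)) by (replace (r / 9) with (/ 3 * (r / 3)) by field; rewrite I1; field; lra).
  assert (H1 : G (r / 3) = h * G r) by (rewrite I1; now apply G_inv).
  assert (H3 : G (r / 9) = r * h * G (3 * r)) by (rewrite I3, G_inv, sqrt_mult by lra; reflexivity).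
  assert (Gr := G_pos r R0); assert (G9 := G_pos (r / 9) ltac:(lra)).
  assert (C := G_cubic (r / 3) ltac:(lra)).
  replace (3 * (r / 3)) with r in C by field; replace (r / 3 / 3) with (r / 9) in C by field.
  rewrite H1, Rpow_mult_distr in C; unfold h in C; unfold r in C at 1.
  rewrite sqrt_sqrt_pow4 in C by lra.
  assert (E : Rpower 4 (1 / INR 3) = (G (r / 9) + G r) / G r).
  { apply Rpower_root; [lia|apply Rdiv_lt_0_compat; lra|].
    transitivity (G r * (G (r / 9) + G r) ^ 3 / G r ^ 4); [field; lra|rewrite <- C; field; lra]. }
  replace (INR 3) with 3 in E by (simpl; ring); fold c in E.
  assert (H2 : G (r / 9) = (c - 1) * G r) by (rewrite E; field; lra).
  repeat split; auto.
  apply (Rmult_lt_reg_r (G r)); lra.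
Qed.

(** The cubic relation at t = 1, with G (1/3) inverted, says that the fourth power is (sqrt 3 + 1)^3
    - 1. *)
Lemma evaluations_1 : G (1 / 3) = sqrt 3 * G 3 /\ (G 1 / G 3) ^ 4 = 3 * sqrt 3 * (2 + sqrt 3).
Proof.
  assert (S3 : sqrt 3 ^ 2 = 3) by (apply pow2_sqrt; lra).
  assert (H : G (1 / 3) = sqrt 3 * G 3) by (unfold Rdiv; rewrite Rmult_1_l; apply G_inv; lra).
  split; auto; assert (C := G_cubic 1 ltac:(lra)); assert (P := G_pos 3 ltac:(lra)).
  rewrite Rmult_1_r, H in C.
  transitivity ((G 1 ^ 4 + G 3 ^ 4) / G 3 ^ 4 - 1); [field; lra|rewrite C].
  transitivity ((sqrt 3 + 1) ^ 3 - 1); [field; lra|].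
  replace ((sqrt 3 + 1) ^ 3 - 1) with (sqrt 3 * sqrt 3 ^ 2 + 3 * sqrt 3 ^ 2 + 3 * sqrt 3) by ring.
  replace (3 * sqrt 3 * (2 + sqrt 3)) with (6 * sqrt 3 + 3 * sqrt 3 ^ 2) by ring.
  rewrite S3; ring.
Qed.

Ltac args I := unfold Rdiv; rewrite ?Rinv_mult, ?I; field.

Theorem theorem5p4 :
  (* (i) *)
  psi (- exp (- PI / sqrt 5)) / (exp (- PI / (2 * sqrt 5)) * psi (- exp (- sqrt 5 * PI)))
    = Rpower 5 (1/4)
  /\ (* (ii) *)
  psi (- exp (- 3 * PI / sqrt 5)) / (exp (- 3 * PI / (2 * sqrt 5)) * psi (- exp (- 3 * sqrt 5 * PI)))
    = Rpower 5 (1/4) * (sqrt 3 + 1) * (sqrt 5 + sqrt 3) / 2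
  /\ (* (iii) *)
  psi (- exp (- PI / (3 * sqrt 5))) / (exp (- PI / (3 * sqrt 5)) * psi (- exp (- 3 * PI / sqrt 5)))
    = sqrt 3 * (sqrt 3 - 1) * (sqrt 5 - sqrt 3) / 2
  /\ (* (iv) *)
  psi (- exp (- PI / (3 * sqrt 3))) / (exp (- PI / (12 * sqrt 3)) * psi (- exp (- PI / sqrt 3)))
    = Rpower 3 (- (1/4)) * (Rpower 4 (1/3) - 1)
  /\ (* (v) *)
  psi (- exp (- PI)) / (exp (- PI / 4) * psi (- exp (- 3 * PI)))
    = Rpower (3 * sqrt 3 * (2 + sqrt 3)) (1/4)
  /\ (* (vi) *)
  psi (- exp (- PI / (3 * sqrt 5))) / (exp (- PI / (6 * sqrt 5)) * psi (- exp (- sqrt 5 * PI / 3)))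
    = Rpower 5 (1/4) * (sqrt 3 - 1) * (sqrt 5 - sqrt 3) / 2
  /\ (* (vii) *)
  psi (- exp (- sqrt 5 * PI / 3)) / (exp (- sqrt 5 * PI / 3) * psi (- exp (- 3 * sqrt 5 * PI)))
    = sqrt 3 * (sqrt 3 + 1) * (sqrt 5 + sqrt 3) / 2
  /\ (* (viii) *)
  psi (- exp (- PI / sqrt 3)) / (exp (- PI / (4 * sqrt 3)) * psi (- exp (- sqrt 3 * PI)))
    = Rpower 3 (1/4)
  /\ (* (ix) *)
  psi (- exp (- sqrt 3 * PI)) / (exp (- sqrt 3 * PI / 4) * psi (- exp (- 3 * sqrt 3 * PI)))
    = Rpower 27 (1/4) / (Rpower 4 (1/3) - 1)
  /\ (* (x) *)
  psi (- exp (- PI / 3)) / (exp (- PI / 3) * psi (- exp (- 3 * PI)))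
    = sqrt 3
  /\ (* (xi) *)
  psi (- exp (- PI / 3)) / (exp (- PI / 12) * psi (- exp (- PI)))
    = Rpower (sqrt 3 * (2 - sqrt 3)) (1/4)
  /\ (* (xii) *)
  psi (- exp (- PI / sqrt 3)) / (exp (- PI / sqrt 3) * psi (- exp (- 3 * sqrt 3 * PI)))
    = 3 / (Rpower 4 (1/3) - 1)
  /\ (* (xiii) *)
  psi (- exp (- PI / (3 * sqrt 3))) / (exp (- PI / (3 * sqrt 3)) * psi (- exp (- sqrt 3 * PI)))
    = Rpower 4 (1/3) - 1.
Proof.
  assert (S5 : sqrt 5 ^ 2 = 5) by (apply pow2_sqrt; lra).
  assert (S3 : sqrt 3 ^ 2 = 3) by (apply pow2_sqrt; lra).
  assert (S50 := sqrt_lt_R0 5 ltac:(lra)); assert (S30 := sqrt_lt_R0 3 ltac:(lra)).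
  (* The exponents carry the root above or below the fraction bar; all arguments are brought to
     rational multiples of the root. *)
  assert (I5 : / sqrt 5 = sqrt 5 / 5) by (apply (Rmult_eq_reg_l (sqrt 5)); [field_simplify; lra|lra]).
  assert (I3 : / sqrt 3 = sqrt 3 / 3) by (apply (Rmult_eq_reg_l (sqrt 3)); [field_simplify; lra|lra]).
  assert (F5 : Rpower 5 (1 / 4) = sqrt (sqrt 5))
    by (apply Rpower_fourth_root; [now apply sqrt_lt_R0|apply sqrt_sqrt_pow4; lra]).
  assert (F3 : Rpower 3 (1 / 4) = sqrt (sqrt 3))
    by (apply Rpower_fourth_root; [now apply sqrt_lt_R0|apply sqrt_sqrt_pow4; lra]).
  assert (F27 : Rpower 27 (1 / 4) = sqrt 3 * sqrt (sqrt 3)).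
  { apply Rpower_fourth_root; [apply Rmult_lt_0_compat; auto; now apply sqrt_lt_R0|].
    rewrite Rpow_mult_distr, sqrt_sqrt_pow4 by lra.
    replace (sqrt 3 ^ 4) with ((sqrt 3 ^ 2) ^ 2) by ring; rewrite S3; ring. }
  assert (L5 := sqrt_lt_R0 _ S50); assert (L3 := sqrt_lt_R0 _ S30).
  assert (Q5 := G_pos _ S50); assert (Q53 := G_pos (3 * sqrt 5) ltac:(lra)).
  assert (Q3 := G_pos _ S30); assert (Q33 := G_pos (3 * sqrt 3) ltac:(lra)).
  assert (Q1 := G_pos 1 ltac:(lra)); assert (Q13 := G_pos 3 ltac:(lra)).
  destruct evaluations_sqrt5 as [A1 [A2 [A3 A4]]].
  destruct evaluations_sqrt3 as [B1 [B2 [B3 B4]]].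
  destruct evaluations_1 as [C1 C2].
  set (m := (sqrt 3 + 1) * (sqrt 5 + sqrt 3) / 2) in *.
  assert (Mp : 0 < m) by (unfold m; nra).
  (* The product with [m] is (3 - 1)(5 - 3) / 4 = 1. *)
  assert (Mi : (sqrt 3 - 1) * (sqrt 5 - sqrt 3) / 2 = / m).
  { apply (Rmult_eq_reg_l m); [|lra]; rewrite Rinv_r by lra; unfold m.
    transitivity ((sqrt 3 ^ 2 - 1) * (sqrt 5 ^ 2 - sqrt 3 ^ 2) / 4); [field|rewrite S3, S5; field]. }
  set (c := Rpower 4 (1 / 3)) in *.
  assert (D : (c - 1) * G (sqrt 3) = sqrt 3 * sqrt (sqrt 3) * G (3 * sqrt 3)) by (rewrite <- B2; auto).
  assert (Ev : G 1 / G 3 = Rpower (3 * sqrt 3 * (2 + sqrt 3)) (1 / 4)).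
  { symmetry; apply Rpower_fourth_root; auto; now apply Rdiv_lt_0_compat. }
  rewrite F3, F5, F27, Rpower_Ropp, F3.
  split; [|split; [|split; [|split; [|split; [|split; [|split; [|split; [|split; [|split; [|split; [|split]]]]]]]]]]].
  - rewrite (psi_ratio _ _ _ (sqrt 5 / 5) (sqrt 5)); [|lra|lra|args I5|args I5|args I5].
    rewrite A1; field; lra.
  - rewrite (psi_ratio _ _ _ (3 * sqrt 5 / 5) (3 * sqrt 5)); [|lra|lra|args I5|args I5|args I5].
    rewrite A2; unfold m; field; lra.
  - rewrite (psi_ratio _ _ _ (sqrt 5 / 15) (3 * sqrt 5 / 5)); [|lra|lra|args I5|args I5|args I5].
    transitivity (sqrt 3 * ((sqrt 3 - 1) * (sqrt 5 - sqrt 3) / 2)); [rewrite Mi, A2, A3|]; field; lra.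
  - rewrite (psi_ratio _ _ _ (sqrt 3 / 9) (sqrt 3 / 3)); [|lra|lra|args I3|args I3|args I3].
    rewrite B1, B2; field; lra.
  - rewrite (psi_ratio _ _ _ 1 3); [|lra|lra|field|field|field]; auto.
  - rewrite (psi_ratio _ _ _ (sqrt 5 / 15) (sqrt 5 / 3)); [|lra|lra|args I5|args I5|args I5].
    transitivity (sqrt (sqrt 5) * ((sqrt 3 - 1) * (sqrt 5 - sqrt 3) / 2)); [rewrite Mi, A3, A4|]; field; lra.
  - rewrite (psi_ratio _ _ _ (sqrt 5 / 3) (3 * sqrt 5)); [|lra|lra|args I5|args I5|args I5].
    rewrite A4; unfold m; field; lra.
  - rewrite (psi_ratio _ _ _ (sqrt 3 / 3) (sqrt 3)); [|lra|lra|args I3|args I3|args I3].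
    rewrite B1; field; lra.
  - rewrite (psi_ratio _ _ _ (sqrt 3) (3 * sqrt 3)); [|lra|lra|args I3|args I3|args I3].
    apply (Rmult_eq_reg_l ((c - 1) * G (3 * sqrt 3))); [|apply Rgt_not_eq, Rmult_lt_0_compat; lra].
    transitivity ((c - 1) * G (sqrt 3)); [|rewrite D]; field; lra.
  - rewrite (psi_ratio _ _ _ (1 / 3) 3); [|lra|lra|field|field|field].
    rewrite C1; field; lra.
  - rewrite (psi_ratio _ _ _ (1 / 3) 1); [|lra|lra|field|field|field].
    symmetry; apply Rpower_fourth_root.
    + rewrite C1; apply Rdiv_lt_0_compat; [apply Rmult_lt_0_compat|]; auto.
    (* The quotient is sqrt 3 / (G 1 / G 3), with fourth power 9 / (3 sqrt 3 (2 + sqrt 3)), which is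
       rationalised by 2 - sqrt 3. *)
    + rewrite C1; transitivity ((sqrt 3 ^ 2) ^ 2 / (G 1 / G 3) ^ 4); [field; lra|].
      rewrite C2, S3; apply (Rmult_eq_reg_l (3 * sqrt 3 * (2 + sqrt 3))); [|apply Rgt_not_eq; nra].
      transitivity (3 * sqrt 3 ^ 2 * (4 - sqrt 3 ^ 2)); [rewrite S3; field; lra|ring].
  - rewrite (psi_ratio _ _ _ (sqrt 3 / 3) (3 * sqrt 3)); [|lra|lra|args I3|args I3|args I3].
    rewrite B1; apply (Rmult_eq_reg_l ((c - 1) * G (3 * sqrt 3))); [|apply Rgt_not_eq, Rmult_lt_0_compat; lra].
    transitivity (sqrt (sqrt 3) * ((c - 1) * G (sqrt 3))); [field; lra|rewrite D].
    transitivity (sqrt 3 * sqrt (sqrt 3) ^ 2 * G (3 * sqrt 3)); [ring|].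
    rewrite pow2_sqrt by lra; transitivity (sqrt 3 ^ 2 * G (3 * sqrt 3)); [ring|rewrite S3; field; lra].
  - rewrite (psi_ratio _ _ _ (sqrt 3 / 9) (sqrt 3)); [|lra|lra|args I3|args I3|args I3].
    rewrite B2; field; lra.
Qed.
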